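(* Assume that for some $\alpha\in(0,1]$ the following holds. (i) There exist a function $\bar\varphi(t,s)$, a constant $a^2$ and a remainder $\mathscr R^1_\varepsilon(t,s)$ such that for $s,t\in[0,1]$ $$\mathrm{Cov}(X_{T_n+\varepsilon t}-X_{T_n},X_{T_n+\varepsilon s}-X_{T_n})=\varepsilon^2\big[a^2ts+\bar\varphi(t,s)\varepsilon^\alpha+\mathscr R^1_\varepsilon(t,s)\big],\qquad\lim_{\varepsilon\to0}\sup_{s,t\in[0,1]}\frac{|\mathscr R^1_\varepsilon(t,s)|}{\varepsilon^\alpha}=0.$$ (ii) For every fixed $T>0$ there exist a function $\bar\psi(t;T)$, a constant $c(T)$ and a remainder $\mathscr R^2_\varepsilon(t;T)$ such that for $t\in[0,1]$ $$k(T_n+\varepsilon t,T)-k(T_n,T)=\varepsilon\big[c(T)t+\bar\psi(t;T)\varepsilon^\alpha+\mathscr R^2_\varepsilon(t;T)\big],\qquad\lim_{\varepsilon\to0}\sup_{t\in[0,1]}\frac{|\mathscr R^2_\varepsilon(t;T)|}{\varepsilon^\alpha}=0.$$ Let $Y^n$ be the bridge of the $n$-fold conditional process $X^n$ with final value $y$ at time $T_n+\varepsilon$. Then the family of processes $\{(Y^n_{T_n+\varepsilon t})_{t\in[0,1]}\}_\varepsilon$ satisfies a large deviation principle on $C([0,1])$ as $\varepsilon\to0$, with inverse speed $\varepsilon^{2+\alpha}$ and good rate function $$J_Y(h)=\begin{cases}\frac12\|h-\bar m\|^2_{\bar{\mathscr H}_Y}&\text{if }h-\bar m\in\bar{\mathscr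 H}_Y,\\+\infty&\text{otherwise,}\end{cases}$$ where $\bar m_t=x_n+\bar\beta_t(y-x_n)$ and $\bar{\mathscr H}_Y$ is the reproducing kernel Hilbert space associated to the covariance function $$\bar k_Y(t,s)=\bar\varphi_n(t,s)+ts\,\bar\varphi_n(1,1)-t\,\bar\varphi_n(1,s)-s\,\bar\varphi_n(t,1).$$
   Context: Let $X=(X_t)_{t\ge0}$ be a continuous centered Gaussian process with continuous covariance function $k(t,s)=\mathrm{Cov}(X_t,X_s)$. Fix $n\in\mathbb N$, $n\ge1$, times $0<T_1<\dots<T_n$ and real numbers $x_1,\dots,x_n$, $y$. Set $X^0=X$, $k_0=k$ and, for $j=1,\dots,n$, $$\alpha_j(t)=\frac{k_{j-1}(t,T_j)}{k_{j-1}(T_j,T_j)},\qquad X^j_t=X^{j-1}_t-\alpha_j(t)(X^{j-1}_{T_j}-x_j),\qquad k_j(t,s)=k_{j-1}(t,s)-\alpha_j(t)k_{j-1}(s,T_j),$$ where it is assumed that $k_{j-1}(T_j,T_j)>0$. Then $k_j$ is the covariance function of $X^j$, and $X^n$ (the $n$-fold conditional process) has the law of $X$ conditioned on $X_{T_1}=x_1,\dots,X_{T_n}=x_n$. The bridge $Y^n$ (which depends on $\varepsilon$) is $X^n$ conditioned to be at $y$ at time $T_n+\varepsilon$; in law, $$Y^n_{T_n+\varepsilon t}=X^n_{T_n+\varepsilon t}-\beta^\varepsilon_{T_n+\varepsilon t}(X^n_{T_n+\varepsilon}-y),\qquad \beta^\varepsilon_{T_n+\varepsilon t}=\frac{k_n(T_n+\varepsilon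 t,T_n+\varepsilon)}{k_n(T_n+\varepsilon,T_n+\varepsilon)},\quad t\in[0,1],$$ and $\bar\beta_t=\lim_{\varepsilon\to0}\beta^\varepsilon_{T_n+\varepsilon t}$ (under the present assumptions $\bar\beta_t=\bar k_n(t,1)/\bar k_n(1,1)=t$, with $\bar k_n(t,s)=a_n^2ts$). Set $c_0=c$, $\bar\psi_0=\bar\psi$ and, for $j=1,\dots,n$, $c_j(T)=c_{j-1}(T)-\alpha_j(T)c_{j-1}(T_j)$, $\bar\psi_j(t;T)=\bar\psi_{j-1}(t;T)-\alpha_j(T)\bar\psi_{j-1}(t;T_j)$. Set $$a_n^2=a^2-\sum_{\ell=1}^n\frac{c_{\ell-1}^2(T_\ell)}{k_{\ell-1}(T_\ell,T_\ell)},\qquad \bar\varphi_n(t,s)=\bar\varphi(t,s)-\sum_{\ell=1}^n\frac{c_{\ell-1}(T_\ell)}{k_{\ell-1}(T_\ell,T_\ell)}\big(\bar\psi_{\ell-1}(t;T_\ell)\,s+\bar\psi_{\ell-1}(s;T_\ell)\,t\big),$$ and assume $a_n^2>0$. $C([0,1])$ is the space of continuous real paths on $[0,1]$ with the sup-norm. A family $\{U^\varepsilon\}_\varepsilon$ of $C([0,1])$-valued random variables satisfies a large deviation principle with inverse speed $\gamma_\varepsilon^2$ and good rate function $I$ if $\gamma_\varepsilon\to0$, the set $\{I\le a\}$ is compact for every real $a$, $\liminf_{\varepsilon\to0}\gamma_\varepsilon^2\log\mathbb P(U^\varepsilon\in G)\ge-\inf_GI$ for every open $G$, and $\limsup_{\varepsilon\to0}\gamma_\varepsilon^2\log\mathbb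 P(U^\varepsilon\in F)\le-\inf_FI$ for every closed $F$. The reproducing kernel Hilbert space of a continuous, symmetric, positive (semi)definite kernel $q$ on $[0,1]^2$ is the completion, inside $C([0,1])$, of the paths $h_t=\int_0^1q(t,s)\lambda(ds)$, $\lambda$ a signed Borel measure on $[0,1]$, with $\|h\|^2=\int_0^1\int_0^1q(t,s)\lambda(dt)\lambda(ds)$. *)

(* Defs.v *)
From HB Require Import structures.
From mathcomp Require Import all_boot all_order all_algebra.
From mathcomp Require Import all_classical all_reals all_analysis.

Set Implicit Arguments.
Unset Strict Implicit.
Unset Printing Implicit Defensive.

Import Order.TTheory GRing.Theory Num.Theory.
Import numFieldNormedType.Exports.

Local Open Scope classical_set_scope.
Local Open Scope ring_scope.

(* Topologizes [continuousType _ _] by uniform convergence, see [C01_nbhsP]. *)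
Import ArrowAsUniformType.

Section path_space.
Variable R : realType.

Definition unit_itv : topologicalType := set_type (`[0, 1]%classic : set R).

Definition C01 : uniformType := continuousType unit_itv R.

Lemma zero_path_continuous : continuous (fun _ : unit_itv => 0 : R).
Proof. exact: cst_continuous. Qed.

Definition C01_zero : C01 := mkcts zero_path_continuous.

(* The path f as an element of C([0, 1]). It is only meant for continuous f,
   see [to_C01E]; other functions are sent to the zero path. *)
Definition to_C01 (f : unit_itv -> R) : C01 :=
  match pselect (continuous f) with
  | left cf => mkcts cf
  | right _ => C01_zero
  end.

Definition C01_fun (h : C01) : unit_itv -> R :=
  (h : continuousType unit_itv R).

Lemma to_C01E (f : unit_itv -> R) : continuous f -> C01_fun (to_C01 f) = f.
Proof. by rewrite /to_C01 => cf; case: pselect. Qed.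

Lemma C01_nbhsP (h : C01) (A : set (C01)) :
  nbhs h A <-> exists2 e : R, 0 < e &
    forall g : C01, (forall t, `|C01_fun h t - C01_fun g t| < e) -> A g.
Proof.
rewrite -nbhs_entourageE; split.
- move=> [E [F [B entB sBF] sFE] sEA].
  have [e e0 eB] : exists2 e : R, 0 < e & [set xy : R*R | ball xy.1 e xy.2] `<=` B.
    by move: entB; rewrite -entourage_ballE => -[e /= e0 eB]; exists e.
  exists e => // g hg; apply/sEA/xsectionP/sFE => /=; apply: sBF => /= t.
  exact/eB/hg.
- move=> [e e0 eA].
  exists [set fg : C01 * C01 | forall t, ball (C01_fun fg.1 t) e (C01_fun fg.2 t)].
    exists [set fg | forall t, ball (fg.1 t) e (fg.2 t)]; last by [].
    exists [set xy | ball xy.1 e xy.2] => //.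
    by rewrite -entourage_ballE; exists e.
  by move=> g /xsectionP hg; apply: eA => t; exact: hg.
Qed.

End path_space.

Section large_deviations.
Context {R : realType} {d : measure_display} {Omega : measurableType d}.
Variable P : probability Omega R.

(* [v e] is the inverse speed, written gamma_e ^ 2 in the usual definition,
   so that [v e --> 0] is gamma_e --> 0. The second clause says that each U e
   is a random variable for the Borel sigma-algebra of S. Here
   [lne 0 = -oo] and the infimum over the empty set is [+oo]. *)
Definition satisfies_LDP {S : topologicalType} (U : R -> Omega -> S)
    (v : R -> R) (I : S -> \bar R) : Prop :=
  [/\ v e @[e --> 0^'+] --> (0 : R),
      forall e, 0 < e -> forall G : set S, open G -> measurable (U e @^-1` G),
      forall a : R, compact [set h | (I h <= a%:E)%E],
      forall G : set S, open G ->
        (- ereal_inf (I @` G) <=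
           limf_einf (fun e => (v e)%:E * lne (P (U e @^-1` G))) 0^'+)%E
    & forall F : set S, closed F ->
        (limf_esup (fun e => (v e)%:E * lne (P (U e @^-1` F))) 0^'+ <=
           - ereal_inf (I @` F))%E].

End large_deviations.

Section signed_measures.
Context {R : realType} {d : measure_display} {T : measurableType d}.
Variable nu : {charge set T -> \bar R}.

Definition hahn_pos : set T := sval (cid (Hahn_decomposition nu)).

Definition hahn_neg : set T := sval (cid (svalP (cid (Hahn_decomposition nu)))).

Definition hahn_PN : hahn_decomposition nu hahn_pos hahn_neg :=
  svalP (cid (svalP (cid (Hahn_decomposition nu)))).

(* Integral against a signed measure through its Jordan decomposition. *)
Definition charge_integral (D : set T) (f : T -> R) : R :=
  \int[jordan_pos hahn_PN]_(x in D) f x - \int[jordan_neg hahn_PN]_(x in D) f x.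

End signed_measures.

Section rkhs.
Context {R : realType}.
Variable q : R -> R -> R.

(* A signed Borel measure on [0, 1] is given as one on the real line of which
   only the restriction to [0, 1] is used. *)
Local Notation signed_measure :=
  ({charge set (measurableTypeR R) -> \bar R}).

Definition kernel_path (lam : signed_measure) (t : R) : R :=
  charge_integral lam `[0, 1] (fun s => q t s).

Definition kernel_sqnorm (lam : signed_measure) : R :=
  charge_integral lam `[0, 1] (fun t => charge_integral lam `[0, 1] (q t)).

Definition charge_diff (lam mu : signed_measure) : signed_measure :=
  cadd lam (cscale (-1) mu).

(* The paths of the measures [lam n] are Cauchy for the norm of the space and
   converge to h in C([0, 1]). *)
Definition rkhs_approx (lam : nat -> signed_measure) (h : unit_itv R -> R) :=
  (forall e, 0 < e -> exists N, forall m n, (N <= m)%N -> (N <= n)%N ->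
     kernel_sqnorm (charge_diff (lam m) (lam n)) < e) /\
  (forall e, 0 < e -> exists N, forall n, (N <= n)%N ->
     forall t : unit_itv R, `|kernel_path (lam n) (val t) - h t| < e).

Definition rkhs : set (unit_itv R -> R) :=
  [set h | continuous h /\ exists lam, rkhs_approx lam h].

(* The squared norm of an element of [rkhs]: the common limit of
   [kernel_sqnorm (lam n)] over all sequences approximating h. *)
Definition rkhs_sqnorm (h : unit_itv R -> R) : R :=
  xget 0 [set v | exists2 lam, rkhs_approx lam h &
                    kernel_sqnorm (lam n) @[n --> \oo] --> v].

(* The rate function h |-> |h - m|^2 / 2 of the space with kernel q. *)
Definition rkhs_rate (m : unit_itv R -> R) (h : C01 R) : \bar R :=
  if `[< rkhs (C01_fun h \- m) >]
  then (2^-1 * rkhs_sqnorm (C01_fun h \- m))%:E else +oo%E.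

End rkhs.

Section gaussian_processes.
Context {R : realType} {d : measure_display} {Omega : measurableType d}.
Variable P : probability Omega R.

(* [normal_prob m 0] is not a Dirac mass in the library. *)
Definition gaussian_law (m s : R) : set R -> \bar R :=
  if s == 0 then dirac m else normal_prob m s.

Definition gaussian_rv (Z : Omega -> R) : Prop :=
  exists m s : R, 0 <= s /\
    forall A, measurable A -> P (Z @^-1` A) = gaussian_law m s A.

(* Processes are indexed by R, and only times t >= 0 are constrained. *)
Definition gaussian_process (X : R -> {RV P >-> R}) : Prop :=
  forall (m : nat) (t c : 'I_m -> R), (forall i, 0 <= t i) ->
    gaussian_rv (fun w => \sum_(i < m) c i * X (t i) w).

Definition centered_process (X : R -> {RV P >-> R}) : Prop :=
  forall t, 0 <= t -> ('E_P[X t] = 0)%E.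

Definition continuous_process (X : R -> {RV P >-> R}) : Prop :=
  forall w, {within `[0, +oo[, continuous (fun t => X t w)}.

Definition cov_fun (X : R -> {RV P >-> R}) (t s : R) : R :=
  fine (covariance P (X t) (X s)).

Definition continuous_cov (k : R -> R -> R) : Prop :=
  {within `[0, +oo[ `*` `[0, +oo[, continuous (fun ts : R * R => k ts.1 ts.2)}.

End gaussian_processes.

(* Times and values of the conditionings are T 1, ..., T n and x 1, ..., x n;
   the other values of T and x play no role. *)
Section conditioning.
Context {R : realType}.
Variables (k : R -> R -> R) (T : nat -> R).

Fixpoint cond_cov (j : nat) (t s : R) : R :=
  if j is i.+1 then
    cond_cov i t s
      - cond_cov i t (T j) / cond_cov i (T j) (T j) * cond_cov i s (T j)
  else k t s.

(* For j >= 1. *)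
Definition cond_weight (j : nat) (t : R) : R :=
  cond_cov j.-1 t (T j) / cond_cov j.-1 (T j) (T j).

Fixpoint cond_process {Omega : Type} (x : nat -> R) (X : R -> Omega -> R)
    (j : nat) (t : R) (w : Omega) : R :=
  if j is i.+1 then
    cond_process x X i t w
      - cond_weight j t * (cond_process x X i (T j) w - x j)
  else X t w.

(* The recursion shared by c_j and by psi_j(t; .), in the variable S. *)
Fixpoint cond_coef (f : R -> R) (j : nat) (S : R) : R :=
  if j is i.+1 then
    cond_coef f i S - cond_weight j S * cond_coef f i (T j)
  else f S.

Variables (c : R -> R) (psi : R -> R -> R).

Definition cond_sq (a : R) (n : nat) : R :=
  a ^+ 2 - \sum_(1 <= l < n.+1)
    cond_coef c l.-1 (T l) ^+ 2 / cond_cov l.-1 (T l) (T l).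

Definition cond_phi (phi : R -> R -> R) (n : nat) (t s : R) : R :=
  phi t s - \sum_(1 <= l < n.+1)
    cond_coef c l.-1 (T l) / cond_cov l.-1 (T l) (T l) *
      (cond_coef (psi t) l.-1 (T l) * s + cond_coef (psi s) l.-1 (T l) * t).

(* The weight beta^e at time T n + e t. *)
Definition bridge_weight (n : nat) (e t : R) : R :=
  cond_cov n (T n + e * t) (T n + e) / cond_cov n (T n + e) (T n + e).

Definition bridge_weight_lim (n : nat) (t : R) : R :=
  lim (bridge_weight n e t @[e --> 0^'+]).

(* The rescaled bridge t |-> Y_(T n + e t) as a random path. *)
Definition bridge {Omega : Type} (x : nat -> R) (y : R) (X : R -> Omega -> R)
    (n : nat) (e : R) (w : Omega) : C01 R :=
  to_C01 (fun u : unit_itv R => let t := val u in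
    cond_process x X n (T n + e * t) w
      - bridge_weight n e t * (cond_process x X n (T n + e) w - y)).

Definition bridge_mean (xn y : R) (n : nat) (u : unit_itv R) : R :=
  xn + bridge_weight_lim n (val u) * (y - xn).

End conditioning.

Definition bridge_kernel {R : realType} (phi : R -> R -> R) (t s : R) : R :=
  phi t s + t * s * phi 1 1 - t * phi 1 s - s * phi t 1.

(* Main.v *)
(* Let Y be the bridge and v = e^(2 + alpha). Conditioning on X at T 1, ..., T n
   only subtracts from X a linear combination of its values at these times, so
   that Y is a Gaussian path; expanding the covariance of X at T n, the leading
   term a_n^2 t s is a rank-one kernel, which the bridge cancels, and the
   covariance of Y divided by v converges uniformly to the kernel q = k_Y, while
   its mean converges to m.

   For such a Gaussian family the principle is obtained by duality. For a
   finitely supported signed measure s, let the score of a path g be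
   s(g - m) - q(s, s) / 2. The supremum of the scores is half the squared norm of
   g - m in the space of q: a near maximizer s has a potential close to g - m.
   - Upper bound: by the exponential Markov inequality, the event that the score
     of Y for s exceeds b has probability about exp(- b / v). A closed set off the
     compact level set {J <= b} is covered by finitely many such events, up to
     paths of large oscillation.
   - Lower bound: Y is close to the potential of s at finitely many times, with
     probability about exp(- q(s, s) / (2 v)), by tilting with exp(s(Y) / v).
   - In both cases the oscillation of Y is controlled by a concentration
     inequality for the maximum F of a Gaussian vector, which only asks that Y be
     close to its mean with probability at least 1/2. It follows from the
     Maurey-Pisier argument: for an independent copy Z' of the vector Z, the
     difference F(Z) - F(Z') telescopes along the rotations Z cos t + Z' sin t
     of Z, and two rotations at angle h have the joint law of Z and
     Z cos h + Z' sin h, as their moment generating functions are equal. *)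

Require Import Defs.
From HB Require Import structures.
From mathcomp Require Import all_boot all_order all_algebra.
From mathcomp Require Import all_classical all_reals all_analysis.
From mathcomp Require Import measurable_realfun.
From mathcomp Require Import ring lra.

Import Order.TTheory GRing.Theory Num.Theory.
Import numFieldNormedType.Exports.

Local Open Scope classical_set_scope.
Local Open Scope ring_scope.

(** * Finitely supported signed measures *)

(** The expansions control remainders only uniformly on the unit square: divided by v, the
    covariance of Y is known up to o(1). Increments of Y over a short distance thus have small
    normalized variance, but for fixed e no rate at which it vanishes with the distance is
    available, so chaining estimates are out of reach. The concentration bound depends on the
    largest variance and not on the number of points, and therefore extends to all increments
    between nodes at once. Its input, a probability of at least 1/2, comes from X being one fixed
    process with continuous paths: the random part of Y is read off a conditioned path that vanishes
    at T_n, over a window of length e. The functions phi and psi are known only through the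
    expansions, so the symmetry and boundedness of phi_n and the continuity of q are obtained as
    properties of uniform limits of covariances. Finitely supported measures keep the probability
    finite-dimensional: the law of X enters through moment generating functions of finite linear
    combinations, while general signed measures appear only when the supremum of the scores is
    identified with the Hilbert space norm. *)

Section finite_functionals.
Context {R : realType}.
Implicit Types (s : seq (R * R)) (f g : R -> R) (q : R -> R -> R).

(* A list of pairs (c, t) encodes the finitely supported signed measure with
   masses c at the points t. *)
Definition lin s f : R := \sum_(p <- s) p.1 * f p.2.

Definition bil q s s' : R := lin s (fun t => lin s' (q t)).

Definition scale_list (a : R) s := [seq (a * p.1, p.2) | p <- s].

Definition supported (D : set R) s := forall p, p \in s -> D p.2.

Lemma lin_nil f : lin [::] f = 0.
Proof. exact: big_nil. Qed.

Lemma lin_cons p s f : lin (p :: s) f = p.1 * f p.2 + lin s f.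
Proof. exact: big_cons. Qed.

Lemma lin_cat s s' f : lin (s ++ s') f = lin s f + lin s' f.
Proof. exact: big_cat. Qed.

Lemma lin_scale a s f : lin (scale_list a s) f = a * lin s f.
Proof.
by rewrite /lin big_map mulr_sumr; apply: eq_bigr => p _; rewrite mulrA.
Qed.

Lemma linD s f g : lin s (fun t => f t + g t) = lin s f + lin s g.
Proof. by rewrite /lin -big_split; apply: eq_bigr => p _; rewrite mulrDr. Qed.

Lemma linN s f : lin s (fun t => - f t) = - lin s f.
Proof. by rewrite /lin -sumrN; apply: eq_bigr => p _; rewrite mulrN. Qed.

Lemma linB s f g : lin s (fun t => f t - g t) = lin s f - lin s g.
Proof. by rewrite linD linN. Qed.

Lemma linZ s a f : lin s (fun t => a * f t) = a * lin s f.
Proof. by rewrite /lin mulr_sumr; apply: eq_bigr => p _; rewrite mulrCA. Qed.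

Lemma linZr s a f : lin s (fun t => f t * a) = lin s f * a.
Proof. by rewrite mulrC -linZ; congr lin; apply/funext => t; rewrite mulrC. Qed.

Lemma eq_lin D s f g : supported D s -> (forall t, D t -> f t = g t) ->
  lin s f = lin s g.
Proof.
move=> sD fg; rewrite /lin !big_seq; apply: eq_bigr => p ps.
by rewrite fg//; exact: sD.
Qed.

Lemma lin_exchange q s s' :
  lin s (fun t => lin s' (q t)) = lin s' (fun u => lin s (q^~ u)).
Proof.
rewrite /lin; under eq_bigr do rewrite mulr_sumr.
rewrite exchange_big/=; apply: eq_bigr => p _.
by rewrite mulr_sumr; apply: eq_bigr => p' _; rewrite mulrCA.
Qed.

Lemma bil_catl q s1 s2 s : bil q (s1 ++ s2) s = bil q s1 s + bil q s2 s.
Proof. exact: lin_cat. Qed.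

Lemma bil_catr q s s1 s2 : bil q s (s1 ++ s2) = bil q s s1 + bil q s s2.
Proof.
by rewrite /bil -linD; congr lin; apply/funext => t; rewrite lin_cat.
Qed.

Lemma bil_scalel q a s s' : bil q (scale_list a s) s' = a * bil q s s'.
Proof. exact: lin_scale. Qed.

Lemma bil_scaler q a s s' : bil q s (scale_list a s') = a * bil q s s'.
Proof.
by rewrite /bil -linZ; congr lin; apply/funext => t; rewrite lin_scale.
Qed.

Lemma bil_sym D q s s' : (forall t u, D t -> D u -> q t u = q u t) ->
  supported D s -> supported D s' -> bil q s s' = bil q s' s.
Proof.
move=> qC sD s'D; rewrite /bil lin_exchange.
apply: (eq_lin D) => // t Dt; apply: (eq_lin D) => // u Du; exact: qC.
Qed.

Lemma supported_cat D s s' : supported D s -> supported D s' ->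
  supported D (s ++ s').
Proof. by move=> h h' p; rewrite mem_cat => /orP[/h|/h']. Qed.

Lemma supported_scale D a s : supported D s -> supported D (scale_list a s).
Proof. by move=> h p /mapP[p' /h ? ->]. Qed.

Lemma supported_nil D : supported D [::].
Proof. by []. Qed.

Lemma supported1 D c t : D t -> supported D [:: (c, t)].
Proof. by move=> Dt p; rewrite inE => /eqP ->. Qed.

Lemma supported_cons D p s : supported D (p :: s) -> D p.2 /\ supported D s.
Proof.
move=> h; split; first by apply: h; rewrite mem_head.
by move=> p' p's; apply: h; rewrite inE p's orbT.
Qed.

(** Bounds the total variation of the encoded measure, since a point may occur several times in the
    list. *)
Definition mass s : R := \sum_(p <- s) `|p.1|.

Lemma mass_ge0 s : 0 <= mass s.
Proof. exact: sumr_ge0. Qed.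

Lemma lin_le D s f g e : supported D s -> (forall t, D t -> `|f t - g t| <= e) ->
  `|lin s f - lin s g| <= mass s * e.
Proof.
move=> sD h; rewrite -linB /lin (le_trans (ler_norm_sum _ _ _))// /mass mulr_suml.
by rewrite !big_seq; apply: ler_sum => p ps; rewrite normrM ler_wpM2l//; exact/h/sD.
Qed.

Lemma bil_le D q q' s s' e : supported D s -> supported D s' ->
  (forall t u, D t -> D u -> `|q t u - q' t u| <= e) ->
  `|bil q s s' - bil q' s s'| <= mass s * (mass s' * e).
Proof.
move=> sD s'D h; apply: (lin_le D) => // t Dt; apply: (lin_le D) => // u Du.
exact: h.
Qed.

Lemma bil_add_scale D q s s' a : (forall t u, D t -> D u -> q t u = q u t) ->
  supported D s -> supported D s' ->
  bil q (s ++ scale_list a s') (s ++ scale_list a s') =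
  bil q s s + 2 * a * bil q s s' + a ^+ 2 * bil q s' s'.
Proof.
move=> qC sD s'D; rewrite !bil_catl !bil_catr !bil_scalel !bil_scaler.
by rewrite (bil_sym D q s' s)//; ring.
Qed.

End finite_functionals.

(** * Laws with equal moment generating functions *)

Section exponential_domination.
Context {R : realType} {I : finType}.
Implicit Types (x u : I -> R).

Definition l1norm x : R := \sum_i `|x i|.

Definition dotp u x : R := \sum_i u i * x i.

Definition exp_dominated (c C : R) (f : (I -> R) -> R) :=
  forall x, `|f x| <= C * expR (c * l1norm x).

Lemma l1norm_ge0 x : 0 <= l1norm x.
Proof. exact: sumr_ge0. Qed.

Lemma l1norm_ge x i : `|x i| <= l1norm x.
Proof. by rewrite /l1norm (bigD1 i)//= lerDl sumr_ge0. Qed.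

Lemma expR_norm_le (a : R) : expR `|a| <= expR a + expR (- a).
Proof.
have [a0|a0] := ger0P a; rewrite ?lerDl ?lerDr ?expR_ge0//.
Qed.

(** The norm is at most [#|I|] times the largest coordinate, whose exponential is bounded by two of
    the summands. These are exponentials of linear forms, which the moment generating function
    integrates. The summand 1 serves an empty index type. *)
Lemma expR_l1norm_le (c : R) x : 0 <= c ->
  expR (c * l1norm x) <= 1 + \sum_i (expR (c * #|I|%:R * x i) +
                                   expR (- (c * #|I|%:R * x i))).
Proof.
move=> c0.
have sge0 (P : pred I) : 0 <= \sum_(i | P i) (expR (c * #|I|%:R * x i) +
                                   expR (- (c * #|I|%:R * x i))).
  by apply: sumr_ge0 => i _; rewrite addr_ge0 ?expR_ge0.
have [i0|noI] := pselect (exists i0 : I, true); last first.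
  rewrite /l1norm big_pred0 ?mulr0 ?expR0 ?lerDl// => i.
  by exfalso; apply: noI; exists i.
have {i0} [i0 _] := i0.
have [i _ imax] := @Order.TotalTheory.arg_maxP _ _ I i0 predT (fun i => `|x i|) isT.
rewrite (bigD1 i)//= (le_trans _ (_ : expR (c * #|I|%:R * x i) + expR (- (c * #|I|%:R * x i)) <= _))//; last first.
  by rewrite addrCA lerDl addr_ge0.
apply: le_trans (expR_norm_le _).
rewrite ler_expR normrM ger0_norm ?mulr_ge0// -mulrA ler_wpM2l//.
rewrite mulr_natl -sumr_const; apply: ler_sum => j _; exact: imax.
Qed.

Lemma dotp_le u x : `|dotp u x| <= (\sum_i `|u i|) * l1norm x.
Proof.
rewrite (le_trans (ler_norm_sum _ _ _))// mulr_suml; apply: ler_sum => i _.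
by rewrite normrM ler_wpM2l// l1norm_ge.
Qed.

Lemma exp_dominated_ge0 c C f : exp_dominated c C f -> 0 <= C.
Proof.
move=> /(_ (fun=> 0)) h; rewrite -(pmulr_lge0 C (expR_gt0 (c * l1norm (fun=> 0)))).
exact: le_trans h.
Qed.

Lemma exp_dominatedW c c' C f : c <= c' -> exp_dominated c C f ->
  exp_dominated c' C f.
Proof.
move=> cc' H x; rewrite (le_trans (H x))// ler_wpM2l ?(exp_dominated_ge0 _ _ _ H)//.
by rewrite ler_expR ler_wpM2r// l1norm_ge0.
Qed.

Lemma exp_dominatedM c C c' C' f g : exp_dominated c C f ->
  exp_dominated c' C' g -> exp_dominated (c + c') (C * C') (fun x => f x * g x).
Proof.
move=> hf hg x; rewrite normrM mulrDl expRD mulrACA.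
by apply: ler_pM.
Qed.

End exponential_domination.

Section mgf_determines_law.
Context {R : realType} {d : measure_display} {S : measurableType d}.
Context (nu : probability S R) {I : finType}.
Variables V W : I -> S -> R.

Definition has_mgf (U : I -> S -> R) :=
  (forall i, measurable_fun setT (U i)) /\
  forall u : I -> R, (\int[nu]_s (expR (dotp u (fun i => U i s)))%:E < +oo)%E.

Hypothesis gV : has_mgf V.
Hypothesis gW : has_mgf W.
Hypothesis mgfVW : forall u : I -> R,
  (\int[nu]_s (expR (dotp u (fun i => V i s)))%:E =
   \int[nu]_s (expR (dotp u (fun i => W i s)))%:E)%E.

Lemma measurable_dotp (U : I -> S -> R) u : has_mgf U ->
  measurable_fun setT (fun s => dotp u (fun i => U i s)).
Proof.
move=> [mU _]; apply: measurable_sum => i.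
by apply: measurable_funM => //; exact: mU.
Qed.

Lemma integrable_exp_dotp (U : I -> S -> R) u : has_mgf U ->
  nu.-integrable setT (fun s => (expR (dotp u (fun i => U i s)))%:E).
Proof.
move=> gU; apply/integrableP; split.
  apply/measurable_EFinP; apply: measurableT_comp => //.
  exact: measurable_dotp.
under eq_integral do rewrite gee0_abs ?lee_fin ?expR_ge0//.
exact: gU.2.
Qed.

Lemma dotp_single i (a : R) (x : I -> R) :
  dotp (fun j => if j == i then a else 0) x = a * x i.
Proof.
rewrite /dotp (bigD1 i)//= eqxx big1 ?addr0// => j /negbTE ->.
by rewrite mul0r.
Qed.

Lemma measurable_l1norm (U : I -> S -> R) : has_mgf U ->
  measurable_fun setT (fun s => l1norm (fun i => U i s)).
Proof.
move=> [mU _]; apply: measurable_sum => i.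
by apply: measurableT_comp => //; exact: mU.
Qed.

Lemma integrable_exp_l1norm (U : I -> S -> R) (c C : R) : 0 <= c ->
  has_mgf U ->
  nu.-integrable setT (fun s => (C * expR (c * l1norm (fun i => U i s)))%:E).
Proof.
move=> c0 gU.
under eq_fun do rewrite EFinM.
apply: integrableZl => //.
have mE : measurable_fun setT (fun s => expR (c * l1norm (fun i => U i s))).
  apply: measurableT_comp => //; apply: measurable_funM => //.
  exact: measurable_l1norm.
pose g (s : S) : R := 1 + \sum_i (expR (c * #|I|%:R * U i s) +
                                   expR (- (c * #|I|%:R * U i s))).
apply: (@le_integrable _ _ _ nu setT measurableT _ (fun s => (g s)%:E)).
- exact/measurable_EFinP.
- move=> s _; rewrite !abse_EFin lee_fin ger0_norm ?expR_ge0//.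
  by rewrite (le_trans (expR_l1norm_le _ _ c0))// ler_norm.
- have -> : (fun s => (g s)%:E) = (fun s => 1%:E + \sum_i
      ((expR (c * #|I|%:R * U i s))%:E + (expR (- (c * #|I|%:R * U i s)))%:E))%E.
    by apply/funext => s; rewrite /g EFinD -sumEFin.
  apply: (@integrableD _ _ _ nu setT measurableT (cst 1%:E) (fun s => \sum_i
      ((expR (c * #|I|%:R * U i s))%:E + (expR (- (c * #|I|%:R * U i s)))%:E)))%E.
    exact: finite_measure_integrable_cst.
  apply: integrable_sum => // i _.
  have := @integrable_exp_dotp U (fun j => if j == i then c * #|I|%:R else 0) gU.
  have := @integrable_exp_dotp U (fun j => if j == i then - (c * #|I|%:R) else 0) gU.
  under eq_fun do rewrite dotp_single mulNr.
  move=> h1; under eq_fun do rewrite dotp_single.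
  move=> h2.
  exact: (integrableD measurableT).
Qed.

(** Measurability is asked after composition with [V] and [W], as the space of vectors carries no
    sigma-algebra at this point. *)
Definition admissible (f : (I -> R) -> R) :=
  [/\ measurable_fun setT (fun s => f (fun i => V i s)),
      measurable_fun setT (fun s => f (fun i => W i s)) &
      exists c C, 0 <= c /\ exp_dominated c C f].

Definition same_mean (f : (I -> R) -> R) :=
  (\int[nu]_s (f (fun i => V i s))%:E = \int[nu]_s (f (fun i => W i s))%:E)%E.

(* The multiplier g makes this class stable under products, which the closure of
   the exponentials under dominated limits would not give at once. *)
Definition transferable (f : (I -> R) -> R) :=
  admissible f /\
  forall g, admissible g ->
    (forall u, same_mean (fun x => g x * expR (dotp u x))) ->
    forall u, same_mean (fun x => f x * g x * expR (dotp u x)).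

Lemma integrable_dominated (U : I -> S -> R) f c C : has_mgf U ->
  measurable_fun setT (fun s => f (fun i => U i s)) ->
  0 <= c -> exp_dominated c C f ->
  nu.-integrable setT (fun s => (f (fun i => U i s))%:E).
Proof.
move=> gU mf c0 fC.
apply: (le_integrable measurableT _ _ (integrable_exp_l1norm U c C c0 gU)) => //.
  exact/measurable_EFinP.
move=> s _; rewrite !abse_EFin lee_fin (le_trans (fC _))//.
by rewrite ler_norm.
Qed.

Lemma integrableV f : admissible f ->
  nu.-integrable setT (fun s => (f (fun i => V i s))%:E).
Proof. by move=> [mf _ [c [C [c0 fC]]]]; exact: (integrable_dominated V f c C). Qed.

Lemma integrableW f : admissible f ->
  nu.-integrable setT (fun s => (f (fun i => W i s))%:E).
Proof. by move=> [_ mf [c [C [c0 fC]]]]; exact: (integrable_dominated W f c C). Qed.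

Lemma admissibleM f g : admissible f -> admissible g ->
  admissible (fun x => f x * g x).
Proof.
move=> [f1 f2 [c [C [c0 fC]]]] [g1 g2 [c' [C' [c0' gC]]]]; split.
- exact: measurable_funM.
- exact: measurable_funM.
- exists (c + c'), (C * C'); split; first exact: addr_ge0.
  exact: exp_dominatedM.
Qed.

Lemma admissibleD f g : admissible f -> admissible g ->
  admissible (fun x => f x + g x).
Proof.
move=> [f1 f2 [c [C [c0 fC]]]] [g1 g2 [c' [C' [c0' gC]]]]; split.
- exact: measurable_funD.
- exact: measurable_funD.
- exists (c + c'), (C + C'); split; first exact: addr_ge0.
  move=> x; rewrite (le_trans (ler_normD _ _))// mulrDl lerD//.
    by apply: (exp_dominatedW c) => //; rewrite lerDl.
  by apply: (exp_dominatedW c') => //; rewrite lerDr.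
Qed.

Lemma admissible_cst a : admissible (fun=> a).
Proof.
split; [exact: measurable_cst|exact: measurable_cst|].
by exists 0, `|a|; split => // x; rewrite mul0r expR0 mulr1.
Qed.

Lemma admissible_exp u : admissible (fun x => expR (dotp u x)).
Proof.
split.
- by apply: measurableT_comp => //; exact: measurable_dotp.
- by apply: measurableT_comp => //; exact: measurable_dotp.
- exists (\sum_i `|u i|), 1; split; first exact: sumr_ge0.
  move=> x; rewrite mul1r ger0_norm ?expR_ge0// ler_expR.
  exact: le_trans (ler_norm _) (dotp_le _ _).
Qed.

Lemma transferable_same_mean f : transferable f -> same_mean f.
Proof.
move=> [af /(_ (fun=> 1) (admissible_cst 1))].
have h : forall u, same_mean (fun x => 1 * expR (dotp u x)).
  by move=> u; rewrite /same_mean; under eq_integral do rewrite mul1r;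
    rewrite mgfVW; apply: eq_integral => s _; rewrite mul1r.
move=> /(_ h (fun=> 0)).
have e0 x : dotp (fun=> 0) x = 0 :> R by rewrite /dotp big1// => i _; rewrite mul0r.
by rewrite /same_mean; under eq_integral do rewrite mulr1 e0 expR0 mulr1;
  move=> ->; apply: eq_integral => s _; rewrite mulr1 e0 expR0 mulr1.
Qed.

(** An exponential factor only shifts the tilt, over which the definition already quantifies. *)
Lemma transferable_exp u : transferable (fun x => expR (dotp u x)).
Proof.
split; first exact: admissible_exp.
move=> g ag h v; move: (h (fun i => u i + v i)); rewrite /same_mean.
have e x : g x * expR (dotp (fun i => u i + v i) x) =
    expR (dotp u x) * g x * expR (dotp v x).
  rewrite mulrAC -expRD mulrC; congr (expR _ * _).
  by rewrite /dotp -big_split/=; apply: eq_bigr => i _; rewrite mulrDl.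
by under eq_integral do rewrite e; move=> ->; apply: eq_integral => s _; rewrite e.
Qed.

(** The first factor is used against the multiplier [g * h], whose tilted means agree by the second
    factor. *)
Lemma transferableM f g : transferable f -> transferable g ->
  transferable (fun x => f x * g x).
Proof.
move=> [af hf] [ag hg]; split; first exact: admissibleM.
move=> h ah hh u.
have := hf _ (admissibleM _ _ ag ah) (hg _ ah hh) u.
by rewrite /same_mean; under eq_integral do rewrite mulrA;
  move=> ->; apply: eq_integral => s _; rewrite mulrA.
Qed.

Lemma transferableD f g : transferable f -> transferable g ->
  transferable (fun x => f x + g x).
Proof.
move=> [af hf] [ag hg]; split; first exact: admissibleD.
move=> h ah hh u.
have := hf _ ah hh u; have := hg _ ah hh u; rewrite /same_mean => h1 h2.
have a1 := admissibleM _ _ (admissibleM _ _ af ah) (admissible_exp u).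
have a2 := admissibleM _ _ (admissibleM _ _ ag ah) (admissible_exp u).
have eV := integralD measurableT (integrableV _ a1) (integrableV _ a2).
have eW := integralD measurableT (integrableW _ a1) (integrableW _ a2).
rewrite h1 h2 in eV.
transitivity (\int[nu]_s ((f (fun i => V i s) * h (fun i => V i s) *
   expR (dotp u (fun i => V i s)))%:E + (g (fun i => V i s) * h (fun i => V i s) *
   expR (dotp u (fun i => V i s)))%:E))%E.
  by apply: eq_integral => s _; rewrite !mulrDl EFinD.
rewrite [LHS]eV; rewrite -[LHS]eW.
by apply: eq_integral => s _; rewrite !mulrDl EFinD.
Qed.

Lemma transferable_cst a : transferable (fun=> a).
Proof.
split; first exact: admissible_cst.
move=> h ah hh u; rewrite /same_mean.
under eq_integral do rewrite -mulrA EFinM.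
under [RHS]eq_integral do rewrite -mulrA EFinM.
have a1 := admissibleM _ _ ah (admissible_exp u).
rewrite (integralZl measurableT (integrableV _ a1)).
by rewrite (integralZl measurableT (integrableW _ a1)) hh.
Qed.

(** Dominated convergence along [V] and along [W]; the bound is common to all [n], and it remains
    integrable after multiplication by an admissible function and an exponential. *)
Lemma transferable_lim (f_ : nat -> (I -> R) -> R) (f : (I -> R) -> R) (c C : R) : 0 <= c ->
  (forall n, transferable (f_ n)) -> (forall n, exp_dominated c C (f_ n)) ->
  (forall x, f_ n x @[n --> \oo] --> f x) -> transferable f.
Proof.
move=> c0 tf domf cvf.
have af : admissible f.
  split.
  - exact: (@measurable_fun_cvg _ _ _ setT (fun n s => f_ n (fun i => V i s)) _
      (fun n => let: And3 m _ _ := (tf n).1 in m) (fun s _ => cvf _)).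
  - exact: (@measurable_fun_cvg _ _ _ setT (fun n s => f_ n (fun i => W i s)) _
      (fun n => let: And3 _ m _ := (tf n).1 in m) (fun s _ => cvf _)).
  - exists c, C; split => // x.
    have cx : `|f_ n x| @[n --> \oo] --> `|f x| by apply: cvg_norm; exact: cvf.
    rewrite -(cvg_lim _ cx)//; apply: limr_le; first by apply/cvg_ex; eexists; exact: cx.
    by apply: nearW => n; exact: domf.
split=> // h ah hh u.
have aq n := admissibleM _ _ (admissibleM _ _ (tf n).1 ah) (admissible_exp u).
have [c' [C' [c0' hC]]] : exists c C, 0 <= c /\
    forall n, exp_dominated c C (fun x => f_ n x * h x * expR (dotp u x)).
  have [_ _ [c1 [C1 [c10 hC1]]]] := ah.
  have [_ _ [c2 [C2 [c20 hC2]]]] := admissible_exp u.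
  exists (c + c1 + c2), (C * C1 * C2); split; first by rewrite !addr_ge0.
  by move=> n; do 2! apply: exp_dominatedM => //.
have key (U : I -> S -> R) : has_mgf U ->
    (forall n, measurable_fun setT (fun s => f_ n (fun i => U i s) *
       h (fun i => U i s) * expR (dotp u (fun i => U i s)))) ->
    (\int[nu]_s (f_ n (fun i => U i s) *
       h (fun i => U i s) * expR (dotp u (fun i => U i s)))%:E @[n --> \oo] -->
     \int[nu]_s (f (fun i => U i s) *
       h (fun i => U i s) * expR (dotp u (fun i => U i s)))%:E)%E.
  move=> gU mU.
  apply: (@dominated_cvg _ _ _ _ _ _ _ _ (fun s =>
    (C' * expR (c' * l1norm (fun i => U i s)))%:E)) => //.
  - by move=> n; apply/measurable_EFinP; exact: mU.
  - move=> s _; apply: cvg_EFin; first exact: nearW.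
    apply: cvgM; last exact: cvg_cst.
    by apply: cvgM; [exact: cvf|exact: cvg_cst].
  - exact: integrable_exp_l1norm.
  - by move=> n s _; rewrite abse_EFin lee_fin; exact: hC.
have kV := key V gV (fun n => let: And3 m _ _ := aq n in m).
have kW := key W gW (fun n => let: And3 _ m _ := aq n in m).
have /funext e n := (tf n).2 h ah hh u.
rewrite e in kV.
exact: (cvg_unique (@ereal_hausdorff R) kV kW).
Qed.

Lemma expR_sub1_bounds (y : R) : y <= expR y - 1 <= y * expR y.
Proof.
have h1 := expR_ge1Dx y; have h2 := expR_ge1Dx (- y).
have e0 := expR_gt0 y.
have : (1 - y) * expR y <= 1.
  by rewrite -[leRHS](expRxMexpNx_1 y) mulrC ler_wpM2l ?expR_ge0.
by rewrite mulrBl mul1r => h; apply/andP; split; lra.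
Qed.

Lemma cvg_expR_quotient (x : R) :
  n.+1%:R * (expR (x / n.+1%:R) - 1) @[n --> \oo] --> x.
Proof.
have h0 : x / n.+1%:R @[n --> \oo] --> (0 : R).
  rewrite -[X in _ --> X](mulr0 x).
  by apply: cvgM; [exact: cvg_cst|exact: cvg_harmonic].
apply: (@squeeze_cvgr _ _ _ _ (fun=> x) (fun n => x * expR (x / n.+1%:R))).
- apply: nearW => n; have /andP[h1 h2] := expR_sub1_bounds (x / n.+1%:R).
  have n0 : 0 < n.+1%:R :> R by [].
  have e : x = n.+1%:R * (x / n.+1%:R) by rewrite mulrC divfK ?gt_eqF.
  have le (a b : R) : a <= b -> n.+1%:R * a <= n.+1%:R * b by move=> ab; rewrite ler_pM2l.
  apply/andP; split; first by rewrite {1}e le.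
  by rewrite {2}e -mulrA le.
- exact: cvg_cst.
- rewrite -[X in _ --> X]mulr1; apply: cvgM; first exact: cvg_cst.
  have c0 : {for (0:R), continuous expR} by exact: continuous_expR.
  by rewrite -[X in _ --> X]expR0; exact: (continuous_cvg _ c0 h0).
Qed.

Lemma norm_le_expR_norm (x : R) : `|x| <= expR `|x|.
Proof. by rewrite (le_trans _ (expR_ge1Dx _))// lerDr. Qed.

Lemma expR_quotient_le (x : R) (n : nat) :
  `|n.+1%:R * (expR (x / n.+1%:R) - 1)| <= expR (2 * `|x|).
Proof.
have n0 : 0 < n.+1%:R :> R by [].
have /andP[h1 h2] := expR_sub1_bounds (x / n.+1%:R).
have hx : `|x| / n.+1%:R <= `|x| by rewrite ler_pdivrMr// ler_peMr// ler1n.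
have hb : `|expR (x / n.+1%:R) - 1| <= `|x / n.+1%:R| * expR (`|x|).
  have hh : expR (x / n.+1%:R) <= expR `|x|.
    rewrite ler_expR (le_trans (ler_norm _))// normrM (@ger0_norm _ n.+1%:R^-1)//.
  have h1e : 1 <= expR `|x| by rewrite -expR0 ler_expR.
  rewrite ler_norml; apply/andP; split.
    rewrite (le_trans _ h1)// lerNl -normrN.
    rewrite (le_trans (ler_norm _))// ler_peMr//.
  rewrite (le_trans h2)// (le_trans (ler_norm _))// normrM ler_wpM2l//.
  by rewrite ger0_norm ?expR_ge0.
rewrite normrM (ger0_norm (ltW n0)).
have -> : 2 * `|x| = `|x| + `|x| by lra.
rewrite expRD.
have {}hb : n.+1%:R * `|expR (x / n.+1%:R) - 1| <=
    n.+1%:R * (`|x / n.+1%:R| * expR `|x|) by rewrite ler_pM2l.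
rewrite (le_trans hb)// mulrA normrM (@ger0_norm _ n.+1%:R^-1)//.
rewrite [_ * (`|x| / _)]mulrC divfK//.
by rewrite ler_wpM2r ?expR_ge0// norm_le_expR_norm.
Qed.

(** Differentiates exponentials at 0: the quotients n (exp(x / n) - 1) tend to x and are dominated
    by exp(2 |x|). *)
Lemma transferable_coord i : transferable (fun x => x i).
Proof.
apply: (@transferable_lim (fun n x => n.+1%:R * (expR (x i / n.+1%:R) - 1)) _ 2 1).
- by [].
- move=> n; apply: transferableM; first exact: transferable_cst.
  apply: transferableD; last exact: transferable_cst.
  have -> : (fun x : I -> R => expR (x i / n.+1%:R)) = (fun x =>
      expR (dotp (fun j => if j == i then n.+1%:R^-1 else 0) x)).
    by apply/funext => x; rewrite dotp_single mulrC.
  exact: transferable_exp.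
- move=> n x; rewrite mul1r (le_trans (expR_quotient_le _ _))// ler_expR.
  by rewrite ler_wpM2l// l1norm_ge.
- by move=> x; exact: cvg_expR_quotient.
Qed.

Lemma transferable_sum n (f_ : nat -> (I -> R) -> R) :
  (forall k, transferable (f_ k)) ->
  transferable (fun x => \sum_(0 <= k < n) f_ k x).
Proof.
move=> h; elim: n => [|n ih].
  under eq_fun do rewrite big_geq//.
  exact: transferable_cst.
under eq_fun do rewrite big_nat_recr//=.
exact: transferableD.
Qed.

Lemma transferableX f n : transferable f -> transferable (fun x => f x ^+ n).
Proof.
move=> tf; elim: n => [|n ih]; first exact: transferable_cst.
under eq_fun do rewrite exprS.
exact: transferableM.
Qed.

Lemma series_exp_coeff_le (y : R) n : 0 <= y -> series (exp_coeff y) n <= expR y.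
Proof.
move=> y0; rewrite /expR; apply: nondecreasing_cvgn_le.
  apply: nondecreasing_series => k _ _.
  by rewrite /exp_coeff/= divr_ge0// exprn_ge0.
exact: is_cvg_series_exp_coeff.
Qed.

(** Taylor sums of the sine are polynomials in one coordinate, dominated by the exponential series.
    The sine serves as a bounded function whose sign is known near 0, because thresholds are applied
    to functions with values in [0, 1]. *)
Lemma transferable_sin i (a b : R) : transferable (fun x => sin (a * (x i - b))).
Proof.
apply: (@transferable_lim (fun n x => series (sin_coeff (a * (x i - b))) n) _
   `|a| (expR `|a * b|)).
- by [].
- move=> n; rewrite /series/=; apply: transferable_sum => k.
  rewrite /sin_coeff/=; apply: transferableM; last exact: transferable_cst.
  apply: transferableM; first exact: transferable_cst.
  apply: transferableX; apply: transferableM; first exact: transferable_cst.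
  by apply: transferableD; [exact: transferable_coord|exact: transferable_cst].
- move=> n x; set y := a * (x i - b).
  apply: (@le_trans _ _ (series (exp_coeff `|y|) n)).
    rewrite /series/= (le_trans (ler_norm_sum _ _ _))//; apply: ler_sum => k _.
    rewrite /sin_coeff /exp_coeff/= normrM [X in _ * X <= _]ger0_norm ?invr_ge0//.
    rewrite ler_pM2r ?invr_gt0 ?ltr0n ?fact_gt0// normrM normrX.
    rewrite ler_piMl ?exprn_ge0// normrM normrX normrN1 expr1n mulr1 normr_nat.
    by case: (odd k).
  apply: (le_trans (series_exp_coeff_le _ _ (normr_ge0 _))).
  rewrite -expRD ler_expR /y mulrBr (le_trans (ler_normB _ _))// addrC lerD2l.
  by rewrite normrM ler_wpM2l// l1norm_ge.
- move=> x; rewrite sin.unlock; exact: is_cvg_series_sin_coeff.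
Qed.

Definition transferable_set (A : set (I -> R)) :=
  transferable (\1_A : (I -> R) -> R).

Lemma transferable_setC A : transferable_set A -> transferable_set (~` A).
Proof.
move=> tA; rewrite /transferable_set.
have -> : (\1_(~` A) : (I -> R) -> R) = (fun x => 1 + -1 * \1_A x).
  apply/funext => x; rewrite indicC/= indicE; case: (x \in A) => /=.
    by rewrite mulr1 subrr.
  by rewrite mulr0 addr0.
apply: transferableD; first exact: transferable_cst.
by apply: transferableM => //; exact: transferable_cst.
Qed.

Lemma transferable_setI A B : transferable_set A -> transferable_set B ->
  transferable_set (A `&` B).
Proof. by move=> tA tB; rewrite /transferable_set indicI; exact: transferableM. Qed.

Lemma indic_dominated (A : set (I -> R)) : exp_dominated 0 1 (\1_A).
Proof.
by move=> x; rewrite mul0r expR0 mulr1 indicE ger0_norm// ; case: (_ \in _).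
Qed.

Lemma transferable_bigcap (A : nat -> set (I -> R)) :
  (forall n, transferable_set (A n)) -> transferable_set (\bigcap_n A n).
Proof.
move=> tA.
pose B n := \bigcap_(k < n) A k.
have tB n : transferable_set (B n).
  elim: n => [|n ih].
    rewrite /B bigcap_mkord big_ord0 /transferable_set indicT.
    exact: transferable_cst.
  by rewrite /B bigcap_mkord big_ord_recr/= -bigcap_mkord; exact: transferable_setI.
apply: (@transferable_lim (fun n => \1_(B n)) _ 0 1) => //.
  by move=> n; exact: indic_dominated.
move=> x; have [h|h] := pselect ((\bigcap_n A n) x).
  rewrite indicE mem_set//; apply: cvg_near_cst; apply: nearW => n.
  by rewrite indicE mem_set// => k _; exact: h.
rewrite indicE memNset//.
have [k hk] : exists k, ~ A k x.
  by apply/existsNP => h'; apply: h => k _; exact: h'.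
apply: cvg_near_cst; exists k.+1 => // n /= kn.
by rewrite indicE memNset// => /(_ k kn).
Qed.

Lemma transferable_bigcup (A : nat -> set (I -> R)) :
  (forall n, transferable_set (A n)) -> transferable_set (\bigcup_n A n).
Proof.
move=> tA; rewrite -[X in transferable_set X]setCK setC_bigcup.
by apply/transferable_setC/transferable_bigcap => n; exact: transferable_setC.
Qed.

(** The powers of [f] decrease to the indicator of the level set. *)
Lemma transferable_set_eq1 f : transferable f -> (forall x, 0 <= f x <= 1) ->
  transferable_set [set x | f x = 1].
Proof.
move=> tf f01.
apply: (@transferable_lim (fun n x => f x ^+ n) _ 0 1) => //.
- by move=> n; exact: transferableX.
- move=> n x; have /andP[f0 f1] := f01 x.
  by rewrite mul0r expR0 mulr1 normrX exprn_ile1// ger0_norm.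
- move=> x; have /andP[f0 f1] := f01 x; have [fx1|fx1] := eqVneq (f x) 1.
    rewrite indicE mem_set//=; apply: cvg_near_cst; apply: nearW => n.
    by rewrite fx1 expr1n.
  rewrite indicE memNset/=; last exact/eqP.
  by apply: cvg_expr; rewrite ger0_norm// lt_neqAle fx1.
Qed.

Lemma bernoulli_le (t : R) n : 0 <= t <= 1 -> 1 - n%:R * t <= (1 - t) ^+ n.
Proof.
move=> /andP[t0 t1]; elim: n => [|n ih]; first by rewrite mul0r subr0 expr0.
rewrite exprS; apply: (@le_trans _ _ ((1 - t) * (1 - n%:R * t))); last first.
  by rewrite ler_wpM2l// subr_ge0.
have := mulr_ge0 (mulr_ge0 (ler0n R n) t0) t0.
by rewrite -natr1; nra.
Qed.

(** For s < 1/2, Bernoulli's inequality bounds the terms below by 1 - (2 s)^n. For s > 1/2, the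
    inequality 1 - s^n <= exp(- s^n) bounds them above by exp(- (2 s)^n) <= (2 s)^(-n). *)
Lemma cvg_threshold (s : R) : 0 <= s <= 1 -> s != 2^-1 ->
  (1 - s ^+ n) ^+ (2 ^ n) @[n --> \oo] --> ((s < 2^-1)%R%:R : R).
Proof.
move=> /andP[s0 s1] s2; have p01 n : 0 <= s ^+ n <= 1.
  by rewrite exprn_ge0//= exprn_ile1.
have [slt|sge] := ltP s 2^-1.
  apply: (@squeeze_cvgr _ _ _ _ (fun n => 1 - (2 * s) ^+ n) (fun=> 1)).
  - apply: nearW => n; apply/andP; split.
      by have := bernoulli_le _ (2 ^ n)%N (p01 n); rewrite natrX exprMn.
    by apply: exprn_ile1; have /andP[h1 h2] := p01 n; lra.
  - rewrite -[X in _ --> X]subr0; apply: cvgB; first exact: cvg_cst.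
    by apply: cvg_expr; rewrite ger0_norm; lra.
  - exact: cvg_cst.
have sgt : 2^-1 < s by rewrite lt_neqAle eq_sym s2.
have q0 : 0 < 2 * s by lra.
apply: (@squeeze_cvgr _ _ _ _ (fun=> 0) (fun n => ((2 * s)^-1) ^+ n)).
- apply: nearW => n; apply/andP; split.
    by rewrite exprn_ge0// subr_ge0; have /andP[] := p01 n.
  apply: (@le_trans _ _ (expR (- s ^+ n) ^+ (2 ^ n))).
    rewrite lerXn2r ?nnegrE ?expR_ge0//; last exact: expR_ge1Dx.
    by rewrite subr_ge0; have /andP[] := p01 n.
  rewrite -expRM_natr mulNr expRN natrX mulrC -exprMn exprVn.
  rewrite lef_pV2 ?posrE ?expR_gt0 ?exprn_gt0//.
  by rewrite (le_trans _ (expR_ge1Dx _))// lerDr.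
- exact: cvg_cst.
- apply: cvg_expr; rewrite ger0_norm ?invr_ge0 ?ltW// invf_lt1//; lra.
Qed.

(* As in the proof of the Stone-Weierstrass theorem, (1 - f^n)^(2^n) tends to
   the indicator of f < 1/2 off the level set f = 1/2. *)
Lemma transferable_set_lt_half f : transferable f ->
  (forall x, 0 <= f x <= 1) -> transferable_set [set x | f x < 2^-1].
Proof.
move=> tf f01; pose A := [set x | f x = 2^-1].
have tA : transferable_set A.
  (* The level set is where 1 - (f - 1/2)^2, a function with values in [0, 1], attains the value
     1. *)
  have -> : A = [set x | 1 + -1 * (f x + - 2^-1) ^+ 2 = 1].
    apply/seteqP; split => x /=; rewrite /A/= => h.
      by rewrite h subrr expr0n/= mulr0 addr0.
    have /eqP : (f x - 2^-1) ^+ 2 = 0 by lra.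
    by rewrite sqrf_eq0 subr_eq0 => /eqP.
  apply: transferable_set_eq1; last first.
    move=> x; have /andP[f0 f1] := f01 x; rewrite mulN1r; apply/andP; split.
      have f1' : 0 <= 1 - f x by rewrite subr_ge0.
      by have := mulr_ge0 f0 f1'; nra.
    by rewrite gerBl sqr_ge0.
  apply: transferableD; first exact: transferable_cst.
  apply: transferableM; first exact: transferable_cst.
  apply: transferableX; apply: transferableD => //; exact: transferable_cst.
have tAC := transferable_setC _ tA.
apply: (@transferable_lim (fun n x => (1 + -1 * f x ^+ n) ^+ (2 ^ n) * \1_(~` A) x) _ 0 1) => //.
- move=> n; apply: transferableM => //; apply: transferableX.
  apply: transferableD; first exact: transferable_cst.
  apply: transferableM; first exact: transferable_cst.
  exact: transferableX.
- move=> n x; have /andP[f0 f1] := f01 x.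
  have h1 : 0 <= f x ^+ n <= 1 by rewrite exprn_ge0//= exprn_ile1.
  rewrite -[leRHS]mulr1 normrM ler_pM//; last first.
    by have := indic_dominated (~` A) x; rewrite mul0r expR0 mulr1.
  rewrite mul0r expR0 mulr1 normrX exprn_ile1//; rewrite ger0_norm; lra.
- move=> x; rewrite [X in _ --> X]indicE/=; have [Ax|Ax] := pselect (A x).
    have -> : (x \in [set x | f x < 2^-1]) = false.
      by rewrite memNset//=; rewrite Ax ltxx.
    by apply: cvg_near_cst; apply: nearW => n; rewrite indicE memNset/= ?mulr0.
  have -> : (x \in [set x | f x < 2^-1]) = (f x < 2^-1).
    by apply/idP/idP; rewrite inE.
  rewrite (_ : (fun n => _) = (fun n => (1 - f x ^+ n) ^+ (2 ^ n))).
    by apply: cvg_threshold => //; exact/eqP.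
  by apply/funext => n; rewrite indicE mem_set//= mulr1 mulN1r.
Qed.

Definition half_spaces : set (set (I -> R)) :=
  [set A | exists i a, A = [set x | x i < a]].

(** Between -1 and 1 the sine has the sign of its argument, so that x_i < a exactly when sin((x_i -
    a) / m) < 0 for all large m: dividing by m brings any given point into that range. *)
Lemma transferable_half_space i a : transferable_set [set x | x i < a].
Proof.
have -> : [set x : I -> R | x i < a] = \bigcup_N \bigcap_n
    [set x | 2^-1 * (1 + sin ((N + n).+1%:R^-1 * (x i - a))) < 2^-1].
  have e (y : R) : (2^-1 * (1 + y) < 2^-1) = (y < 0) by apply/idP/idP; lra.
  have small (y : R) : exists N, forall n, `|(N + n).+1%:R^-1 * y| < 1.
    exists (Num.Def.truncn `|y|) => n.
    rewrite normrM ger0_norm ?invr_ge0// mulrC ltr_pdivrMr ?ltr0n// mul1r.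
    rewrite (lt_le_trans (truncnS_gt _))//.
    by rewrite ler_nat ltnS leq_addr.
  have pi1 : 1 < pi :> R by have := @pi_ge2 R; lra.
  apply/seteqP; split => x /=.
    move=> xa; have [N hN] := small (x i - a); exists N => // n _ /=.
    rewrite e; have := hN n; set y := _ * _ => y1.
    have y0 : y < 0 by rewrite /y pmulr_rlt0 ?invr_gt0// subr_lt0.
    rewrite -oppr_gt0 -sinN; apply: sin_gt0_pi.
    move: y1; rewrite ltr0_norm// => y1; apply/andP; split; lra.
  move=> [N _ hN]; rewrite ltNge; apply/negP => ax.
  have [M hM] := small (x i - a); have := hN M Logic.I => /=.
  rewrite e; have := hM N; rewrite addnC; set y := _ * _ => y1; apply/negP.
  have y0 : 0 <= y by rewrite /y mulr_ge0 ?invr_ge0// subr_ge0.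
  rewrite -leNgt; apply: sin_ge0_pi.
  move: y1; rewrite ger0_norm// => y1; apply/andP; split; lra.
apply: transferable_bigcup => N; apply: transferable_bigcap => n.
apply: transferable_set_lt_half; last first.
  by move=> x; have := sin_le1 ((N + n).+1%:R^-1 * (x i - a));
    have := sin_geN1 ((N + n).+1%:R^-1 * (x i - a)); lra.
apply: transferableM; first exact: transferable_cst.
apply: transferableD; first exact: transferable_cst.
exact: transferable_sin.
Qed.

(** Stability under products makes the transferable sets a sigma-algebra outright, without a
    monotone class argument. *)
Lemma transferable_borel : <<s half_spaces >> `<=` transferable_set.
Proof.
apply: smallest_sub.
  split.
  - by rewrite /transferable_set indic0; exact: transferable_cst.
  - by move=> A tA; rewrite setTD; exact: transferable_setC.
  - exact: transferable_bigcup.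
by move=> A [i [a ->]]; exact: transferable_half_space.
Qed.

Let vecType := g_sigma_algebraType half_spaces.

Lemma measurable_to_vec (U : I -> S -> R) :
  (forall i, measurable_fun setT (U i)) ->
  measurable_fun setT (fun s => (fun i => U i s) : vecType).
Proof.
move=> mU; apply: (@measurability _ _ S vecType setT _ half_spaces) => //.
move=> _ [_ [i [a ->]] <-].
rewrite (_ : _ `&` _ = setT `&` U i @^-1` `]-oo, a[); last first.
  by apply/seteqP; split => s /=; rewrite in_itv.
exact: mU.
Qed.

Lemma same_law (G : vecType -> \bar R) : measurable_fun setT G ->
  (forall x, 0 <= G x)%E ->
  (\int[nu]_s G (fun i => V i s) = \int[nu]_s G (fun i => W i s))%E.
Proof.
move=> mG G0.
have mV := measurable_to_vec V gV.1; have mW := measurable_to_vec W gW.1.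
have := ge0_integral_pushforward mV nu measurableT mG (fun y _ => G0 y).
have := ge0_integral_pushforward mW nu measurableT mG (fun y _ => G0 y).
rewrite !preimage_setT => <- <-; apply: eq_measure_integral => A mA _.
have := transferable_same_mean _ (transferable_borel _ mA).
rewrite /same_mean.
have e (U : I -> S -> R) (mU : measurable_fun setT (fun s => (fun i => U i s) : vecType)) :
    (\int[nu]_s (\1_A (fun i => U i s))%:E = nu ((fun s i => U i s) @^-1` A))%E.
  have mA' : measurable ((fun s i => U i s) @^-1` A).
    by rewrite -[X in measurable X]setTI; exact: mU.
  by rewrite -[in RHS](setIT (_ @^-1` _)) -integral_indic.
by rewrite !e.
Qed.

End mgf_determines_law.

Lemma measurable_vec_coord {R : realType} {I : finType} (i : I) :
  measurable_fun setT
    (fun x : g_sigma_algebraType (@half_spaces R I) => (x i : R)).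
Proof.
apply: (measurability _ (RGenInftyO.measurableE R)) => _ [_ [a ->] <-].
apply: sub_sigma_algebra; exists i, a.
by apply/seteqP; split => s /=; rewrite in_itv/=; [case|].
Qed.

(** * Concentration of Gaussian maxima *)

Section elementary_inequalities.
Context {R : realType}.

Lemma sin_le_id (x : R) : 0 <= x -> sin x <= x.
Proof.
move=> x0.
have [c _ h] := @MVT_segment R sin cos 0 x x0 (fun y _ => is_derive_sin y)
  (continuous_subspaceT (@continuous_sin R)).
by move: h; rewrite sin0 !subr0 => ->; rewrite ler_piMl// cos_le1.
Qed.

(** Half-angle formula: 1 - cos x = 2 sin(x / 2)^2. *)
Lemma one_sub_cos_le (x : R) : 0 <= x <= pi -> 1 - cos x <= x ^+ 2 / 2.
Proof.
move=> /andP[x0 xpi]; have -> : x = x / 2 + x / 2 by lra.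
rewrite cosD; have := cos2Dsin2 (x / 2).
have h1 : 0 <= x / 2 by lra.
have := sin_le_id _ h1.
have : 0 <= sin (x / 2) by apply: sin_ge0_pi; apply/andP; split; lra.
by nra.
Qed.

(** Averages the lower bound given by the tangent line of the exponential at the mean. *)
Lemma expR_jensen n (f : 'I_n.+1 -> R) :
  expR (n.+1%:R^-1 * \sum_i f i) <= n.+1%:R^-1 * \sum_i expR (f i).
Proof.
set a := n.+1%:R^-1 * _.
have n0 : n.+1%:R != 0 :> R by [].
have h i : expR a * (1 + (f i - a)) <= expR (f i).
  apply: (@le_trans _ _ (expR a * expR (f i - a))).
    by rewrite ler_pM2l ?expR_gt0// expR_ge1Dx.
  by rewrite -expRD addrCA subrr addr0.
apply: (@le_trans _ _ (n.+1%:R^-1 * \sum_i (expR a * (1 + (f i - a))))); last first.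
  by rewrite ler_wpM2l ?invr_ge0//; apply: ler_sum.
rewrite -mulr_sumr big_split/= sumrB !sumr_const card_ord.
rewrite le_eqVlt; apply/orP; left; apply/eqP.
have -> : \sum_(i < n.+1) f i = n.+1%:R * a by rewrite /a mulrA divff// mul1r.
by rewrite -(mulr_natl a) subrr addr0 mulrCA -mulr_natl mulr1 mulVf// mulr1.
Qed.

End elementary_inequalities.

Lemma integral_cst_prob {R : realType} {d : measure_display}
  {T : measurableType d} (P : probability T R) (a : R) :
  (\int[P]_x a%:E = a%:E)%E.
Proof.
have := integral_cst P measurableT a%:E.
by move=> ->; rewrite [X in (_ * X)%E]probability_setT mule1.
Qed.

Section gaussian_concentration.
Context {R : realType} {d : measure_display} {Omega : measurableType d}.
Context (P : probability Omega R) {I : finType}.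
Variables (D : I -> Omega -> R) (B : I -> I -> R).
Hypothesis mD : forall i, measurable_fun setT (D i).

Let Q (u : I -> R) : R := \sum_i \sum_j u i * u j * B i j.

Hypothesis mgfD : forall u : I -> R,
  (\int[P]_w (expR (dotp u (fun i => D i w)))%:E = (expR (2^-1 * Q u))%:E)%E.

Let nu : probability _ R := (P \x P)%E.

(** Two combinations of the vector and its independent copy, packed into a single vector indexed by
    [I + I], so that equality of their joint laws is an instance of [same_law]. *)
Definition rotated_pair (c s c' s' : R) (i : I + I) (z : Omega * Omega) : R :=
  match i with
  | inl i => c * D i z.1 + s * D i z.2
  | inr i => c' * D i z.1 + s' * D i z.2
  end.

Lemma measurable_rotated_pair c s c' s' i :
  measurable_fun setT (rotated_pair c s c' s' i).
Proof.
have m1 j : measurable_fun setT (fun z : Omega * Omega => D j z.1).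
  by apply: measurableT_comp => //; exact: measurable_fst.
have m2 j : measurable_fun setT (fun z : Omega * Omega => D j z.2).
  by apply: measurableT_comp => //; exact: measurable_snd.
by case: i => i; apply: measurable_funD => //; apply: measurable_funM.
Qed.

Lemma fubini_ge0 (f : Omega * Omega -> R) : measurable_fun setT f ->
  (forall z, 0 <= f z) ->
  (\int[nu]_z (f z)%:E = \int[P]_w \int[P]_w' (f (w, w'))%:E)%E.
Proof.
by move=> mf f0; rewrite fubini_tonelli1//; exact/measurable_EFinP.
Qed.

Lemma mgf_rotated_pair c s c' s' (u : I + I -> R) :
  (\int[nu]_z (expR (dotp u (fun i => rotated_pair c s c' s' i z)))%:E =
   (expR (2^-1 * (Q (fun i => u (inl i) * c + u (inr i) * c') +
                  Q (fun i => u (inl i) * s + u (inr i) * s'))))%:E)%E.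
Proof.
set a := fun i => _ + _ * c'; set b := fun i => _ + _ * s'.
have e z : dotp u (fun i => rotated_pair c s c' s' i z) =
    dotp a (fun i => D i z.1) + dotp b (fun i => D i z.2).
  rewrite /dotp big_sumType/= -!big_split/=; apply: eq_bigr => i _.
  rewrite /a /b; ring.
under eq_integral do rewrite e.
have mdot (v : I -> R) : measurable_fun setT (fun w => dotp v (fun i => D i w)).
  by apply: measurable_sum => i; apply: measurable_funM.
rewrite fubini_ge0//; last first.
  apply: measurableT_comp => //; apply: measurable_funD => //.
    by apply: (measurableT_comp (mdot a)); exact: measurable_fst.
  by apply: (measurableT_comp (mdot b)); exact: measurable_snd.
have mexp (v : I -> R) : measurable_fun setT (fun w => (expR (dotp v (fun i => D i w)))%:E).
  by apply/measurable_EFinP/measurableT_comp.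
have pexp (v : I -> R) (w : Omega) : setT w ->
    (0 <= (expR (dotp v (fun i => D i w)))%:E)%E by rewrite lee_fin expR_ge0.
have inner w : (\int[P]_w' (expR (dotp a (fun i => D i w) + dotp b (fun i => D i w')))%:E =
    (expR (2^-1 * Q b))%:E * (expR (dotp a (fun i => D i w)))%:E)%E.
  have h := ge0_integralZl_EFin P measurableT (pexp b) (mexp b)
    (expR_ge0 (dotp a (fun i => D i w))).
  rewrite mgfD muleC in h.
  by under eq_integral do rewrite expRD EFinM.
under eq_integral do rewrite /= inner.
have h := ge0_integralZl_EFin P measurableT (pexp a) (mexp a)
  (expR_ge0 (2^-1 * Q b)).
by rewrite [LHS]h mgfD -EFinM -expRD mulrDr addrC.
Qed.

Lemma has_mgf_rotated_pair c s c' s' : has_mgf nu (rotated_pair c s c' s').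
Proof.
split; first exact: measurable_rotated_pair.
by move=> u; rewrite mgf_rotated_pair ltry.
Qed.

Let vecType := g_sigma_algebraType (@half_spaces R (I + I)%type).

(* Only the Gram matrix of the two unit vectors matters. *)
Lemma same_law_rotated_pair c s c' s' k t (G : vecType -> \bar R) :
  c ^+ 2 + s ^+ 2 = 1 -> c' ^+ 2 + s' ^+ 2 = 1 -> c * c' + s * s' = k ->
  k ^+ 2 + t ^+ 2 = 1 ->
  measurable_fun setT G -> (forall x, 0 <= G x)%E ->
  (\int[nu]_z G (fun i => rotated_pair c s c' s' i z) =
   \int[nu]_z G (fun i => rotated_pair 1 0 k t i z))%E.
Proof.
move=> h1 h2 h3 h4 mG G0; apply: (same_law nu) => //;
  [exact: has_mgf_rotated_pair|exact: has_mgf_rotated_pair|].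
move=> u; rewrite !mgf_rotated_pair; congr (expR (_ * _))%:E.
rewrite /Q -!big_split/=; apply: eq_bigr => i _.
rewrite -!big_split/=; apply: eq_bigr => j _.
set p := u (inl i); set q := u (inr i); set p' := u (inl j); set q' := u (inr j).
transitivity ((p * p' * (c ^+ 2 + s ^+ 2) + q * q' * (c' ^+ 2 + s' ^+ 2) +
  (p * q' + q * p') * (c * c' + s * s')) * B i j); first by ring.
transitivity ((p * p' + q * q' * (k ^+ 2 + t ^+ 2) +
  (p * q' + q * p') * k) * B i j); last by ring.
by rewrite h1 h2 h3 h4 !mulr1.
Qed.

Definition max_norm (x : I -> R) : R := \big[Num.max/0]_i `|x i|.

Lemma max_norm_ge x i : `|x i| <= max_norm x.
Proof. exact: le_bigmax. Qed.

Lemma max_norm_ge0 x : 0 <= max_norm x.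
Proof. exact: bigmax_ge_id. Qed.

Lemma max_norm_arg x : max_norm x = 0 \/ exists i, max_norm x = `|x i|.
Proof.
rewrite /max_norm; elim/big_ind : _ => [|a b [->|[i ->]] [->|[j ->]]|i _].
- by left.
- by left; rewrite maxxx.
- by right; exists j; rewrite max_r.
- by right; exists i; rewrite max_l.
- by right; rewrite /Num.max; case: ifP => _; [exists j|exists i].
- by right; exists i.
Qed.

(** The truncation bounds the drift (1 - k) F of one rotation step by (1 - k) r, so that no
    exponential moment of the maximum itself is involved. *)
Definition trunc_max (r : R) (x : I -> R) : R := Num.min (max_norm x) r.

Definition exp_increment (l r : R) (x : I + I -> R) : R :=
  expR (l * (trunc_max r (x \o inl) - trunc_max r (x \o inr))).

Lemma measurable_max_norm dT (T : measurableType dT) (f : I -> T -> R) :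
  (forall i, measurable_fun setT (f i)) ->
  measurable_fun setT (fun x => max_norm (f^~ x)).
Proof.
move=> mf; rewrite /max_norm.
elim: (index_enum I) => [|i s ih].
  by under eq_fun do rewrite big_nil; exact: measurable_cst.
under eq_fun do rewrite big_cons.
by apply: measurable_maxr => //; apply: measurableT_comp => //; exact: mf.
Qed.

Lemma measurable_exp_increment l r :
  measurable_fun setT (fun x : vecType => exp_increment l r x).
Proof.
have h (g : I -> I + I) : measurable_fun setT (fun x : vecType => trunc_max r (x \o g)).
  apply: measurable_minr => //.
  apply: (@measurable_max_norm _ vecType (fun i x => x (g i))) => i.
  exact: measurable_vec_coord.
rewrite /exp_increment; apply: measurableT_comp => //.
apply: measurable_funM => //; exact: measurable_funB.
Qed.

Lemma mgf_single i (a : R) :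
  (\int[P]_w (expR (a * D i w))%:E = (expR (2^-1 * (a ^+ 2 * B i i)))%:E)%E.
Proof.
have := mgfD (fun j => if j == i then a else 0).
under eq_integral do rewrite dotp_single.
move=> ->; congr (expR (_ * _))%:E; rewrite /Q.
rewrite (bigD1 i)//= [X in _ + X]big1 ?addr0; last first.
  by move=> j /negbTE ji; apply: big1 => k _; rewrite ji !mul0r.
rewrite (bigD1 i)//= [X in _ + X]big1 ?addr0 ?eqxx//.
by move=> k /negbTE ki; rewrite ki mulr0 mul0r.
Qed.

(** The largest |Z_i| is attained at an index that depends on Z alone. For fixed Z, a positive
    increment is at most (1 - k) r minus t times one signed coordinate of Z', whose exponential
    moment is explicit; hence the number of coordinates does not enter. The summand 1 accounts for
    nonpositive increments. *)
Lemma one_step_bound l r k t v : 0 <= l -> 0 <= r -> 0 <= k <= 1 ->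
  (forall i, B i i <= v) ->
  (\int[nu]_z (exp_increment l r (fun i => rotated_pair 1 0 k t i z))%:E <=
   (1 + expR (l * (1 - k) * r + 2^-1 * (l ^+ 2 * t ^+ 2 * v)))%:E)%E.
Proof.
move=> l0 r0 /andP[k0 k1] Bv.
rewrite fubini_ge0; last 2 first.
- apply: (measurableT_comp (measurable_exp_increment l r)).
  exact: measurable_to_vec (measurable_rotated_pair 1 0 k t).
- by move=> z; exact: expR_ge0.
rewrite -[leRHS](integral_cst_prob P).
have mrot i : measurable_fun setT (rotated_pair 1 0 k t i).
  exact: measurable_rotated_pair.
apply: ge0_le_integral => //.
- by move=> w _; apply: integral_ge0 => w' _; rewrite lee_fin expR_ge0.
- apply: (@measurable_fun_fubini_tonelli_F _ _ _ _ _ P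
    (fun z => (exp_increment l r (fun i => rotated_pair 1 0 k t i z))%:E)) => //.
    apply/measurable_EFinP; apply: (measurableT_comp (measurable_exp_increment l r)).
    exact: measurable_to_vec.
  by move=> z; rewrite lee_fin expR_ge0.
move=> w _ /=.
have mw' i : measurable_fun setT (fun w' => rotated_pair 1 0 k t i (w, w')).
  exact: measurableT_comp.
have mexp : measurable_fun setT (fun w' => (exp_increment l r
    (fun i => rotated_pair 1 0 k t i (w, w')))%:E).
  apply/measurable_EFinP; apply: (measurableT_comp (measurable_exp_increment l r)).
  exact: measurable_to_vec.
pose x i := D i w.
have e1 w' : ((fun i => rotated_pair 1 0 k t i (w, w')) \o inl) = x.
  by apply/funext => i; rewrite /rotated_pair/= mul1r mul0r addr0.
(* Here a maximizing index may fail to exist, as [I] may be empty, but the increment is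
   nonpositive. *)
have [F0|F0] := eqVneq (max_norm x) 0.
  apply: (@le_trans _ _ (\int[P]_w' 1%:E)%E); last first.
    by rewrite integral_cst_prob lee_fin lerDl expR_ge0.
  apply: ge0_le_integral => //.
  - by move=> w' _; rewrite lee_fin expR_ge0.
  move=> w' _; rewrite lee_fin /exp_increment e1 {1}/trunc_max F0 -[leRHS]expR0.
  rewrite ler_expR (min_l r0) sub0r mulrN oppr_le0 mulr_ge0//.
  by rewrite le_min r0 max_norm_ge0.
have [i0 Fi0] : exists i, max_norm x = `|x i|.
  by have [/eqP|//] := max_norm_arg x; rewrite (negbTE F0).
pose sg : R := Num.sg (x i0).
apply: (@le_trans _ _ (\int[P]_w' (1 + (expR (l * (1 - k) * r) * expR (- (l * t * sg) * D i0 w')))%:E)%E).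
  apply: ge0_le_integral => //.
  - by move=> w' _; rewrite lee_fin expR_ge0.
  - apply/measurable_EFinP; apply: measurable_funD => //.
    apply: measurable_funM => //; apply: measurableT_comp => //.
    exact: measurable_funM.
  move=> w' _; rewrite lee_fin /exp_increment e1.
  set f' := trunc_max r (_ \o inr).
  have [le0|gt0] := leP (trunc_max r x) f'.
    apply: (@le_trans _ _ 1); last by rewrite lerDl mulr_ge0 ?expR_ge0.
    by rewrite -[leRHS]expR0 ler_expR mulr_ge0_le0// subr_le0.
  apply: (@le_trans _ _ (expR (l * (1 - k) * r) * expR (- (l * t * sg) * D i0 w'))); last first.
    by rewrite lerDr.
  rewrite -expRD ler_expR.
  have -> : l * (1 - k) * r + - (l * t * sg) * D i0 w' =
    l * ((1 - k) * r - t * (sg * D i0 w')) by ring.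
  apply: ler_wpM2l => //.
  set y := (fun i => rotated_pair 1 0 k t i (w, w')) \o inr.
  have f'E : f' = max_norm y.
    rewrite /f' /trunc_max -/y; apply: min_l; rewrite leNgt; apply/negP => ry.
    by move: gt0; rewrite /f' /trunc_max -/y (min_r (ltW ry)) lt_min ltxx andbF.
  have xi0 : `|x i0| = sg * x i0 by rewrite /sg normrEsg.
  have h1 : sg * y i0 <= f'.
    rewrite f'E (le_trans _ (max_norm_ge _ i0))// (le_trans (ler_norm _))//.
    rewrite normrM ler_piMl// /sg normr_sg; by case: (_ != 0).
  have h2 : y i0 = k * x i0 + t * D i0 w' by [].
  have h3 : trunc_max r x <= sg * x i0 by rewrite -xi0 -Fi0 ge_min lexx.
  have h4 : trunc_max r x <= r by rewrite ge_min lexx orbT.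
  have h5 : k * trunc_max r x <= k * (sg * x i0) by rewrite ler_wpM2l.
  have h6 : (1 - k) * trunc_max r x <= (1 - k) * r by rewrite ler_wpM2l// subr_ge0.
  move: h1; rewrite h2; nra.
have mz : measurable_fun setT (fun w' => (expR (- (l * t * sg) * D i0 w'))%:E).
  apply/measurable_EFinP; apply: measurableT_comp => //; exact: measurable_funM.
have pz (w' : Omega) : setT w' -> (0 <= (expR (- (l * t * sg) * D i0 w'))%:E)%E.
  by rewrite lee_fin expR_ge0.
have hz := ge0_integralZl_EFin P measurableT pz mz (expR_ge0 (l * (1 - k) * r)).
have hd : (\int[P]_w' (1%:E + (expR (l * (1 - k) * r))%:E *
     (expR (- (l * t * sg) * D i0 w'))%:E) =
   \int[P]_w' 1%:E + \int[P]_w' ((expR (l * (1 - k) * r))%:E *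
     (expR (- (l * t * sg) * D i0 w'))%:E))%E.
  have p2 (w' : Omega) : setT w' -> (0 <= (expR (l * (1 - k) * r))%:E *
     (expR (- (l * t * sg) * D i0 w'))%:E)%E.
    by rewrite -EFinM lee_fin mulr_ge0 ?expR_ge0.
  have m2 : measurable_fun setT (fun w' => ((expR (l * (1 - k) * r))%:E *
     (expR (- (l * t * sg) * D i0 w'))%:E)%E).
    by apply: emeasurable_funM => //; exact: measurable_cst.
  have p1 (w' : Omega) : setT w' -> (0 <= (1 : R)%:E)%E by rewrite lee_fin.
  exact: (ge0_integralD P measurableT p1 (measurable_cst _) p2 m2).
under eq_integral do rewrite EFinD EFinM.
rewrite hd hz integral_cst_prob.
rewrite mgf_single -EFinM -EFinD lee_fin lerD2l -expRD ler_expR lerD2l.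
rewrite ler_wpM2l// sqrrN !exprMn.
have -> : sg ^+ 2 = 1 by rewrite /sg sqr_sg -normr_eq0 -Fi0 F0.
by rewrite mulr1 ler_wpM2l// mulr_ge0 ?sqr_ge0.
Qed.

Let angle (m j : nat) : R := j%:R * (pi / 2 / m.+1%:R).

Let step (m j : nat) :=
  rotated_pair (cos (angle m j)) (sin (angle m j))
    (cos (angle m j.+1)) (sin (angle m j.+1)).

(** The angle runs from 0, which gives Z, to pi / 2, which gives Z'. Writing the difference as an
    average of [m.+1] rescaled steps allows Jensen's inequality to separate steps that are not
    independent. *)
Lemma exp_increment_telescope l r m z :
  exp_increment l r (fun i => rotated_pair 1 0 0 1 i z) <=
  m.+1%:R^-1 * \sum_(j < m.+1)
     exp_increment (l * m.+1%:R) r (fun i => step m j i z).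
Proof.
pose a j := trunc_max r (fun i => cos (angle m j) * D i z.1 + sin (angle m j) * D i z.2).
have -> : exp_increment l r (fun i => rotated_pair 1 0 0 1 i z) = expR (l * (a 0 - a m.+1)).
  rewrite /exp_increment /a.
  have -> : (fun i => rotated_pair 1 0 0 1 i z) \o inl =
      (fun i => cos (angle m 0) * D i z.1 + sin (angle m 0) * D i z.2).
    by apply/funext => i; rewrite /angle mul0r cos0 sin0.
  have -> // : (fun i => rotated_pair 1 0 0 1 i z) \o inr =
      (fun i => cos (angle m m.+1) * D i z.1 + sin (angle m m.+1) * D i z.2).
  have am : angle m m.+1 = pi / 2 by rewrite /angle mulrC divfK.
  by apply/funext => i; rewrite am cos_pihalf sin_pihalf.
have -> : l * (a 0 - a m.+1) =
    m.+1%:R^-1 * \sum_(j < m.+1) (l * m.+1%:R * (a j - a j.+1)).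
  have tel n : \sum_(j < n) (a j - a j.+1) = a 0 - a n.
    elim: n => [|n ih]; first by rewrite big_ord0 subrr.
    by rewrite big_ord_recr/= ih addrA subrK.
  by rewrite -mulr_sumr tel mulrA [in RHS](mulrC l) mulrA mulVf// mul1r.
exact: expR_jensen.
Qed.

(** By rotation invariance all the steps have the law of the pair at angle pi / 2 / (m + 1), hence
    the same bound, which their average inherits. *)
Lemma rotated_increment_bound l r m v : 0 <= l -> 0 <= r ->
  (forall i, B i i <= v) ->
  (\int[nu]_z (exp_increment l r (fun i => rotated_pair 1 0 0 1 i z))%:E <=
   (1 + expR (l * m.+1%:R * (1 - cos (pi / 2 / m.+1%:R)) * r +
      2^-1 * ((l * m.+1%:R) ^+ 2 * sin (pi / 2 / m.+1%:R) ^+ 2 * v)))%:E)%E.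
Proof.
move=> l0 r0 Bv; set h := pi / 2 / _; set b := 1 + expR _.
have m0 : 0 < m.+1%:R :> R by [].
have mstep j : measurable_fun setT
    (fun z => (exp_increment (l * m.+1%:R) r (fun i => step m j i z))%:E).
  apply/measurable_EFinP; apply: (measurableT_comp (measurable_exp_increment _ r)).
  by apply: measurable_to_vec => i; exact: measurable_rotated_pair.
have pstep (j : nat) (z : Omega * Omega) : setT z ->
    (0 <= (exp_increment (l * m.+1%:R) r (fun i => step m j i z))%:E)%E.
  by rewrite lee_fin expR_ge0.
apply: (@le_trans _ _ (\int[nu]_z ((m.+1%:R^-1)%:E * \sum_(j < m.+1)
     (exp_increment (l * m.+1%:R) r (fun i => step m j i z))%:E)))%E.
  apply: ge0_le_integral => //.
  - by move=> z _; rewrite lee_fin expR_ge0.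
  - apply/measurable_EFinP; apply: (measurableT_comp (measurable_exp_increment _ r)).
    by apply: measurable_to_vec => i; exact: measurable_rotated_pair.
  - apply: emeasurable_funM; first exact: measurable_cst.
    by apply: emeasurable_sum => j; exact: mstep.
  - by move=> z _; rewrite sumEFin -EFinM lee_fin exp_increment_telescope.
have psum (z : Omega * Omega) : setT z -> (0 <= \sum_(j < m.+1)
    (exp_increment (l * m.+1%:R) r (fun i => step m j i z))%:E)%E.
  by move=> _; apply: sume_ge0 => j _; exact: pstep.
have msum := emeasurable_sum (index_enum 'I_m.+1) (fun j : 'I_m.+1 => mstep j).
have minv0 : 0 <= m.+1%:R^-1 :> R by rewrite invr_ge0 ltW.
rewrite (ge0_integralZl_EFin nu measurableT psum msum minv0).
rewrite ge0_integral_sum//; last first.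
  by move=> j; exact: pstep.
rewrite muleC lee_pdivrMr//.
apply: (@le_trans _ _ (\sum_(j < m.+1) b%:E)%E); last first.
  by rewrite sumEFin sumr_const card_ord -EFinM mulr_natr.
apply: lee_sum => j _.
have cs2 x : cos x ^+ 2 + sin x ^+ 2 = 1 :> R by exact: cos2Dsin2.
have h0 : 0 <= h by rewrite /h !divr_ge0// pi_ge0.
have hpi : h <= pi / 2.
  by rewrite /h ler_pdivrMr// ler_peMr ?divr_ge0 ?pi_ge0// ler1n.
have kc : cos (angle m j) * cos (angle m j.+1) +
    sin (angle m j) * sin (angle m j.+1) = cos h.
  by rewrite mulrC [X in _ + X]mulrC -cosB /angle -mulrBl -natrB// subSnn mul1r.
rewrite (same_law_rotated_pair _ _ _ _ (cos h) (sin h)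
   (fun x => (exp_increment (l * m.+1%:R) r x)%:E))//.
- apply: one_step_bound => //; first by rewrite mulr_ge0// ltW.
  by rewrite cos_le1 andbT cos_ge0_pihalf// hpi andbT (le_trans _ h0)// oppr_le0 divr_ge0 ?pi_ge0.
- by apply/measurable_EFinP; exact: measurable_exp_increment.
- by move=> x; rewrite lee_fin expR_ge0.
Qed.

(** When the first copy reaches r and the second stays below r / 2, the truncated increment is at
    least r / 2. By independence this costs at most a factor 2 against the event for the first copy
    alone, and the exponential Markov inequality applies. *)
Lemma gaussian_max_tail (r v : R) : 0 < r -> 0 < v -> (forall i, B i i <= v) ->
  ((2^-1)%:E <= P [set w | (max_norm (fun i => D i w) <= r / 2)%R])%E ->
  (P [set w | (r <= max_norm (fun i => D i w))%R] <=
   (expR (3 - r ^+ 2 / (32 * v)))%:E)%E.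
Proof.
move=> r0 v0 Bv; set C := [set w | _ <= r / 2]; move=> PC; set A := [set w | r <= _].
have mmax : measurable_fun setT (fun w => max_norm (fun i => D i w)).
  exact: measurable_max_norm.
have mA : measurable A.
  rewrite (_ : A = setT `&` (fun w => max_norm (fun i => D i w)) @^-1` `[r, +oo[).
    exact: mmax.
  by apply/seteqP; split => w /=; rewrite /A/= in_itv/= andbT; [split|case].
have mC : measurable C.
  rewrite (_ : C = setT `&` (fun w => max_norm (fun i => D i w)) @^-1` `]-oo, r / 2]).
    exact: mmax.
  by apply/seteqP; split => w /=; rewrite /C/= in_itv/=; [split|case].
(* Maximizer of l r / 2 - 2 l^2 v; the maximum is r^2 / (32 v). *)
pose l := r / (8 * v).
have l0 : 0 < l by rewrite divr_gt0// mulr_gt0.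
have lower : ((expR (l * (r / 2)))%:E * (P A * P C) <=
    \int[nu]_z (exp_increment l r (fun i => rotated_pair 1 0 0 1 i z))%:E)%E.
  have -> : (P A * P C = nu (A `*` C))%E by rewrite -product_measure1E.
  rewrite -[X in nu X]setIT -integral_indic//; last exact: measurableX.
  have mi : measurable_fun setT (fun z => (\1_(A `*` C) z : R)%:E).
    by apply/measurable_EFinP/measurable_indic; exact: measurableX.
  have pi0 (z : Omega * Omega) : setT z -> (0 <= (\1_(A `*` C) z : R)%:E)%E.
    by rewrite lee_fin.
  rewrite -(ge0_integralZl_EFin nu measurableT pi0 mi (expR_ge0 _)).
  apply: ge0_le_integral => //.
  - by apply: emeasurable_funM => //; exact: measurable_cst.
  - apply/measurable_EFinP; apply: (measurableT_comp (measurable_exp_increment _ r)).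
    by apply: measurable_to_vec => i; exact: measurable_rotated_pair.
  - move=> z _; rewrite -EFinM lee_fin indicE.
    have [/set_mem[/= zA zC]|_] := boolP (z \in A `*` C); last by rewrite mulr0 expR_ge0.
    rewrite mulr1 ler_expR ler_pM2l//.
    have -> : trunc_max r ((fun i => rotated_pair 1 0 0 1 i z) \o inl) = r.
      rewrite /trunc_max min_r//; apply: (le_trans zA).
      rewrite le_eqVlt; apply/orP; left; apply/eqP; congr max_norm.
      by apply/funext => i /=; rewrite mul1r mul0r addr0.
    have : trunc_max r ((fun i => rotated_pair 1 0 0 1 i z) \o inr) <= r / 2.
      rewrite /trunc_max ge_min; apply/orP; left; apply: (le_trans _ zC).
      rewrite le_eqVlt; apply/orP; left; apply/eqP; congr max_norm.
      by apply/funext => i /=; rewrite mul1r mul0r add0r.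
    lra.
(* With so many steps the total drift, at most 2 l r / (m + 1), is bounded by 1. *)
have [m hm] : exists m : nat, 2 * l * r <= m.+1%:R.
  by exists (Num.Def.truncn (2 * l * r)); rewrite ltW// truncnS_gt.
have upper := rotated_increment_bound l r m v (ltW l0) (ltW r0) Bv.
have m0 : 0 < m.+1%:R :> R by [].
set h := pi / 2 / m.+1%:R in upper.
have h0 : 0 <= h by rewrite /h !divr_ge0// pi_ge0.
have hM : m.+1%:R * h = pi / 2 by rewrite /h mulrC divfK.
have pi2 : pi / 2 < 2 :> R := pihalf_lt2 R.
have hpi : h <= pi.
  rewrite /h -mulrA ler_piMr ?pi_ge0// -invfM invf_le1// -natrM ler1n//.
have e1 : l * m.+1%:R * (1 - cos h) * r <= 1.
  have c1 := one_sub_cos_le h; rewrite h0 hpi in c1; have {}c1 := c1 isT.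
  have : l * m.+1%:R * (1 - cos h) * r <= l * m.+1%:R * (h ^+ 2 / 2) * r.
    by rewrite ler_pM2r// ler_pM2l// mulr_gt0.
  have : m.+1%:R * (l * m.+1%:R * (h ^+ 2 / 2) * r) <= m.+1%:R.
    have -> : m.+1%:R * (l * m.+1%:R * (h ^+ 2 / 2) * r) =
      l * r / 2 * (m.+1%:R * h) ^+ 2 by ring.
    rewrite hM; have : (pi / 2) ^+ 2 <= 4 :> R.
      have := @pi_ge0 R; nra.
    have := mulr_gt0 l0 r0; nra.
  rewrite -[X in _ <= X]mulr1 ler_pM2l//; lra.
(* Since (m + 1) h = pi / 2 < 2, the quadratic term stays below 2 l^2 v for any number of steps. *)
have e2 : 2^-1 * ((l * m.+1%:R) ^+ 2 * sin h ^+ 2 * v) <= 2 * l ^+ 2 * v.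
  have s1 := sin_le_id _ h0.
  have s0 : 0 <= sin h by apply: sin_ge0_pi; rewrite h0.
  have : (m.+1%:R * sin h) ^+ 2 <= 4.
    have : m.+1%:R * sin h <= pi / 2 by rewrite -hM ler_pM2l.
    have : 0 <= m.+1%:R * sin h by rewrite mulr_ge0// ltW.
    nra.
  have : 0 <= l ^+ 2 * v by rewrite mulr_ge0 ?sqr_ge0// ltW.
  rewrite !exprMn; nra.
have {}upper := le_trans lower upper.
have fA : P A \is a fin_num by exact: fin_num_measure.
have fC : P C \is a fin_num by exact: fin_num_measure.
rewrite -(fineK fA) -(fineK fC) -!EFinM lee_fin in upper.
rewrite -(fineK fA) lee_fin.
rewrite -(fineK fC) lee_fin in PC.
have pA0 : 0 <= fine (P A) by rewrite fine_ge0.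
have pv : l * (r / 2) - 2 * l ^+ 2 * v = r ^+ 2 / (32 * v).
  by rewrite /l; field; rewrite gt_eqF.
set X := l * m.+1%:R * (1 - cos h) * r + _ in upper.
have hX : X <= 1 + 2 * l ^+ 2 * v by rewrite /X lerD.
(* The constant 3 of the conclusion has three units: one bounds the drift, one absorbs the summand
   1, and one the factor 2 coming from the probability of [C]. *)
have e : 1 + expR X <= expR (2 + 2 * l ^+ 2 * v).
  have a0 : 0 <= 1 + 2 * l ^+ 2 * v.
    by have := mulr_ge0 (sqr_ge0 l) (ltW v0); lra.
  have a1 : 1 <= expR (1 + 2 * l ^+ 2 * v) by rewrite -[leLHS]expR0 ler_expR.
  have a2 : expR X <= expR (1 + 2 * l ^+ 2 * v) by rewrite ler_expR.
  apply: (@le_trans _ _ (expR 1 * expR (1 + 2 * l ^+ 2 * v))).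
    have := expR_ge1Dx (1 : R); nra.
  by rewrite -expRD ler_expR; lra.
have f1 : fine (P A) <= 2 * (expR (2 + 2 * l ^+ 2 * v) * expR (- (l * (r / 2)))).
  have g0 := expR_gt0 (l * (r / 2)).
  rewrite expRN mulrA ler_pdivlMr// mulrC.
  have : expR (l * (r / 2)) * fine (P A) * 2^-1 <= expR (2 + 2 * l ^+ 2 * v).
    apply: le_trans e; apply: le_trans upper.
    rewrite -mulrA ler_pM2l// ler_wpM2l//.
  lra.
apply: (le_trans f1); rewrite -expRD -pv.
apply: (@le_trans _ _ (expR 1 * expR (2 + 2 * l ^+ 2 * v + - (l * (r / 2))))).
  by rewrite ler_wpM2r ?expR_ge0//; have := expR_ge1Dx (1 : R); lra.
by rewrite -expRD ler_expR; lra.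
Qed.

End gaussian_concentration.

(** * Gaussian processes *)

Section normal_mgf.
Context {R : realType}.
Local Notation leb := (@lebesgue_measure R).

(** The Radon-Nikodym derivative of the normal law agrees almost everywhere with the normal density,
    as both have the same integral over every measurable set. *)
Lemma ge0_integral_normal_prob (m s : R) (f : R -> \bar R) :
  measurable_fun setT f -> (forall x, 0 <= f x)%E ->
  (\int[normal_prob m s]_x f x = \int[leb]_x (f x * (normal_pdf m s x)%:E))%E.
Proof.
move=> mf f0.
have dom := @normal_prob_dominates R m s.
rewrite -(Radon_Nikodym_SigmaFinite.change_of_variables dom f0 measurableT mf).
apply: ge0_ae_eq_integral => //.
- apply: emeasurable_funM => //; apply: (measurable_int leb).
  exact: Radon_Nikodym_SigmaFinite.f_integrable.
- apply: emeasurable_funM => //; apply/measurable_EFinP.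
  exact: measurable_normal_pdf.
- by move=> x _; rewrite mule_ge0// Radon_Nikodym_SigmaFinite.f_ge0.
- by move=> x _; rewrite mule_ge0// lee_fin normal_pdf_ge0.
- apply: ae_eqe_mul2l; apply: integral_ae_eq => //.
  + exact: Radon_Nikodym_SigmaFinite.f_integrable.
  + by apply/measurable_EFinP; exact: measurable_normal_pdf.
  + by move=> E _ mE; rewrite -(Radon_Nikodym_SigmaFinite.f_integral dom).
Qed.

(** Completing the square moves the mean of the density to m + s^2 u. *)
Lemma mgf_normal_prob (m s u : R) : s != 0 ->
  (\int[normal_prob m s]_x (expR (u * x))%:E =
   (expR (u * m + 2^-1 * (u ^+ 2 * s ^+ 2)))%:E)%E.
Proof.
move=> s0.
have mu_ : measurable_fun setT (fun x : R => (expR (u * x))%:E).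
  by apply/measurable_EFinP; apply: measurableT_comp => //; exact: measurable_funM.
have pu (x : R) : (0 <= (expR (u * x))%:E)%E by rewrite lee_fin expR_ge0.
rewrite ge0_integral_normal_prob//.
have e x : ((expR (u * x))%:E * (normal_pdf m s x)%:E =
   (expR (u * m + 2^-1 * (u ^+ 2 * s ^+ 2)))%:E *
   (normal_pdf (m + s ^+ 2 * u) s x)%:E)%E.
  rewrite !normal_pdfE// -!EFinM /normal_fun; congr EFin.
  rewrite mulrCA [RHS]mulrCA; congr (_ * _); rewrite -!expRD; congr expR.
  by field.
under eq_integral do rewrite e.
have p0 (x : R) : setT x -> (0 <= (normal_pdf (m + s ^+ 2 * u) s x)%:E)%E.
  by rewrite lee_fin normal_pdf_ge0.
have mp : measurable_fun setT (fun x => (normal_pdf (m + s ^+ 2 * u) s x)%:E).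
  by apply/measurable_EFinP; exact: measurable_normal_pdf.
rewrite (ge0_integralZl_EFin leb measurableT p0 mp (expR_ge0 _)).
by rewrite integral_normal_pdf mule1.
Qed.

End normal_mgf.

Section gaussian_rv_moments.
Context {R : realType} {d : measure_display} {Omega : measurableType d}.
Context (P : probability Omega R).

Lemma gaussian_rv_mgf (Z : Omega -> R) : measurable_fun setT Z ->
  gaussian_rv P Z -> exists m v : R, 0 <= v /\ forall u,
   (\int[P]_w (expR (u * Z w))%:E = (expR (u * m + 2^-1 * (u ^+ 2 * v)))%:E)%E.
Proof.
move=> mZ [m [s [s0 lawZ]]]; exists m, (s ^+ 2); split; first exact: sqr_ge0.
move=> u.
have mf : measurable_fun setT (fun x : measurableTypeR R => (expR (u * (x : R)))%:E).
  by apply/measurable_EFinP; apply: measurableT_comp => //; exact: measurable_funM.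
have {}mZ : measurable_fun setT (Z : Omega -> measurableTypeR R) := mZ.
have f0 (x : measurableTypeR R) : (0 <= (expR (u * x))%:E)%E by rewrite lee_fin expR_ge0.
have := ge0_integral_pushforward mZ P measurableT mf (fun x _ => f0 x).
rewrite preimage_setT => <-.
(* The degenerate law is a Dirac mass; it obeys the same formula with variance 0. *)
have [se|sn] := eqVneq s 0.
  transitivity (\int[dirac (m : measurableTypeR R)]_x (expR (u * x))%:E)%E.
    apply: (@eq_measure_integral _ (measurableTypeR R)) => A mA _.
    by have := lawZ A mA; rewrite /gaussian_law se eqxx.
  by rewrite integral_dirac// diracT mul1e se expr0n/= !mulr0 addr0.
rewrite -(mgf_normal_prob m s u sn).
apply: (@eq_measure_integral _ (measurableTypeR R)) => A mA _.
by have := lawZ A mA; rewrite /gaussian_law (negbTE sn).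
Qed.

Lemma cvg_expR_quotient_seq (t x_ : nat -> R) (x : R) : (forall n, 0 < t n) ->
  (t n)^-1 @[n --> \oo] --> 0 -> x_ n @[n --> \oo] --> x ->
  t n * (expR (x_ n / t n) - 1) @[n --> \oo] --> x.
Proof.
move=> t0 ct cx.
have h0 : x_ n / t n @[n --> \oo] --> (0 : R).
  by rewrite -[X in _ --> X](mulr0 x); exact: cvgM.
apply: (@squeeze_cvgr _ _ _ _ x_ (fun n => x_ n * expR (x_ n / t n))) => //.
- apply: nearW => n; have /andP[h1 h2] := expR_sub1_bounds (x_ n / t n).
  have e : x_ n = t n * (x_ n / t n) by rewrite mulrC divfK ?gt_eqF.
  have le (a b : R) : a <= b -> t n * a <= t n * b by move=> ab; rewrite ler_pM2l.
  apply/andP; split; first by rewrite {1}e le.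
  by rewrite {2}e -mulrA le.
- rewrite -[X in _ --> X]mulr1; apply: cvgM => //.
  have c0 : {for (0:R), continuous expR} by exact: continuous_expR.
  by rewrite -[X in _ --> X]expR0; exact: (continuous_cvg _ c0 h0).
Qed.

Variables (Z : Omega -> R) (m v : R).
Hypothesis mZ : measurable_fun setT Z.
Hypothesis mgfZ : forall u,
   (\int[P]_w (expR (u * Z w))%:E = (expR (u * m + 2^-1 * (u ^+ 2 * v)))%:E)%E.

Let mexp u : measurable_fun setT (fun w => expR (u * Z w)).
Proof. by apply: measurableT_comp => //; exact: measurable_funM. Qed.

Let iexp u : P.-integrable setT (fun w => (expR (u * Z w))%:E).
Proof.
apply/integrableP; split; first exact/measurable_EFinP.
under eq_integral do rewrite gee0_abs ?lee_fin ?expR_ge0//.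
by rewrite mgfZ ltry.
Qed.

Lemma integrable_expR_norm u : 0 <= u ->
  P.-integrable setT (fun w => (expR (u * `|Z w|))%:E).
Proof.
move=> u0; apply: (le_integrable measurableT _ _
  (integrableD measurableT (iexp u) (iexp (- u)))).
  apply/measurable_EFinP; apply: measurableT_comp => //.
  by apply: measurable_funM => //; exact: measurableT_comp.
move=> w _ /=; rewrite lee_fin ger0_norm ?expR_ge0//.
apply: (le_trans _ (ler_norm _)).
by rewrite mulNr (le_trans _ (expR_norm_le _))// normrM (ger0_norm u0).
Qed.

Lemma mgf_integrable : P.-integrable setT (EFin \o Z).
Proof.
apply: (le_integrable measurableT _ _ (integrable_expR_norm _ ler01)).
  exact/measurable_EFinP.
move=> w _ /=; rewrite lee_fin mul1r [leRHS]ger0_norm ?expR_ge0//.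
exact: norm_le_expR_norm.
Qed.

Lemma mgf_integrable_sqr : P.-integrable setT (fun w => (Z w ^+ 2)%:E).
Proof.
apply: (le_integrable measurableT _ _ (integrable_expR_norm _ (ler0n _ 2))).
  by apply/measurable_EFinP; exact: measurable_funX.
move=> w _ /=; rewrite lee_fin [leRHS]ger0_norm ?expR_ge0// normrX.
rewrite (_ : 2 * _ = `|Z w| + `|Z w|) ?expRD; last by lra.
by rewrite expr2 ler_pM// norm_le_expR_norm.
Qed.

Let iexpB u (c : R) : P.-integrable setT (fun w => (expR (u * Z w) - c)%:E).
Proof.
have := integrableB measurableT (iexp u) (finite_measure_integrable_cst P c measurableT).
exact.
Qed.

Let integral_expRB u (c t : R) : (\int[P]_w (t * (expR (u * Z w) - c))%:E =
  (t * (expR (u * m + 2^-1 * (u ^+ 2 * v)) - c))%:E)%E.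
Proof.
have hZ := integralZl measurableT (iexpB u c) t.
have hB := integralB measurableT (iexp u) (finite_measure_integrable_cst P c measurableT).
under eq_integral do rewrite EFinM.
rewrite [LHS]hZ EFinM; congr (_ * _)%E.
under eq_integral do rewrite EFinB.
by rewrite [LHS]hB mgfZ /= integral_cst_prob EFinB.
Qed.

Let fin_exp (a : R) (w : Omega) :
  setT w -> (expR (a * `|Z w|))%:E \is a fin_num.
Proof. by []. Qed.

Let harmonic0 : (n.+1%:R^-1 : R) @[n --> \oo] --> (0 : R).
Proof. exact: cvg_harmonic. Qed.

(** Differentiates the moment generating function at 0 along the quotients n (exp(Z / n) - 1), which
    are dominated by exp(2 |Z|). *)
Lemma mgf_mean : (\int[P]_w (Z w)%:E = m%:E)%E.
Proof.
pose f n w : R := n.+1%:R * (expR (n.+1%:R^-1 * Z w) - 1).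
have mf n : measurable_fun setT (EFin \o f n).
  apply/measurable_EFinP; apply: measurable_funM => //.
  by apply: measurable_funB => //; exact: mexp.
have cf (w : Omega) : setT w -> (EFin \o f n) w @[n --> \oo] --> (Z w)%:E.
  move=> _; apply: cvg_EFin; first exact: nearW.
  under eq_fun do rewrite /= /f [_^-1 * _]mulrC.
  exact: cvg_expR_quotient.
have dom n (w : Omega) : setT w -> (`|(EFin \o f n) w| <= (expR (2 * `|Z w|))%:E)%E.
  move=> _; rewrite /= lee_fin /f [n.+1%:R^-1 * _]mulrC; exact: expR_quotient_le.
have := dominated_cvg measurableT mf cf (fin_exp 2)
  (integrable_expR_norm _ (ler0n _ 2)) dom.
have -> : (fun n => \int[P]_w (EFin \o f n) w)%E = (fun n =>
    (n.+1%:R * (expR ((m + 2^-1 * (n.+1%:R^-1 * v)) / n.+1%:R) - 1))%:E).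
  apply/funext => n; rewrite /f /= integral_expRB; congr (_ * (expR _ - _))%:E.
  by ring.
move=> c1; apply: (cvg_unique (@ereal_hausdorff R) c1).
apply: cvg_EFin; first exact: nearW.
apply: cvg_expR_quotient_seq => //.
rewrite -[X in _ --> X]addr0; apply: cvgD; first exact: cvg_cst.
rewrite -(mulr0 2^-1); apply: cvgM; first exact: cvg_cst.
by rewrite -(mul0r v); apply: cvgM => //; exact: cvg_cst.
Qed.

(* The square of (exp(Z/n) - 1) n expands into exponentials of Z. *)
Lemma mgf_second_moment : m = 0 -> (\int[P]_w (Z w ^+ 2)%:E = v%:E)%E.
Proof.
move=> m0.
pose f n w : R := (n.+1%:R * (expR (n.+1%:R^-1 * Z w) - 1)) ^+ 2.
have mf n : measurable_fun setT (EFin \o f n).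
  apply/measurable_EFinP; apply: measurable_funX; apply: measurable_funM => //.
  by apply: measurable_funB => //; exact: mexp.
have cf (w : Omega) : setT w -> (EFin \o f n) w @[n --> \oo] --> (Z w ^+ 2)%:E.
  move=> _; apply: cvg_EFin; first exact: nearW.
  have h : n.+1%:R * (expR (n.+1%:R^-1 * Z w) - 1) @[n --> \oo] --> Z w.
    under eq_fun do rewrite [_^-1 * _]mulrC.
    exact: cvg_expR_quotient.
  by rewrite expr2; under eq_fun do rewrite /f/= expr2; exact: cvgM.
have dom n (w : Omega) : setT w -> (`|(EFin \o f n) w| <= (expR (4 * `|Z w|))%:E)%E.
  move=> _; rewrite /= lee_fin /f normrX [n.+1%:R^-1 * _]mulrC.
  rewrite (_ : 4 * _ = 2 * `|Z w| + 2 * `|Z w|) ?expRD; last by lra.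
  by rewrite expr2 ler_pM//; exact: expR_quotient_le.
have := dominated_cvg measurableT mf cf (fin_exp 4)
  (integrable_expR_norm _ (ler0n _ 4)) dom.
have -> : (fun n => \int[P]_w (EFin \o f n) w)%E = (fun n =>
    (n.+1%:R ^+ 2 * (expR ((2 * v) / n.+1%:R ^+ 2) - 1) -
     2 * (n.+1%:R ^+ 2 * (expR ((2^-1 * v) / n.+1%:R ^+ 2) - 1)))%:E).
  apply/funext => n; rewrite /f /=.
  have e w : (n.+1%:R * (expR (n.+1%:R^-1 * Z w) - 1)) ^+ 2 =
      n.+1%:R ^+ 2 * (expR (2 * n.+1%:R^-1 * Z w) - 1) -
      2 * n.+1%:R ^+ 2 * (expR (n.+1%:R^-1 * Z w) - 1).
    by rewrite (_ : 2 * _ * Z w = n.+1%:R^-1 * Z w + n.+1%:R^-1 * Z w) ?expRD; [ring|ring].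
  under eq_integral do rewrite e EFinB.
  have i1 := integrableZl measurableT (n.+1%:R ^+ 2) (iexpB (2 * n.+1%:R^-1) 1).
  have i2 := integrableZl measurableT (2 * n.+1%:R ^+ 2) (iexpB (n.+1%:R^-1) 1).
  have hB := integralB measurableT i1 i2.
  under eq_integral do rewrite 2!EFinM.
  rewrite [LHS]hB.
  under [X in (X - _)%E]eq_integral do rewrite -EFinM.
  under [X in (_ - X)%E]eq_integral do rewrite -EFinM.
  rewrite !integral_expRB m0 -EFinB; congr (EFin (_ * (expR _ - 1) - _)).
    by rewrite mulr0 add0r; field; rewrite nat1r pnatr_eq0.
  rewrite mulrA; congr (_ * (expR _ - 1)).
  by rewrite mulr0 add0r; field; rewrite nat1r pnatr_eq0.
move=> c1; apply: (cvg_unique (@ereal_hausdorff R) c1).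
apply: cvg_EFin; first exact: nearW.
have sq0 : ((n.+1%:R ^+ 2)^-1 : R) @[n --> \oo] --> (0 : R).
  have -> : (fun n : nat => (n.+1%:R ^+ 2)^-1 : R) = (fun n => n.+1%:R^-1 * n.+1%:R^-1).
    by apply/funext => n; rewrite -exprVn expr2.
  by rewrite -[X in _ --> X](mulr0 (0 : R)); exact: (cvgM harmonic0 harmonic0).
have lim (x : R) : n.+1%:R ^+ 2 * (expR (x / n.+1%:R ^+ 2) - 1) @[n --> \oo] --> x.
  have t0 (n : nat) : 0 < n.+1%:R ^+ 2 :> R by rewrite exprn_gt0.
  exact: (cvg_expR_quotient_seq _ (fun=> x) x t0 sq0 (cvg_cst _)).
rewrite [X in _ --> X](_ : v = 2 * v - 2 * (2^-1 * v)); last by lra.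
apply: cvgB => //; apply: cvgM => //; exact: cvg_cst.
Qed.

End gaussian_rv_moments.

Section gaussian_process_mgf.
Context {R : realType} {d : measure_display} {Omega : measurableType d}.
Context (P : probability Omega R) (X : R -> {RV P >-> R}).
Hypothesis Xgauss : gaussian_process X.
Hypothesis Xcentered : centered_process X.

Definition nneg_times : set R := [set t | 0 <= t].

Let k := cov_fun X.

Let L s (w : Omega) : R := lin s (fun t => X t w).

Lemma measurable_lin_process s : measurable_fun setT (L s).
Proof.
apply: measurable_sum => p; apply: measurable_funM => //.
Qed.

Lemma gaussian_lin_process s : supported nneg_times s -> gaussian_rv P (L s).
Proof.
move=> sD; have := Xgauss (size s) (fun i => (nth (0, 0) s i).2)
  (fun i => (nth (0, 0) s i).1).
have h i : (i < size s)%N -> 0 <= (nth (0, 0) s i).2.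
  by move=> si; apply: sD; exact: mem_nth.
move=> /(_ (fun i => h i (ltn_ord i))); congr (gaussian_rv P _).
by apply/funext => w; rewrite /L /lin (big_nth (0, 0)) big_mkord.
Qed.

Lemma integrable_lin_process s : supported nneg_times s ->
  P.-integrable setT (fun w => (L s w)%:E) /\
  P.-integrable setT (fun w => (L s w ^+ 2)%:E).
Proof.
move=> sD; have mL := measurable_lin_process s.
have [m [v [v0 mgfL]]] := gaussian_rv_mgf P _ mL (gaussian_lin_process s sD).
by split; [exact: mgf_integrable mL mgfL|exact: mgf_integrable_sqr mL mgfL].
Qed.

Lemma integrable_mul_of_sqr (Y Z : Omega -> R) :
  measurable_fun setT Y -> measurable_fun setT Z ->
  P.-integrable setT (fun w => (Y w ^+ 2)%:E) ->
  P.-integrable setT (fun w => (Z w ^+ 2)%:E) ->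
  P.-integrable setT (fun w => (Y w * Z w)%:E).
Proof.
move=> mY mZ iY iZ.
apply: (le_integrable measurableT _ _ (integrableD measurableT iY iZ)).
  by apply/measurable_EFinP; exact: measurable_funM.
move=> w _ /=; rewrite lee_fin (le_trans _ (ler_norm _))// ler_norml.
by apply/andP; split; nra.
Qed.

Lemma integral_lin_mul s (Y : Omega -> R) :
  (forall t, 0 <= t -> P.-integrable setT (fun w => (X t w * Y w)%:E)) ->
  supported nneg_times s ->
  P.-integrable setT (fun w => (L s w * Y w)%:E) /\
  (\int[P]_w (L s w * Y w)%:E =
   (lin s (fun t => fine (\int[P]_w (X t w * Y w)%:E)))%:E)%E.
Proof.
move=> iXY; elim: s => [_|p s ih /supported_cons[p0 sD]].
  have e w : L [::] w * Y w = 0 by rewrite /L lin_nil mul0r.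
  split; first by under eq_fun do rewrite e; exact: integrable0.
  under eq_integral do rewrite e.
  by rewrite integral0 lin_nil.
have [iL eL] := ih sD.
have iZ := integrableZl measurableT p.1 (iXY _ p0).
have iD := integrableD measurableT iZ iL.
have e w : (L (p :: s) w * Y w)%:E = (p.1%:E * (X p.2 w * Y w)%:E + (L s w * Y w)%:E)%E.
  by rewrite -EFinM -EFinD; congr EFin; rewrite /L lin_cons; ring.
split; first by under eq_fun do rewrite e.
under eq_integral do rewrite e.
have hD := integralD measurableT iZ iL.
have hZ := integralZl measurableT (iXY _ p0) p.1.
rewrite [LHS]hD hZ eL lin_cons EFinD EFinM fineK//.
by apply: integrable_fin_num => //; exact: iXY.
Qed.

Lemma lin_process1 t w : L [:: (1, t)] w = X t w.
Proof. by rewrite /L lin_cons lin_nil mul1r addr0. Qed.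

Lemma process_mean t : 0 <= t -> (\int[P]_w (X t w)%:E = 0)%E.
Proof. by move=> t0; have := Xcentered t t0; rewrite expectation.unlock. Qed.

Lemma cov_funE t u : 0 <= t -> 0 <= u ->
  k t u = fine (\int[P]_w (X t w * X u w)%:E).
Proof.
move=> t0 u0; rewrite /k /cov_fun covariance.unlock !Xcentered//= expectation.unlock.
congr fine; apply: eq_integral => w _.
by rewrite -[in RHS](subr0 (X t w)) -[in RHS](subr0 (X u w)).
Qed.

Lemma lin_process_mean s : supported nneg_times s -> (\int[P]_w (L s w)%:E = 0)%E.
Proof.
move=> sD; have [|iL] := integral_lin_mul s (fun=> 1) _ sD.
  move=> t t0; have [+ _] := integrable_lin_process [:: (1, t)] (supported1 _ _ _ t0).
  by under eq_fun do rewrite lin_process1; under [in X in _ -> X]eq_fun do rewrite mulr1.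
under eq_integral do rewrite mulr1; move=> ->; congr EFin.
rewrite (eq_lin nneg_times _ _ (fun=> 0 * 1))//.
  by rewrite linZr /lin big1 ?mul0r// => p _; rewrite mulr0.
move=> t t0; under eq_integral do rewrite mulr1.
by rewrite process_mean// mul0r.
Qed.

Lemma lin_process_covariance s s' : supported nneg_times s ->
  supported nneg_times s' ->
  (\int[P]_w (L s w * L s' w)%:E = (bil k s s')%:E)%E.
Proof.
move=> sD s'D.
have iX t s1 : 0 <= t -> supported nneg_times s1 ->
    P.-integrable setT (fun w => (X t w * L s1 w)%:E).
  move=> t0 s1D; under eq_fun do rewrite -(lin_process1 t).
  apply: integrable_mul_of_sqr; [exact: measurable_lin_process|
    exact: measurable_lin_process| |exact: (integrable_lin_process s1 s1D).2].
  exact: (integrable_lin_process _ (supported1 _ _ _ t0)).2.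
have [|_ ->] := integral_lin_mul s (L s') _ sD.
  by move=> t t0; exact: iX.
congr EFin; rewrite /bil; apply: (eq_lin nneg_times) => // t t0.
have [|_] := integral_lin_mul s' (X t) _ s'D.
  move=> u u0; have := iX u [:: (1, t)] u0 (supported1 _ _ _ t0).
  by under eq_fun do rewrite lin_process1.
move=> h; rewrite (_ : (\int[P]_w (X t w * L s' w)%:E)%E = (lin s' (k t))%:E)//.
under eq_integral do rewrite mulrC.
rewrite h; congr EFin; apply: (eq_lin nneg_times) => // u u0.
rewrite cov_funE//; congr fine; apply: eq_integral => w _.
by rewrite mulrC.
Qed.

(** A Gaussian law is only known to have some parameters; the first two moments identify them as 0
    and the quadratic form of the covariance. *)
Lemma lin_process_mgf s : supported nneg_times s ->
  (\int[P]_w (expR (lin s (fun t => X t w)))%:E = (expR (2^-1 * bil k s s))%:E)%E.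
Proof.
move=> sD; have mL := measurable_lin_process s.
have [m [v [v0 mgfL]]] := gaussian_rv_mgf P _ mL (gaussian_lin_process s sD).
have := mgf_mean P _ _ _ mL mgfL; rewrite lin_process_mean// => -[m0].
have := mgf_second_moment P _ _ _ mL mgfL (esym m0).
under eq_integral do rewrite expr2.
rewrite lin_process_covariance// => -[->].
have := mgfL 1; rewrite -m0 mulr0 add0r expr1n mul1r => <-.
by apply: eq_integral => w _; rewrite mul1r.
Qed.

Lemma cov_fun_psd s : supported nneg_times s -> 0 <= bil k s s.
Proof.
move=> sD; rewrite -lee_fin -lin_process_covariance//.
by apply: integral_ge0 => w _; rewrite lee_fin -expr2 sqr_ge0.
Qed.

Lemma cov_fun_sym t u : k t u = k u t.
Proof. by rewrite /k /cov_fun covarianceC. Qed.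

Lemma covariance_increments t0 t u : 0 <= t0 -> 0 <= t -> 0 <= u ->
  covariance P (X t \- X t0) (X u \- X t0) =
  (k t u - k t t0 - k t0 u + k t0 t0)%:E.
Proof.
move=> t00 tp up.
pose inc v := [:: (1, v); (-1, t0)] : seq (R * R).
have incE v w : L (inc v) w = X v w - X t0 w.
  by rewrite /L /inc !lin_cons lin_nil /= mul1r mulN1r addr0.
have sinc v : 0 <= v -> supported nneg_times (inc v).
  by move=> v0 p; rewrite !inE => /orP[] /eqP ->.
have m0 v : 0 <= v -> ('E_P[X v \- X t0] = 0)%E.
  move=> v0; rewrite expectation.unlock.
  have := lin_process_mean _ (sinc v v0).
  by under eq_integral do rewrite incE.
rewrite covariance.unlock !m0//= expectation.unlock.
have := lin_process_covariance _ _ (sinc t tp) (sinc u up).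
under eq_integral do rewrite !incE.
have -> : (\int[P]_w ((((X t \- X t0) \- cst 0) * ((X u \- X t0) \- cst 0)) w)%:E =
    \int[P]_w ((X t w - X t0 w) * (X u w - X t0 w))%:E)%E.
  apply: eq_integral => w _.
  by rewrite -[in RHS](subr0 (X t w - _)) -[in RHS](subr0 (X u w - _)).
move=> ->; congr EFin; rewrite /bil /inc !lin_cons !lin_nil /=; ring.
Qed.

End gaussian_process_mgf.

(** * Scores and potentials *)

Section kernels.
Context {R : realType}.
Implicit Types (q : R -> R -> R) (g : R -> R) (s c : seq (R * R)) (G : set R).

Definition unit01 : set R := [set t | 0 <= t <= 1].

(** Functions are defined on all of R while only their restriction to the unit interval is
    constrained, which keeps the subtype out of the computations. *)
Definition unif_cont1 g := forall e, 0 < e -> exists2 h : R, 0 < h &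
  forall t u, unit01 t -> unit01 u -> `|t - u| <= h -> `|g t - g u| <= e.

Definition unif_cont2 q := forall e, 0 < e -> exists2 h : R, 0 < h &
  forall t t' u u', unit01 t -> unit01 t' -> unit01 u -> unit01 u' ->
    `|t - t'| <= h -> `|u - u'| <= h -> `|q t u - q t' u'| <= e.

Record cov_kernel q : Prop := CovKernel {
  kernel_sym : forall t u, unit01 t -> unit01 u -> q t u = q u t;
  kernel_psd : forall s, supported unit01 s -> 0 <= bil q s s;
  kernel_cont : unif_cont2 q }.

(* The supremum of the scores of a path is half its squared norm. *)
Definition score q g s : R := lin s g - 2^-1 * bil q s s.

Definition rate_le q (b : R) g := forall s, supported unit01 s -> score q g s <= b.

Definition potential q c (t : R) : R := lin c (q t).

Lemma unit01_0 : unit01 0. Proof. by rewrite /unit01/= lexx ler01. Qed.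

Lemma unit01_1 : unit01 1. Proof. by rewrite /unit01/= lexx ler01. Qed.

Lemma supported_sub G (G' : set R) s : G `<=` G' -> supported G s -> supported G' s.
Proof. by move=> GG' h p /h /GG'. Qed.

(** Walks from t to 0 by steps of length at most h, each of which moves [g] by at most 1. *)
Lemma chain_bound g h : 0 < h ->
  (forall t u, unit01 t -> unit01 u -> `|t - u| <= h -> `|g t - g u| <= 1) ->
  forall t, unit01 t -> `|g t - g 0| <= (Num.Def.truncn h^-1).+1%:R.
Proof.
move=> h0 hg; set N := (Num.Def.truncn h^-1).+1.
have N0 : 0 < N%:R :> R by rewrite ltr0n.
have hN : N%:R^-1 <= h.
  by rewrite -[leRHS]invrK lef_pV2 ?posrE ?invr_gt0// ltW// truncnS_gt.
have key (n : nat) (t : R) : unit01 t -> t <= n%:R / N%:R -> `|g t - g 0| <= n%:R.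
  elim: n t => [|n ih] t tD tn.
    have -> : t = 0 by apply/eqP; rewrite eq_le; move: tD tn; rewrite mul0r => /andP[-> _] ->.
    by rewrite subrr normr0.
  have /andP[t0 t1] := tD; have [tle|tgt] := leP t N%:R^-1.
    have : `|g t - g 0| <= 1.
      by apply: hg => //; [exact: unit01_0|rewrite subr0 ger0_norm// (le_trans tle)].
    by move=> /le_trans; apply; rewrite ler1n.
  have uD : unit01 (t - N%:R^-1).
    by apply/andP; split; [rewrite subr_ge0 ltW|rewrite lerBlDr (le_trans t1)// lerDl invr_ge0 ltW].
  have h1 : `|g t - g (t - N%:R^-1)| <= 1.
    by apply: hg => //; rewrite opprB addrC subrK ger0_norm// invr_ge0 ltW.
  have h2 : `|g (t - N%:R^-1) - g 0| <= n%:R.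
    by apply: ih => //; rewrite lerBlDr (le_trans tn)// -natr1 mulrDl mul1r.
  by have := ler_distD (g (t - N%:R^-1)) (g t) (g 0); rewrite -natr1; lra.
move=> t tD; apply: key => //; rewrite divff ?gt_eqF//; exact: (proj2 (andP tD)).
Qed.

Lemma unif_cont1_bounded g : unif_cont1 g ->
  exists2 M : R, 0 < M & forall t, unit01 t -> `|g t| <= M.
Proof.
move=> cg; have [h h0 hg] := cg 1 ltr01.
exists (`|g 0| + (Num.Def.truncn h^-1).+1%:R); first by rewrite ltr_wpDl.
move=> t tD; have := chain_bound _ _ h0 hg t tD.
have := ler_normD (g t - g 0) (g 0); rewrite subrK; lra.
Qed.

Lemma unif_cont2_section q t : unif_cont2 q -> unit01 t -> unif_cont1 (q t).
Proof.
move=> cq tD e e0; have [h h0 hq] := cq e e0; exists h => // u v uD vD uv.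
by apply: hq => //; rewrite subrr normr0 ltW.
Qed.

Lemma unif_cont2_bounded q : unif_cont2 q ->
  exists2 M : R, 0 < M & forall t u, unit01 t -> unit01 u -> `|q t u| <= M.
Proof.
move=> cq; have [h h0 hq] := cq 1 ltr01.
have cd : unif_cont1 (fun t => q t 0).
  move=> e e0; have [h' h'0 hq'] := cq e e0; exists h' => // u v uD vD uv.
  by apply: hq' => //; [exact: unit01_0|exact: unit01_0|rewrite subrr normr0 ltW].
have [M1 M10 hM1] := unif_cont1_bounded _ cd.
exists (M1 + (Num.Def.truncn h^-1).+1%:R); first by rewrite addr_gt0.
move=> t u tD uD; have hqt v v' : unit01 v -> unit01 v' -> `|v - v'| <= h ->
    `|q t v - q t v'| <= 1.
  by move=> vD vD' vv; apply: hq => //; rewrite subrr normr0 ltW.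
have := chain_bound _ _ h0 hqt u uD; have := hM1 t tD.
have := ler_normD (q t u - q t 0) (q t 0); rewrite subrK; lra.
Qed.

Variables (q : R -> R -> R) (qK : cov_kernel q).

Let qC := kernel_sym q qK.

Lemma score_nil g : score q g [::] = 0.
Proof. by rewrite /score lin_nil /bil lin_nil mulr0 subr0. Qed.

Lemma score_add_scale g c s a : supported unit01 c -> supported unit01 s ->
  score q g (c ++ scale_list a s) =
  score q g c + a * (lin s g - bil q c s) - 2^-1 * a ^+ 2 * bil q s s.
Proof.
move=> cD sD; rewrite /score (bil_add_scale unit01)// lin_cat lin_scale.
by field.
Qed.

(** The supremum of the scores need not be attained by a finitely supported measure, so the
    variational argument is run with an error [e]. *)
Definition near_maximizer G g e c := supported G c /\
  forall s, supported G s -> score q g s <= score q g c + e.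

Lemma near_maximizerP G g e c s (a : R) : G `<=` unit01 ->
  near_maximizer G g e c -> supported G s ->
  a * (lin s g - bil q c s) - 2^-1 * a ^+ 2 * bil q s s <= e.
Proof.
move=> GD [cG cmax] sG.
have := cmax _ (supported_cat _ _ _ cG (supported_scale _ a _ sG)).
rewrite score_add_scale; [lra|exact: supported_sub GD cG|exact: supported_sub GD sG].
Qed.

(** Approximate first-order condition: moving [c] by a s or by - a s gains at most [e], which bounds
    the derivative of the score in the direction [s] on both sides. *)
Lemma near_maximizer_close G g e c s (a : R) : G `<=` unit01 -> 0 < a ->
  near_maximizer G g e c -> supported G s ->
  `|lin s g - bil q c s| <= e / a + 2^-1 * a * bil q s s.
Proof.
move=> GD a0 cM sG; rewrite ler_norml.
have h1 := near_maximizerP _ _ _ _ s a GD cM sG.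
have h2 := near_maximizerP _ _ _ _ s (- a) GD cM sG.
set x := lin s g - _ in h1 h2 *; set Q := bil q s s in h1 h2 *.
have e1 : a * (e / a + 2^-1 * a * Q) = e + 2^-1 * a ^+ 2 * Q.
  by field; rewrite gt_eqF.
apply/andP; split.
  rewrite -(ler_pM2l a0) mulrN e1; rewrite sqrrN in h2; lra.
by rewrite -(ler_pM2l a0) e1; lra.
Qed.

Lemma near_maximizer_exists G g b e : G `<=` unit01 -> 0 < e ->
  (forall s, supported G s -> score q g s <= b) ->
  exists c, near_maximizer G g e c.
Proof.
move=> GD e0 hb.
pose S := [set score q g s | s in supported G].
have supS : has_sup S.
  split; first by exists (score q g [::]), [::] => //; exact: supported_nil.
  by exists b => _ [s sG <-]; exact: hb.
have [_ [c cG <-] hc] := sup_adherent e0 supS.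
exists c; split=> // s sG.
have : score q g s <= sup S by apply: ub_le_sup => //; [exact: supS.2|exists s].
lra.
Qed.

(* The path is the potential of a near maximizer of the score. *)
Lemma rate_le_interpolation G g b eta delta : G `<=` unit01 -> 0 < eta ->
  0 < delta -> (forall s, supported G s -> score q g s <= b - eta) ->
  exists c, [/\ supported G c, 2^-1 * bil q c c <= b &
    forall t, G t -> `|g t - potential q c t| <= delta].
Proof.
move=> GD eta0 delta0 hb.
have b0 : 0 < b.
  have := hb [::] (supported_nil _); rewrite score_nil; lra.
have [M M0 hM] := unif_cont2_bounded q (kernel_cont q qK).
(* [a1] is the length of a perturbation along [c] itself, for the energy bound, and [a2] that of a
   perturbation by a Dirac mass, for the distance of the paths. The error [e] is small against
   both. *)
pose a1 := Num.min 2^-1 (eta / (2 * b)); pose a2 := delta / M.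
have a10 : 0 < a1 by rewrite lt_min invr_gt0 ltr0n divr_gt0// mulr_gt0.
have a20 : 0 < a2 by rewrite divr_gt0.
pose e := Num.min (a1 * (eta / 2)) (a2 * (delta / 2)).
have eta20 : 0 < eta / 2 by rewrite divr_gt0.
have delta20 : 0 < delta / 2 by rewrite divr_gt0.
have e0 : 0 < e by rewrite lt_min (mulr_gt0 a10 eta20) (mulr_gt0 a20 delta20).
have e1 : e <= a1 * (eta / 2) by rewrite ge_min lexx.
have e2 : e <= a2 * (delta / 2) by rewrite ge_min lexx orbT.
have [c cM] := near_maximizer_exists G g (b - eta) e GD e0 hb.
have cG := cM.1; exists c; split=> //.
  have a11 : a1 <= 2^-1 by rewrite ge_min lexx.
  have a1b : a1 * (2 * b) <= eta.
    have : a1 <= eta / (2 * b) by rewrite ge_min lexx orbT.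
    by rewrite ler_pdivlMr// mulr_gt0.
  (* Shrinking [c] by the factor 1 - a1 gains at most [e], so q(c, c) exceeds c(g) by little;
     together with the bound on the score this bounds the energy. *)
  have h1 := near_maximizerP _ _ _ _ c (- a1) GD cM cG.
  have h2 := hb c cG; rewrite /score in h2.
  have Q0 := kernel_psd q qK c (supported_sub _ _ _ GD cG).
  set Q := bil q c c in h1 h2 Q0 *; rewrite sqrrN in h1.
  have h3 : a1 * (Q - lin c g) <= 2^-1 * a1 ^+ 2 * Q + a1 * (eta / 2) by lra.
  have h4 : Q - lin c g <= 2^-1 * a1 * Q + eta / 2.
    by rewrite -(ler_pM2l a10); lra.
  have h5 : 2^-1 * Q * (1 - a1) <= b - eta / 2 by lra.
  have h6 : b - eta / 2 <= b * (1 - a1) by lra.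
  have a1p : 0 < 1 - a1 by lra.
  by rewrite -(ler_pM2r a1p); exact: le_trans h6.
move=> t Gt; have tD := GD _ Gt.
have := near_maximizer_close _ _ _ _ [:: (1, t)] a2 GD a20 cM (supported1 _ _ _ Gt).
have -> : lin [:: (1, t)] g = g t by rewrite lin_cons lin_nil mul1r addr0.
have cD := supported_sub _ _ _ GD cG.
have -> : bil q c [:: (1, t)] = potential q c t.
  rewrite (bil_sym unit01)//; last exact: supported1.
  by rewrite /bil lin_cons lin_nil mul1r addr0.
have -> : bil q [:: (1, t)] [:: (1, t)] = q t t.
  by rewrite /bil !lin_cons !lin_nil !mul1r !addr0.
move=> /le_trans; apply.
have h1 : e / a2 <= delta / 2 by rewrite ler_pdivrMr// mulrC.
have h2 : a2 * q t t <= delta.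
  have := hM t t tD tD; rewrite ler_norml => /andP[_ h].
  by rewrite /a2 mulrAC ler_pdivrMr// ler_pM2l.
lra.
Qed.

Lemma rate_le_increment b g t u : rate_le q b g -> unit01 t -> unit01 u ->
  forall a, 0 < a -> `|g t - g u| <= b / a + 2^-1 * a * (q t t - q t u - q u t + q u u).
Proof.
move=> gb tD uD a a0.
have sD (x : R) : supported unit01 [:: (x, t); (- x, u)].
  by move=> p; rewrite !inE => /orP[] /eqP ->.
have e (x : R) : score q g [:: (x, t); (- x, u)] =
    x * (g t - g u) - 2^-1 * x ^+ 2 * (q t t - q t u - q u t + q u u).
  by rewrite /score /bil !lin_cons !lin_nil /=; ring.
have h1 := gb _ (sD a); have h2 := gb _ (sD (- a)); rewrite !e in h1 h2.
set Q := _ + q u u in h1 h2 *.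
have e1 : a * (b / a + 2^-1 * a * Q) = b + 2^-1 * a ^+ 2 * Q.
  by field; rewrite gt_eqF.
rewrite sqrrN in h2; rewrite ler_norml; apply/andP; split.
  by rewrite -(ler_pM2l a0) mulrN e1; lra.
by rewrite -(ler_pM2l a0) e1; lra.
Qed.

Lemma rate_le_equicontinuous b e : 0 < e -> exists2 h : R, 0 < h &
  forall g, rate_le q b g ->
  forall t u, unit01 t -> unit01 u -> `|t - u| <= h -> `|g t - g u| <= e.
Proof.
(* This choice makes b / a at most e / 2; the modulus of the kernel at e / (2 a) takes care of the
   quadratic term. *)
move=> e0; pose a := 2 * (`|b| + 1) / e.
have a0 : 0 < a by rewrite divr_gt0// mulr_gt0// ltr_wpDl.
have ea0 : 0 < e / (2 * a) by rewrite divr_gt0// mulr_gt0.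
have [h h0 hq] := kernel_cont q qK _ ea0; exists h => // g gb t u tD uD tu.
have := rate_le_increment _ _ _ _ gb tD uD a a0; move=> /le_trans; apply.
have ut : `|u - t| <= h by rewrite distrC.
have h00 : 0 <= h by exact: ltW.
have h1 : `|q t t - q t u| <= e / (2 * a) by apply: hq; rewrite // subrr normr0.
have h2 : `|q u u - q u t| <= e / (2 * a) by apply: hq; rewrite // subrr normr0.
have h3 : q t t - q t u - q u t + q u u <= e / a.
  have -> : e / a = e / (2 * a) + e / (2 * a) by field; rewrite gt_eqF.
  have := ler_norm (q t t - q t u); have := ler_norm (q u u - q u t); lra.
have h4 : a * (q t t - q t u - q u t + q u u) <= e.
  by rewrite mulrC -ler_pdivlMr.
have h5 : b / a <= e / 2.
  rewrite ler_pdivrMr// /a mulrA.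
  have -> : e / 2 * (2 * (`|b| + 1)) / e = `|b| + 1 by field; rewrite gt_eqF.
  by rewrite (le_trans (ler_norm _))// lerDl.
lra.
Qed.

Lemma rate_le_bounded b : exists2 A : R, 0 < A &
  forall g, rate_le q b g -> forall t, unit01 t -> `|g t| <= A.
Proof.
have [M M0 hM] := unif_cont2_bounded q (kernel_cont q qK).
exists (`|b| + M + 1); first by rewrite ltr_wpDl// addr_ge0// ltW.
move=> g gb t tD.
have e (x : R) : score q g [:: (x, t)] = x * g t - 2^-1 * x ^+ 2 * q t t.
  by rewrite /score /bil !lin_cons !lin_nil /=; ring.
have h1 := gb _ (supported1 _ 1 _ tD); have h2 := gb _ (supported1 _ (-1) _ tD).
rewrite !e in h1 h2; have := hM t t tD tD; rewrite ler_norml => /andP[_ h3].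
have := ler_norm b; rewrite ler_norml => h4; apply/andP; split; lra.
Qed.

End kernels.

(** * Scores and the reproducing kernel Hilbert space *)

Section riemann_sums.
Context {R : realType}.
Local Notation mT := (measurableTypeR R).

Lemma unit01E : @unit01 R = [set` `[0, 1]].
Proof. by apply/seteqP; split => t; rewrite /unit01 /= in_itv. Qed.

Lemma measurable_unit01 : measurable (@unit01 R : set mT).
Proof. by rewrite unit01E; exact: measurable_itv. Qed.

Definition node (n i : nat) : R := i%:R / n.+1%:R.

Definition below (n i : nat) : set mT := [set t | unit01 t /\ t < node n i].

(** The cells are half-open, so that [0, 1] is covered by n + 2 of them: the last one, of index n +
    1, is reduced to the end point 1. *)
Definition cell (n i : nat) : set mT :=
  [set t | unit01 t /\ node n i <= t < node n i.+1].

Lemma node_lt n i : node n i < node n i.+1.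
Proof. by rewrite ltr_pM2r ?invr_gt0// ltr_nat. Qed.

Lemma nodeS n i : node n i.+1 = node n i + n.+1%:R^-1.
Proof. by rewrite /node -natr1 mulrDl mul1r. Qed.

Lemma node_unit01 n i : (i <= n.+1)%N -> unit01 (node n i).
Proof.
by move=> iN; apply/andP; rewrite divr_ge0//= ler_pdivrMr// mul1r ler_nat.
Qed.

Lemma measurable_below n i : measurable (below n i).
Proof.
have -> : below n i = @unit01 R `&` `]-oo, node n i[.
  by apply/seteqP; split => t; rewrite /below /= in_itv.
by apply: measurableI; [exact: measurable_unit01|exact: measurable_itv].
Qed.

Lemma measurable_cell n i : measurable (cell n i).
Proof.
have -> : cell n i = @unit01 R `&` `[node n i, node n i.+1[.
  by apply/seteqP; split => t; rewrite /cell /= in_itv.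
by apply: measurableI; [exact: measurable_unit01|exact: measurable_itv].
Qed.

Lemma belowS n i : below n i.+1 = below n i `|` cell n i.
Proof.
apply/seteqP; split => t /=; rewrite /below /cell/=.
  move=> [tD ti]; have [h|h] := ltP t (node n i); [by left|].
  by right; split => //; apply/andP.
case=> [[tD h]|[tD /andP[_ h]]]; split => //.
exact: lt_trans h (node_lt n i).
Qed.

Lemma below_cell_disjoint n i : [disjoint below n i & cell n i].
Proof.
apply/disj_setPLR => t [tD ti] [_ /andP[h _]].
by move: (le_lt_trans h ti); rewrite ltxx.
Qed.

Lemma below_full n : below n n.+2 = @unit01 R.
Proof.
apply/seteqP; split => t /=; rewrite /below/=; first by case.
move=> tD; split => //; have /andP[_ t1] := tD.
by rewrite (le_lt_trans t1)// ltr_pdivlMr// mul1r ltr_nat.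
Qed.

Lemma below0 n : below n 0 = set0.
Proof.
apply/seteqP; split => t //=; rewrite /below /node mul0r /= => -[/andP[t0 _]].
by rewrite ltNge t0.
Qed.

Lemma unif_cont1_measurable (f : R -> R) : unif_cont1 f ->
  measurable_fun (@unit01 R) (f : mT -> R).
Proof.
move=> cf; apply: subspace_continuous_measurable_fun; first exact: measurable_unit01.
apply/subspace_continuousP => t tD; apply/cvgrPdist_le => e e0.
have [h h0 hf] := cf e e0.
rewrite near_withinE; apply/nbhs_ballP; exists h => //= u.
by rewrite /ball/= => tu uD; apply: hf => //; exact: ltW.
Qed.

Section one_measure.
Variable mu : {finite_measure set mT -> \bar R}.

Lemma unif_cont1_integrable (f : R -> R) : unif_cont1 f ->
  mu.-integrable (@unit01 R) (EFin \o f).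
Proof.
move=> cf; apply: measurable_bounded_integrable.
- exact: measurable_unit01.
- by rewrite ltey_eq fin_num_measure//; exact: measurable_unit01.
- exact: unif_cont1_measurable.
- have [M M0 hM] := unif_cont1_bounded _ cf.
  exists M; split; first exact: num_real.
  by move=> x Mx t tD; exact: (le_trans (hM _ tD) (ltW Mx)).
Qed.

Definition meas (A : set mT) : R := fine (mu A).

Lemma measU (A B : set mT) : measurable A -> measurable B ->
  [disjoint A & B] -> meas (A `|` B) = meas A + meas B.
Proof.
move=> mA mB AB; rewrite /meas measureU//; last exact/disj_set2P.
by rewrite fineD// fin_num_measure.
Qed.

Lemma Rintegral_cell (f : R -> R) n i e : unif_cont1 f -> 0 <= e ->
  (forall t u, unit01 t -> unit01 u -> `|t - u| <= n.+1%:R^-1 -> `|f t - f u| <= e) ->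
  (i <= n.+1)%N ->
  `|\int[mu]_(t in cell n i) f t - f (node n i) * meas (cell n i)| <=
    e * meas (cell n i).
Proof.
move=> cf e0 hf iN.
have mc := measurable_cell n i.
have ic : mu.-integrable (cell n i) (EFin \o f).
  apply: integrableS (unif_cont1_integrable f cf) => //; first exact: measurable_unit01.
  by move=> t [].
have icst (a : R) : mu.-integrable (cell n i) (EFin \o cst a).
  exact: finite_measure_integrable_cst.
rewrite -(Rintegral_cst mu mc (f (node n i))) -RintegralB//; last exact: icst.
have iB : mu.-integrable (cell n i) (EFin \o (fun t => f t - f (node n i))).
  exact: (integrableB mc ic (icst _)).
apply: (le_trans (le_normr_Rintegral mc iB)).
rewrite -(Rintegral_cst mu mc e); apply: le_Rintegral => //.
- exact: (integrable_norm iB).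
- exact: icst.
move=> t [tD /andP[t1 t2]]; apply: hf => //; first exact: node_unit01.
by rewrite ger0_norm ?subr_ge0// lerBlDl -nodeS ltW.
Qed.

Lemma Rintegral_riemann (f : R -> R) n e : unif_cont1 f -> 0 <= e ->
  (forall t u, unit01 t -> unit01 u -> `|t - u| <= n.+1%:R^-1 -> `|f t - f u| <= e) ->
  `|\int[mu]_(t in [set` `[0, 1]]) f t -
    \sum_(0 <= i < n.+2) f (node n i) * meas (cell n i)| <= e * meas (@unit01 R).
Proof.
move=> cf e0 hf; rewrite -unit01E -(below_full n).
suff H i : (i <= n.+2)%N -> `|\int[mu]_(t in below n i) f t -
    \sum_(0 <= j < i) f (node n j) * meas (cell n j)| <= e * meas (below n i).
  exact: H.
elim: i => [_|i ih iN].
  by rewrite below0 Rintegral_set0 big_geq// subrr normr0 /meas measure0 mulr0.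
have mb := measurable_below n i; have mc := measurable_cell n i.
rewrite belowS measU//; last exact: below_cell_disjoint.
have ibc : mu.-integrable (below n i `|` cell n i) (EFin \o f).
  apply: (integrableS measurable_unit01 (measurableU _ _ mb mc) _
    (unif_cont1_integrable f cf)).
  by move=> t [[]|[]].
rewrite (Rintegral_setU mb mc ibc (below_cell_disjoint n i)).
rewrite big_nat_recr//= mulrDr opprD addrACA (le_trans (ler_normD _ _))// lerD//.
  by apply: ih; exact: ltnW.
exact: Rintegral_cell.
Qed.

End one_measure.

End riemann_sums.

Lemma norm_sub_le_add {R : realType} (x y u v e p n : R) :
  `|x - u| <= e * p -> `|y - v| <= e * n -> `|(x - y) - (u - v)| <= e * (p + n).
Proof.
rewrite !ler_norml => /andP[h1 h2] /andP[h3 h4].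
by apply/andP; split; lra.
Qed.

(** * Discretization of signed measures *)

Section discretized_charges.
Context {R : realType}.
Local Notation mT := (measurableTypeR R).
Local Notation signed_measure := ({charge set mT -> \bar R}).
Implicit Types (lam mu : signed_measure) (f g : R -> R).

Definition cint lam f : R := charge_integral lam [set` `[0, 1]] f.

(** The mass of each cell is moved to its left node. The masses are those of the charge and not of
    its Jordan parts, which makes the discretization additive in the charge. *)
Definition disc lam (n : nat) : seq (R * R) :=
  [seq (fine (lam (cell n i)), node n i) | i <- iota 0 n.+2].

Definition tv lam : R := meas (jordan_pos (hahn_PN lam)) (@unit01 R) +
                  meas (jordan_neg (hahn_PN lam)) (@unit01 R).

Lemma supported_disc lam n : supported unit01 (disc lam n).
Proof.
move=> p /mapP[i]; rewrite mem_iota add0n => /andP[_ iN] ->.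
exact: node_unit01.
Qed.

Lemma lin_disc lam n f : lin (disc lam n) f =
  \sum_(0 <= i < n.+2) fine (lam (cell n i)) * f (node n i).
Proof. by rewrite /lin big_map /index_iota subn0. Qed.

Lemma tv_ge0 lam : 0 <= tv lam.
Proof. by rewrite addr_ge0// fine_ge0. Qed.

Lemma charge_cell lam n i : fine (lam (cell n i)) =
  meas (jordan_pos (hahn_PN lam)) (cell n i) -
  meas (jordan_neg (hahn_PN lam)) (cell n i).
Proof.
have mc := @measurable_cell R n i.
rewrite (jordan_decomp (hahn_PN lam) mc) /cadd/= cscaleN1 fineB//.
- by rewrite fin_num_measure.
- by rewrite fin_num_measure.
Qed.

Lemma cint_disc lam f n (e : R) : unif_cont1 f -> 0 <= e ->
  (forall t u, unit01 t -> unit01 u -> `|t - u| <= n.+1%:R^-1 -> `|f t - f u| <= e) ->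
  `|cint lam f - lin (disc lam n) f| <= e * tv lam.
Proof.
move=> cf e0 hf; rewrite lin_disc.
under eq_bigr do rewrite charge_cell mulrC mulrBr.
rewrite sumrB.
have := Rintegral_riemann (jordan_pos (hahn_PN lam)) f n e cf e0 hf.
have := Rintegral_riemann (jordan_neg (hahn_PN lam)) f n e cf e0 hf.
by move=> hn hp; exact: norm_sub_le_add.
Qed.

Lemma harmonic_lt (h : R) : 0 < h -> exists N : nat, forall n, (N <= n)%N ->
  n.+1%:R^-1 <= h.
Proof.
move=> h0; exists (Num.Def.truncn h^-1) => n Nn.
rewrite -[leRHS]invrK lef_pV2 ?posrE ?invr_gt0//.
by rewrite ltW// (lt_le_trans (truncnS_gt _))// ler_nat ltnS.
Qed.

Lemma cvg_disc lam f : unif_cont1 f ->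
  lin (disc lam n) f @[n --> \oo] --> cint lam f.
Proof.
move=> cf; apply/cvgrPdist_le => e e0.
have tv1 : 0 < tv lam + 1 by rewrite ltr_wpDl// tv_ge0.
have e1 : 0 < e / (tv lam + 1) by rewrite divr_gt0.
have [h h0 hf] := cf _ e1; have [N hN] := harmonic_lt _ h0.
exists N => // n /= Nn; apply: (le_trans (cint_disc _ _ _ (e / (tv lam + 1)) cf _ _)).
- exact: ltW.
- by move=> t u tD uD tu; apply: hf => //; exact: le_trans tu (hN _ Nn).
- by rewrite mulrAC ler_pdivrMr// ler_pM2l// lerDl.
Qed.

Lemma mass_disc lam n : mass (disc lam n) <= tv lam.
Proof.
have key (nu : {finite_measure set mT -> \bar R}) :
    \sum_(0 <= i < n.+2) meas nu (cell n i) = meas nu (@unit01 R).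
  rewrite -(below_full n).
  suff H i : \sum_(0 <= j < i) meas nu (cell n j) = meas nu (below n i) by exact: H.
  elim: i => [|i ih]; first by rewrite big_geq// below0 /meas measure0.
  rewrite big_nat_recr//= ih belowS measU//.
  - exact: measurable_below.
  - exact: measurable_cell.
  - exact: below_cell_disjoint.
rewrite /mass big_map -[X in \sum_(_ <- X) _](_ : index_iota 0 n.+2 = _); last first.
  by rewrite /index_iota subn0.
rewrite /tv -!key -big_split/=; apply: ler_sum => i _; rewrite charge_cell.
by rewrite (le_trans (ler_normB _ _))// !ger0_norm ?fine_ge0.
Qed.

Lemma cint_le lam f g (e : R) : unif_cont1 f -> unif_cont1 g ->
  (forall t, unit01 t -> `|f t - g t| <= e) ->
  `|cint lam f - cint lam g| <= tv lam * e.
Proof.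
move=> cf cg fg; have e0 : 0 <= e by apply: (le_trans _ (fg 0 unit01_0)).
have c : `|lin (disc lam n) f - lin (disc lam n) g| @[n --> \oo] -->
    `|cint lam f - cint lam g|.
  by apply: cvg_norm; apply: cvgB; exact: cvg_disc.
rewrite -(cvg_lim (@Rhausdorff R) c); apply: limr_le.
  by apply/cvg_ex; eexists; exact: c.
apply: nearW => n; apply: (le_trans (lin_le _ _ _ _ _ (supported_disc lam n) fg)).
by rewrite ler_wpM2r// mass_disc.
Qed.

Lemma lin_disc_diff lam mu n f : lin (disc (charge_diff lam mu) n) f =
  lin (disc lam n) f - lin (disc mu n) f.
Proof.
rewrite !lin_disc -sumrB; apply: eq_bigr => i _; rewrite -mulrBl; congr (_ * _).
have mc := @measurable_cell R n i.
have fl : lam (cell n i) \is a fin_num by exact: fin_num_measure.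
have fm : mu (cell n i) \is a fin_num by exact: fin_num_measure.
have -> : charge_diff lam mu (cell n i) = (lam (cell n i) - mu (cell n i))%E.
  transitivity (lam (cell n i) + (-1)%:E * mu (cell n i))%E; first by [].
  by rewrite EFinN mulN1e.
exact: fineB.
Qed.

Section with_kernel.
Variable q : R -> R -> R.
Hypothesis qK : cov_kernel q.

Definition pair lam mu : R := cint lam (kernel_path q mu).

Lemma unif_cont1_section t : unit01 t -> unif_cont1 (q t).
Proof. exact: unif_cont2_section (kernel_cont q qK). Qed.

Lemma unif_cont1_kernel_path lam : unif_cont1 (kernel_path q lam).
Proof.
move=> e e0; have tv1 : 0 < tv lam + 1 by rewrite ltr_wpDl// tv_ge0.
have e1 : 0 < e / (tv lam + 1) by rewrite divr_gt0.
have [h h0 hq] := kernel_cont q qK _ e1; exists h => // t u tD uD tu.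
apply: (@le_trans _ _ (tv lam * (e / (tv lam + 1)))).
  apply: cint_le; [exact: unif_cont1_section|exact: unif_cont1_section|].
  by move=> v vD; apply: hq => //; rewrite subrr normr0 ltW.
by rewrite mulrCA ler_piMr ?ltW// ltr_pdivrMr// mul1r ltrDl.
Qed.

(** Through this limit the symmetry, positivity and bilinear expansion of [pair] follow from those
    of [bil] on lists; no Fubini theorem for signed measures is involved. *)
Lemma cvg_bil_disc lam mu :
  bil q (disc lam n) (disc mu n) @[n --> \oo] --> pair lam mu.
Proof.
have -> : (fun n => bil q (disc lam n) (disc mu n)) = (fun n =>
    lin (disc lam n) (kernel_path q mu) +
    (bil q (disc lam n) (disc mu n) - lin (disc lam n) (kernel_path q mu))).
  by apply/funext => n; rewrite addrC subrK.
rewrite -[X in _ --> X]addr0; apply: cvgD.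
  by apply: cvg_disc; exact: unif_cont1_kernel_path.
apply/cvgrPdist_le => e e0.
have tv1 : 0 < tv lam * tv mu + 1 by rewrite ltr_wpDl// mulr_ge0 ?tv_ge0.
have e1 : 0 < e / (tv lam * tv mu + 1) by rewrite divr_gt0.
have [h h0 hq] := kernel_cont q qK _ e1; have [N hN] := harmonic_lt _ h0.
exists N => // n /= Nn; rewrite sub0r normrN /bil.
apply: (@le_trans _ _ (mass (disc lam n) * (e / (tv lam * tv mu + 1) * tv mu))).
  apply: (lin_le unit01); first exact: supported_disc.
  move=> t tD; rewrite distrC; apply: cint_disc.
  - exact: unif_cont1_section.
  - exact: ltW.
  - move=> u v uD vD uv; apply: hq => //; first by rewrite subrr normr0 ltW.
    exact: le_trans uv (hN _ Nn).
apply: (@le_trans _ _ (tv lam * (e / (tv lam * tv mu + 1) * tv mu))).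
  by rewrite ler_wpM2r ?mass_disc// mulr_ge0 ?tv_ge0// ltW.
have -> : tv lam * (e / (tv lam * tv mu + 1) * tv mu) =
  e * (tv lam * tv mu) / (tv lam * tv mu + 1) by field; rewrite gt_eqF.
by rewrite ler_pdivrMr// ler_pM2l// lerDl.
Qed.

Lemma pair_sym lam mu : pair lam mu = pair mu lam.
Proof.
have c := cvg_bil_disc mu lam.
rewrite (_ : (fun n => bil q (disc mu n) (disc lam n)) =
  (fun n => bil q (disc lam n) (disc mu n))) in c.
  exact: (cvg_unique (@Rhausdorff R) (cvg_bil_disc lam mu) c).
apply/funext => n; apply: (bil_sym unit01); last 2 first.
- exact: supported_disc.
- exact: supported_disc.
- exact: kernel_sym.
Qed.

Lemma pair_quadratic_ge0 lam mu (a : R) :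
  0 <= pair lam lam + 2 * a * pair lam mu + a ^+ 2 * pair mu mu.
Proof.
have c : bil q (disc lam n) (disc lam n) + 2 * a * bil q (disc lam n) (disc mu n) +
    a ^+ 2 * bil q (disc mu n) (disc mu n) @[n --> \oo] -->
    pair lam lam + 2 * a * pair lam mu + a ^+ 2 * pair mu mu.
  apply: cvgD; first apply: cvgD; first exact: cvg_bil_disc.
    by apply: cvgM; [exact: cvg_cst|exact: cvg_bil_disc].
  by apply: cvgM; [exact: cvg_cst|exact: cvg_bil_disc].
rewrite -(cvg_lim (@Rhausdorff R) c); apply: limr_ge.
  by apply/cvg_ex; eexists; exact: c.
apply: nearW => n; rewrite -(bil_add_scale unit01).
- apply: (kernel_psd q qK); apply: supported_cat; first exact: supported_disc.
  by apply: supported_scale; exact: supported_disc.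
- exact: kernel_sym.
- exact: supported_disc.
- exact: supported_disc.
Qed.

Lemma kernel_sqnorm_diff lam mu : kernel_sqnorm q (charge_diff lam mu) =
  pair lam lam - 2 * pair lam mu + pair mu mu.
Proof.
have c1 := cvg_bil_disc (charge_diff lam mu) (charge_diff lam mu).
have c2 : bil q (disc lam n) (disc lam n) - 2 * bil q (disc lam n) (disc mu n) +
    bil q (disc mu n) (disc mu n) @[n --> \oo] -->
    pair lam lam - 2 * pair lam mu + pair mu mu.
  apply: cvgD; last exact: cvg_bil_disc.
  apply: cvgB; first exact: cvg_bil_disc.
  by apply: cvgM; [exact: cvg_cst|exact: cvg_bil_disc].
rewrite (_ : (fun n => bil q (disc (charge_diff lam mu) n) _) =
  (fun n => bil q (disc lam n) (disc lam n) - 2 * bil q (disc lam n) (disc mu n) +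
    bil q (disc mu n) (disc mu n))) in c1.
  exact: (cvg_unique (@Rhausdorff R) c1 c2).
apply/funext => n.
have r s : bil q s (disc (charge_diff lam mu) n) =
    bil q s (disc lam n) - bil q s (disc mu n).
  by rewrite /bil -linB; congr lin; apply/funext => t; rewrite lin_disc_diff.
rewrite r /bil !lin_disc_diff -/(bil q _ _) -/(bil q _ _) -/(bil q _ _) -/(bil q _ _).
rewrite (bil_sym unit01 _ (disc mu n) (disc lam n)); first by ring.
- exact: kernel_sym.
- exact: supported_disc.
- exact: supported_disc.
Qed.

End with_kernel.
End discretized_charges.

(** The near-covering form of compactness yields a single radius, each center using its own radius
    of continuity halved. *)
Lemma heine_cantor {R : realType} {T : pseudoMetricType R} (K : set T)
    (f : T -> R) (e : R) : compact K -> {within K, continuous f} -> 0 < e ->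
  exists2 h : R, 0 < h & forall x y, K x -> K y -> ball x h y -> `|f x - f y| <= e.
Proof.
move=> /compact_near_coveringP cK /subspace_continuousP cf e0.
pose Q (h : R) (x : T) := K x -> forall y, K y -> ball x h y -> `|f x - f y| <= e.
have [] := cK R 0^'+ Q.
- move=> x Kx; have e20 : 0 < e / 2 by rewrite divr_gt0.
  have /cvgrPdist_le /(_ _ e20) := cf x Kx.
  rewrite near_withinE => /nbhs_ballP[r /= r0 hr].
  have r20 : 0 < r / 2 by rewrite divr_gt0.
  exists (ball x (r / 2), [set h | 0 < h < r / 2]).
    split => /=; first exact: nbhsx_ballx.
    by near=> h; apply/andP; split; near: h; [exact: nbhs_right_gt|exact: nbhs_right_lt].
  move=> [x' h] /= [xx' /andP[h0 hr2]] Kx' y Ky x'y.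
  have h1 : `|f x - f x'| <= e / 2.
    by apply: hr => //; apply: le_ball xx'; lra.
  have h2 : `|f x - f y| <= e / 2.
    apply: hr => //; rewrite (splitr r); apply: (ball_triangle xx').
    exact: le_ball (ltW hr2) _ x'y.
  have := ler_distD (f x) (f x') (f y); rewrite (distrC (f x') (f x)); lra.
- move=> h /= h0 hK; exists (h / 2); first by rewrite divr_gt0.
  move=> x y Kx Ky xy; have h20 : 0 < h / 2 by rewrite divr_gt0.
  apply: (hK (h / 2)) => //=; rewrite sub0r normrN gtr0_norm//.
  by rewrite ltr_pdivrMr// ltr_pMr// ltr1n.
Unshelve. all: by end_near. Qed.

(** * Paths as functions on the real line *)

Section paths_on_unit_interval.
Context {R : realType}.
Implicit Types (f : unit_itv R -> R).

(** The nearest-point retraction onto the unit interval, used to extend paths from the subtype to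
    R. *)
Definition clamp01 (t : R) : R := Num.max 0 (Num.min 1 t).

Lemma clamp01_in t : clamp01 t \in [set` `[(0:R), 1]].
Proof.
rewrite inE /= in_itv /= /clamp01 le_max lexx/= ge_max ler01/=.
by rewrite ge_min lexx.
Qed.

Definition to_itv (t : R) : unit_itv R := exist _ (clamp01 t) (clamp01_in t).

Definition extend f (t : R) : R := f (to_itv t).

Lemma clamp01_id t : unit01 t -> clamp01 t = t.
Proof. by move=> /andP[t0 t1]; rewrite /clamp01 (min_r t1) (max_r t0). Qed.

Lemma val_unit01 (u : unit_itv R) : unit01 (val u).
Proof. by case: u => t /=; rewrite inE /= in_itv. Qed.

Lemma to_itvK (u : unit_itv R) : to_itv (val u) = u.
Proof. by apply: val_inj; rewrite /= clamp01_id//; exact: val_unit01. Qed.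

Lemma extend_val f u : extend f (val u) = f u.
Proof. by rewrite /extend to_itvK. Qed.

Lemma extend_id (g : R -> R) t : unit01 t -> extend (g \o val) t = g t.
Proof. by move=> tD; rewrite /extend /= clamp01_id. Qed.

Lemma clamp01_lipschitz t u : `|clamp01 t - clamp01 u| <= `|t - u|.
Proof.
have e v : clamp01 v = if v < 0 then 0 else if 1 < v then 1 else v.
  rewrite /clamp01; have [v0|v0] := ltP v 0.
    by rewrite min_r ?max_l ?ltW// (lt_trans v0).
  have [v1|v1] := ltP 1 v; first by rewrite max_r.
  by rewrite max_r.
wlog tu : t u / t <= u.
  by move=> H; have [/H//|/ltW/H] := leP t u; rewrite distrC (distrC u).
have -> : `|t - u| = u - t by rewrite ler0_norm ?subr_le0// opprB.
rewrite !e ler_norml; case: (ltP t 0) => ?; case: (ltP u 0) => ?;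
  case: (ltP 1 t) => ?; case: (ltP 1 u) => ?; apply/andP; split; lra.
Qed.

Lemma continuous_extend f : continuous f -> unif_cont1 (extend f).
Proof.
move=> cf e e0.
have ci : continuous to_itv.
  apply: continuous_comp_initial => t; apply/cvgrPdist_le => d d0.
  apply/nbhs_ballP; exists d => //= u; rewrite /ball/= => tu.
  by apply: (le_trans (clamp01_lipschitz t u)); exact: ltW.
have ce : {within [set` `[(0:R), 1]], continuous (extend f)}.
  by apply: continuous_subspaceT => t; apply: continuous_comp; [exact: ci|exact: cf].
have [h h0 hh] := heine_cantor _ _ e (@segment_compact R 0 1) ce e0.
exists (h / 2); first by rewrite divr_gt0.
move=> t u tD uD tu; apply: hh; rewrite /= ?in_itv//.
by rewrite /ball/= (le_lt_trans tu)// ltr_pdivrMr// ltr_pMr// ltr1n.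
Qed.

Lemma unif_cont1_continuous f : unif_cont1 (extend f) -> continuous f.
Proof.
move=> cf.
have ce : continuous (extend f).
  move=> t; apply/cvgrPdist_le => e e0; have [h h0 hh] := cf e e0.
  apply/nbhs_ballP; exists h => //= u; rewrite /ball/= => tu.
  have D v : unit01 (clamp01 v) by have := clamp01_in v; rewrite inE /= in_itv.
  have := hh (clamp01 t) (clamp01 u) (D t) (D u).
  rewrite /extend /to_itv.
  have e1 v : exist _ (clamp01 (clamp01 v)) (clamp01_in (clamp01 v)) = to_itv v.
    by apply: val_inj => /=; rewrite clamp01_id.
  rewrite !e1; apply; exact: (le_trans (clamp01_lipschitz t u) (ltW tu)).
have -> : f = extend f \o val by apply/funext => u /=; rewrite extend_val.
move=> u; apply: continuous_comp; last exact: ce.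
exact: initial_continuous.
Qed.

Lemma continuous_C01 (h : C01 R) : continuous (C01_fun h).
Proof. by move=> u; exact: (@cts_fun _ _ (h : continuousType (unit_itv R) R)). Qed.

End paths_on_unit_interval.

(** * Signed measures of finite support *)

Section charges_of_lists.
Context {R : realType}.
Local Notation mT := (measurableTypeR R).
Local Notation signed_measure := ({charge set mT -> \bar R}).

(** The Hahn decomposition chosen for the charge is not explicit, so the two integrals are compared
    through their common Riemann sums. *)
Lemma cint_finite_measure (nu : {finite_measure set mT -> \bar R}) (f : R -> R) :
  unif_cont1 f ->
  cint (charge_of_finite_measure nu) f = \int[nu]_(t in [set` `[0, 1]]) f t.
Proof.
move=> cf; apply: (cvg_unique (@Rhausdorff R) (cvg_disc _ _ cf)).
apply/cvgrPdist_le => e e0; pose M := meas nu (@unit01 R).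
have M0 : 0 <= M by rewrite /M fine_ge0.
have M1 : 0 < M + 1 by rewrite ltr_wpDl.
have e1 : 0 < e / (M + 1) by rewrite divr_gt0.
have [h h0 hf] := cf _ e1; have [N hN] := harmonic_lt _ h0.
exists N => // n /= Nn.
have := Rintegral_riemann nu f n (e / (M + 1)) cf (ltW e1)
  (fun t u tD uD tu => hf t u tD uD (le_trans tu (hN n Nn))).
have -> : lin (disc (charge_of_finite_measure nu) n) f =
   \sum_(0 <= i < n.+2) f (node n i) * meas nu (cell n i).
  by rewrite lin_disc; apply: eq_bigr => i _; rewrite mulrC.
by move=> /le_trans; apply; rewrite mulrAC ler_pdivrMr// ler_pM2l// lerDl.
Qed.

Definition dirac_charge (t : R) : signed_measure :=
  charge_of_finite_measure (dirac (t : mT)).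

Fixpoint list_charge (s : seq (R * R)) : signed_measure :=
  if s is p :: s' then cadd (cscale p.1 (dirac_charge p.2)) (list_charge s')
  else czero.

Lemma cint_list_charge s (f : R -> R) : supported unit01 s -> unif_cont1 f ->
  cint (list_charge s) f = lin s f.
Proof.
move=> sD cf; apply: (cvg_unique (@Rhausdorff R) (cvg_disc _ _ cf)).
elim: s sD => [_|p s ih /supported_cons[pD sD]].
  rewrite lin_nil (_ : (fun n => _) = (fun=> 0)); first exact: cvg_cst.
  by apply/funext => n; rewrite lin_disc big1// => i _; rewrite mul0r.
rewrite lin_cons.
have -> : (fun n => lin (disc (list_charge (p :: s)) n) f) = (fun n =>
    p.1 * lin (disc (dirac_charge p.2) n) f + lin (disc (list_charge s) n) f).
  apply/funext => n; rewrite !lin_disc mulr_sumr -big_split/=.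
  apply: eq_bigr => i _; rewrite mulrA -mulrDl; congr (_ * _).
  have mc := @measurable_cell R n i.
  have f1 : dirac_charge p.2 (cell n i) \is a fin_num by exact: fin_num_measure.
  have f2 : list_charge s (cell n i) \is a fin_num by exact: fin_num_measure.
  transitivity (fine (p.1%:E * dirac_charge p.2 (cell n i) + list_charge s (cell n i))%E).
    by [].
  by rewrite fineD ?fin_numM// fineM.
apply: cvgD; last exact: ih.
apply: cvgM; first exact: cvg_cst.
have -> : f p.2 = cint (dirac_charge p.2) f; last exact: cvg_disc.
rewrite cint_finite_measure// /Rintegral integral_dirac//=; last first.
  by rewrite -unit01E; apply/measurable_EFinP; exact: unif_cont1_measurable.
by rewrite indicE mem_set ?mul1r// -unit01E.
Qed.

Variable q : R -> R -> R.
Hypothesis qK : cov_kernel q.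

Lemma potential_unif_cont s : supported unit01 s -> unif_cont1 (potential q s).
Proof.
move=> sD e e0; have m1 : 0 < mass s + 1 by rewrite ltr_wpDl// mass_ge0.
have e1 : 0 < e / (mass s + 1) by rewrite divr_gt0.
have [h h0 hq] := kernel_cont q qK _ e1; exists h => // t u tD uD tu.
apply: (@le_trans _ _ (mass s * (e / (mass s + 1)))).
  apply: (lin_le unit01) => // v vD; apply: hq => //.
  by rewrite subrr normr0 ltW.
by rewrite mulrCA ler_piMr ?ltW// ltr_pdivrMr// mul1r ltrDl.
Qed.

Lemma kernel_path_list s t : supported unit01 s -> unit01 t ->
  kernel_path q (list_charge s) t = potential q s t.
Proof.
by move=> sD tD; apply: cint_list_charge => //; exact: unif_cont1_section.
Qed.

Lemma cint_ext (lam : signed_measure) (f g : R -> R) : unif_cont1 f -> unif_cont1 g ->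
  (forall t, unit01 t -> f t = g t) -> cint lam f = cint lam g.
Proof.
move=> cf cg fg; apply/eqP; rewrite -subr_eq0 -normr_le0.
have := cint_le lam f g 0 cf cg; rewrite mulr0; apply.
by move=> t tD; rewrite fg// subrr normr0.
Qed.

Lemma pair_list s s' : supported unit01 s -> supported unit01 s' ->
  pair q (list_charge s) (list_charge s') = bil q s s'.
Proof.
move=> sD s'D; rewrite /pair.
rewrite (cint_ext _ _ (potential q s')).
- by rewrite cint_list_charge//; exact: potential_unif_cont.
- exact: unif_cont1_kernel_path.
- exact: potential_unif_cont.
- by move=> t tD; exact: kernel_path_list.
Qed.

End charges_of_lists.

(** * The squared norm as a supremum of scores *)

Section rkhs_rate_characterization.
Context {R : realType}.
Local Notation mT := (measurableTypeR R).
Local Notation signed_measure := ({charge set mT -> \bar R}).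
Variable q : R -> R -> R.
Hypothesis qK : cov_kernel q.
Implicit Types (h : unit_itv R -> R) (lam : nat -> signed_measure).

Let a_ lam n := pair q (lam n) (lam n).

(* From |l + s m|^2 >= 0 at s = -1 + eta. *)
Lemma sqnorm_diff_lower (l m : signed_measure) (eta D : R) : 0 < eta <= 1 ->
  kernel_sqnorm q (charge_diff l m) <= D -> 0 <= D ->
  pair q l l - pair q m m >= - (eta * pair q m m + D / eta).
Proof.
move=> /andP[eta0 eta1]; rewrite kernel_sqnorm_diff//.
have := pair_quadratic_ge0 q qK l m (-1 + eta).
set A := pair q l l; set B := pair q m m; set p := pair q l m => h hD D0.
rewrite lerNl -(ler_pM2l eta0).
have e : eta * (eta * B + D / eta) = eta ^+ 2 * B + D by field; rewrite gt_eqF.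
rewrite e; nra.
Qed.

Lemma rkhs_approx_bounded lam h : rkhs_approx q lam h ->
  exists K, forall n, a_ lam n <= K.
Proof.
move=> [cau _]; have [N hN] := cau 1 ltr01.
have tail n : (N <= n)%N -> a_ lam n <= 2 * a_ lam N + 4.
  move=> Nn; have := hN N n (leqnn N) Nn => /ltW h1.
  have hh : 0 < (2^-1 : R) <= 1 by apply/andP; split; lra.
  have := sqnorm_diff_lower _ _ _ _ hh h1 ler01.
  rewrite -/(a_ lam N) -/(a_ lam n); lra.
exists (\sum_(i < N.+1) `|a_ lam i| + (2 * `|a_ lam N| + 4)) => n.
have s0 : 0 <= \sum_(i < N.+1) `|a_ lam i| by exact: sumr_ge0.
have aN := ler_norm (a_ lam N); have aN0 := normr_ge0 (a_ lam N).
have [nN|Nn] := ltnP n N.+1; last by have := tail n (ltnW Nn); lra.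
have : `|a_ lam n| <= \sum_(i < N.+1) `|a_ lam i|.
  by rewrite (bigD1 (Ordinal nN))//= lerDl sumr_ge0.
by have := ler_norm (a_ lam n); lra.
Qed.

(** Squared norms are compared by [sqnorm_diff_lower] in place of a triangle inequality for their
    square roots: with a small weight [eta], boundedness of the sequence controls the error and the
    squared norms are Cauchy. *)
Lemma rkhs_approx_cvg lam h : rkhs_approx q lam h ->
  exists v : R, kernel_sqnorm q (lam n) @[n --> \oo] --> v.
Proof.
move=> ha; have [K hK] := rkhs_approx_bounded _ _ ha; have [cau _] := ha.
suff : cvg (a_ lam n @[n --> \oo]) by move=> /cvg_ex[v hv]; exists v.
apply/cauchy_cvgP/cauchy_exP => e e0.
pose M := `|K| + 1; have M0 : 0 < M by rewrite ltr_wpDl.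
pose eta := Num.min 1 (e / (4 * M)).
have eta0 : 0 < eta by rewrite lt_min ltr01/= divr_gt0// mulr_gt0.
have eta1 : 0 < eta <= 1 by rewrite eta0/= ge_min lexx.
have etaM : eta * M <= e / 4.
  have : eta <= e / (4 * M) by rewrite ge_min lexx orbT.
  rewrite ler_pdivlMr; last by rewrite mulr_gt0.
  by rewrite ler_pdivlMr//; lra.
have D0 : 0 < eta * (e / 4) by rewrite mulr_gt0// divr_gt0.
have [N hN] := cau _ D0; exists (a_ lam N); exists N => // n /= Nn.
have step i j : (N <= i)%N -> (N <= j)%N -> a_ lam i - a_ lam j >= - (e / 2).
  move=> Ni Nj; have h1 := ltW (hN i j Ni Nj).
  have := sqnorm_diff_lower _ _ _ _ eta1 h1 (ltW D0).
  rewrite [_ * (e / 4) / _]mulrAC divff ?gt_eqF// mul1r -/(a_ lam i) -/(a_ lam j).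
  have : eta * a_ lam j <= eta * M.
    rewrite ler_pM2l// (le_trans (hK j))// (le_trans (ler_norm _))//.
    by rewrite lerDl.
  lra.
rewrite /ball/= ltr_norml; apply/andP; split.
  by have := step N n (leqnn N) Nn; lra.
by have := step n N Nn (leqnn N); lra.
Qed.

(** No score exceeds v / 2, because |lam_n - s|^2 is nonnegative and passes to the limit. The value
    is nearly reached by discretizing one lam_N, since |lam_N - lam_n|^2 is small for all later
    n. *)
Lemma rkhs_approx_score lam h (v e : R) : rkhs_approx q lam h ->
  unif_cont1 (extend h) ->
  kernel_sqnorm q (lam n) @[n --> \oo] --> v -> 0 < e ->
  rate_le q (2^-1 * v) (extend h) /\
  exists2 s, supported unit01 s & 2^-1 * v - e <= score q (extend h) s.
Proof.
move=> [cau unif] ch cv e0.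
have pathb (d : R) : 0 < d -> exists N, forall n, (N <= n)%N -> forall t, unit01 t ->
    `|kernel_path q (lam n) t - extend h t| <= d.
  move=> d0; have [N hN] := unif d d0; exists N => n Nn t tD.
  have := hN n Nn (to_itv t); rewrite /= clamp01_id// => /ltW.
  by [].
have cK (l : signed_measure) : cint l (kernel_path q (lam n)) @[n --> \oo] -->
    cint l (extend h).
  apply/cvgrPdist_le => d d0.
  have t1 : 0 < tv l + 1 by rewrite ltr_wpDl// tv_ge0.
  have d1 : 0 < d / (tv l + 1) by rewrite divr_gt0.
  have [N hN] := pathb _ d1; exists N => // n /= Nn.
  apply: (le_trans (cint_le l _ _ (d / (tv l + 1)) ch (unif_cont1_kernel_path q qK _) _)).
    by move=> t tD; rewrite distrC; exact: hN.
  by rewrite mulrCA ler_piMr ?ltW// ltr_pdivrMr// mul1r ltrDl.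
split.
  move=> s sD; rewrite /score.
  have sN : supported unit01 (scale_list (-1) s) by exact: supported_scale.
  have c1 : pair q (lam n) (lam n) - 2 * cint (list_charge s) (kernel_path q (lam n)) +
      bil q s s @[n --> \oo] --> v - 2 * lin s (extend h) + bil q s s.
    apply: cvgD; last exact: cvg_cst.
    apply: cvgB; first exact: cv.
    apply: cvgM; first exact: cvg_cst.
    by rewrite -(cint_list_charge s (extend h) sD ch); exact: cK.
  have : 0 <= v - 2 * lin s (extend h) + bil q s s; last by lra.
  rewrite -(cvg_lim (@Rhausdorff R) c1); apply: limr_ge.
    by apply/cvg_ex; eexists; exact: c1.
  apply: nearW => n.
  have := pair_quadratic_ge0 q qK (lam n) (list_charge s) (-1).
  rewrite pair_list// (pair_sym q qK (lam n) (list_charge s)) sqrrN expr1n mul1r.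
  by rewrite mulrN1 mulNr.
have e4 : 0 < e / 4 by rewrite divr_gt0.
have [N hN] := cau _ e4.
(* Lets n tend to infinity in |lam_N - lam_n|^2 < e / 4, where the cross term tends to the integral
   of [h] against lam_N. *)
have hv : v - e / 4 <= 2 * cint (lam N) (extend h) - pair q (lam N) (lam N).
  have c1 : 2 * cint (lam N) (kernel_path q (lam n)) - pair q (lam N) (lam N) -
      pair q (lam n) (lam n)
      @[n --> \oo] --> 2 * cint (lam N) (extend h) - pair q (lam N) (lam N) - v.
    apply: cvgB; last exact: cv.
    apply: cvgB; last exact: cvg_cst.
    by apply: cvgM; [exact: cvg_cst|exact: cK].
  have : - (e / 4) <= 2 * cint (lam N) (extend h) - pair q (lam N) (lam N) - v; last by lra.
  rewrite -(cvg_lim (@Rhausdorff R) c1); apply: limr_ge.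
    by apply/cvg_ex; eexists; exact: c1.
  exists N => // n /= Nn.
  have := hN N n (leqnn N) Nn; rewrite kernel_sqnorm_diff//.
  rewrite -/(pair q (lam N) (lam n)).
  move: (pair q (lam N) (lam n)) (pair q (lam N) (lam N)) (pair q (lam n) (lam n)).
  by move=> x y z; lra.
have c2 : score q (extend h) (disc (lam N) n) @[n --> \oo] -->
    cint (lam N) (extend h) - 2^-1 * pair q (lam N) (lam N).
  rewrite /score; apply: cvgB; first exact: cvg_disc.
  by apply: cvgM; [exact: cvg_cst|exact: cvg_bil_disc].
move/cvgrPdist_le : c2 => /(_ _ e4)[M _ hM].
have := hM M (leqnn M) => /=; rewrite ler_norml => /andP[h1 h2].
exists (disc (lam N) M); first exact: supported_disc.
lra.
Qed.

(** Strict concavity of the score: with B the energy of the difference, the midpoint of the two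
    lists beats [c] by at least B / 8 - e / 2, but also by at most e, whence B <= 12 e. *)
Lemma near_maximizers_close (g : R -> R) (c c' : seq (R * R)) e :
  near_maximizer q unit01 g e c -> near_maximizer q unit01 g e c' ->
  bil q (c ++ scale_list (-1) c') (c ++ scale_list (-1) c') <= 12 * e.
Proof.
move=> cM c'M; have [cD cmax] := cM; have [c'D c'max] := c'M.
have sD : supported unit01 (c' ++ scale_list (-1) c).
  by apply: supported_cat => //; exact: supported_scale.
have h1 := near_maximizerP q qK _ _ _ _ _ 2^-1 (@subset_refl _ unit01) cM sD.
have h2 := c'max _ cD.
rewrite /score in h2; move: h1.
rewrite lin_cat lin_scale bil_catr bil_scaler.
rewrite !(bil_add_scale unit01)//; try exact: kernel_sym.
rewrite (bil_sym unit01 q c' c)//; last exact: kernel_sym.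
nra.
Qed.

(** Near maximizers with errors tending to 0 are Cauchy in energy by concavity, and the first-order
    condition at Dirac masses makes their potentials converge uniformly to [h]. *)
Lemma rkhs_approx_near_maximizers h (b : R) : rate_le q b (extend h) ->
  exists lam, rkhs_approx q lam h.
Proof.
move=> hb.
have ex n : exists c, near_maximizer q unit01 (extend h) (n.+1%:R^-1) c.
  by apply: (near_maximizer_exists q unit01 (extend h) b) => //; rewrite invr_gt0.
pose c n := projT1 (cid (ex n)); have cM n : near_maximizer q unit01 (extend h) (n.+1%:R^-1) (c n).
  by rewrite /c; case: cid.
exists (fun n => list_charge (c n)); split.
  move=> e e0; have e24 : 0 < e / 24 by rewrite divr_gt0.
  have [N hN] := harmonic_lt _ e24; exists N => m n Nm Nn.
  have W k : (N <= k)%N -> near_maximizer q unit01 (extend h) (e / 24) (c k).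
    move=> Nk; have [cD cmax] := cM k; split => // s sD.
    by apply: (le_trans (cmax s sD)); rewrite lerD2l; exact: hN.
  have [cmD _] := cM m; have [cnD _] := cM n.
  rewrite kernel_sqnorm_diff// !pair_list//.
  have := near_maximizers_close _ _ _ _ (W m Nm) (W n Nn).
  by rewrite (bil_add_scale unit01)//; [lra|exact: kernel_sym].
move=> e e0; have [M M0 hM] := unif_cont2_bounded q (kernel_cont q qK).
(* The quadratic term at a Dirac mass is then at most e / 2, and an error below a e / 4 contributes
   at most e / 4. *)
pose a := e / M; have a0 : 0 < a by rewrite divr_gt0.
have ae : 0 < a * (e / 4) by rewrite mulr_gt0// divr_gt0.
have [N hN] := harmonic_lt _ ae; exists N => n Nn u.
have uD := val_unit01 u; have [cD _] := cM n.
rewrite kernel_path_list//.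
have := near_maximizer_close q qK _ _ _ _ [:: (1, val u)] a
  (@subset_refl _ unit01) a0 (cM n) (supported1 _ _ _ uD).
have -> : lin [:: (1, val u)] (extend h) = h u.
  by rewrite lin_cons lin_nil mul1r addr0 extend_val.
have -> : bil q (c n) [:: (1, val u)] = potential q (c n) (val u).
  rewrite (bil_sym unit01)//; [|exact: kernel_sym|exact: supported1].
  by rewrite /bil lin_cons lin_nil mul1r addr0.
have -> : bil q [:: (1, val u)] [:: (1, val u)] = q (val u) (val u).
  by rewrite /bil !lin_cons !lin_nil !mul1r !addr0.
rewrite distrC => /le_lt_trans; apply.
have h1 : n.+1%:R^-1 / a <= e / 4 by rewrite ler_pdivrMr// mulrC hN.
have h2 : a * q (val u) (val u) <= e.
  have := hM _ _ uD uD; rewrite ler_norml => /andP[_ hq].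
  by rewrite /a mulrAC ler_pdivrMr// ler_pM2l.
rewrite -mulrA; move: h1 h2; move: (_ / a) (a * _) => x y; lra.
Qed.

Lemma rkhs_sqnormP h : rkhs q h -> unif_cont1 (extend h) ->
  exists2 lam, rkhs_approx q lam h &
    kernel_sqnorm q (lam n) @[n --> \oo] --> rkhs_sqnorm q h.
Proof.
move=> [_ [lam hl]] ch; have [v hv] := rkhs_approx_cvg _ _ hl.
apply: (@xgetPex _ 0 [set v | exists2 lam, rkhs_approx q lam h &
   kernel_sqnorm q (lam n) @[n --> \oo] --> v]).
by exists v, lam.
Qed.

(** Any limit that [rkhs_sqnorm] may pick is twice the supremum of the scores, so the choice of the
    approximating sequence is harmless, and a bounded supremum by itself puts the path in the
    space. *)
Lemma rkhs_rate_le (m : unit_itv R -> R) (h : C01 R) (b : R) : continuous m ->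
  (rkhs_rate q m h <= b%:E)%E <-> rate_le q b (extend (C01_fun h \- m)).
Proof.
move=> cm; set g := C01_fun h \- m.
have cg : continuous g.
  by move=> u; exact: (continuousB (continuous_C01 h u) (cm u)).
have ug := continuous_extend _ cg.
rewrite /rkhs_rate; split.
  case: ifPn => [/asboolP hr|_]; last by rewrite leye_eq.
  rewrite lee_fin => hb; have [lam hl hv] := rkhs_sqnormP _ hr ug.
  have [r _] := rkhs_approx_score _ _ _ _ hl ug hv ltr01.
  by move=> s sD; exact: le_trans (r s sD) hb.
move=> hb; have [lam hl] := rkhs_approx_near_maximizers _ _ hb.
have hr : rkhs q g by split => //; exists lam.
case: ifPn => [_|/asboolP//]; rewrite lee_fin.
have [lam' hl' hv] := rkhs_sqnormP _ hr ug.
apply/ler_addgt0Pr => e e0.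
have [_ [s sD hs]] := rkhs_approx_score _ _ _ _ hl' ug hv e0.
by have := hb s sD; rewrite -/g; lra.
Qed.

End rkhs_rate_characterization.

(** * Oscillation of Gaussian paths *)

Section list_families.
Context {R : realType} {I : finType}.

Definition combine (a : I -> R) (dl : I -> seq (R * R)) : seq (R * R) :=
  flatten [seq scale_list (a i) (dl i) | i <- enum I].

Lemma lin_combine a dl (f : R -> R) : lin (combine a dl) f = \sum_i a i * lin (dl i) f.
Proof.
rewrite /combine -[in RHS]big_enum.
elim: (enum I) => [|i s ih] /=; first by rewrite lin_nil big_nil.
by rewrite lin_cat ih lin_scale big_cons.
Qed.

Lemma bil_combine q a dl : bil q (combine a dl) (combine a dl) =
  \sum_i \sum_j a i * a j * bil q (dl i) (dl j).
Proof.
rewrite /bil lin_combine; apply: eq_bigr => i _.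
transitivity (a i * lin (dl i) (fun t => \sum_j a j * lin (dl j) (q t))).
  by congr (_ * lin _ _); apply/funext => t; rewrite lin_combine.
rewrite (_ : (fun t => _) = (fun t => lin (combine a dl) (q t))).
  rewrite lin_exchange lin_combine mulr_sumr; apply: eq_bigr => j _.
  by rewrite mulrA; congr (_ * _); rewrite lin_exchange.
by apply/funext => t; rewrite lin_combine.
Qed.

Lemma supported_combine D a dl : (forall i, supported D (dl i)) ->
  supported D (combine a dl).
Proof.
move=> h; rewrite /combine; elim: (enum I) => [|i s ih] //=.
by apply: supported_cat => //; apply: supported_scale.
Qed.

End list_families.

Section gaussian_family.
Context {R : realType} {d : measure_display} {Omega : measurableType d}.
Context (P : probability Omega R).
Variables (q : R -> R -> R) (mbar : R -> R) (v : R -> R).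
Variables (U : R -> Omega -> C01 R) (m : R -> R -> R) (K : R -> R -> R -> R).

Definition path (e : R) (w : Omega) : R -> R := extend (C01_fun (U e w)).

(* U e is a Gaussian path with mean m e and covariance K e, by its moment
   generating function [ga_mgf]. *)
Record gaussian_asymptotics : Prop := GaussianAsymptotics {
  ga_kernel : cov_kernel q;
  ga_mbar : unif_cont1 mbar;
  ga_v_gt0 : forall e, 0 < e -> 0 < v e;
  ga_v_cvg : v e @[e --> 0^'+] --> (0 : R);
  ga_measurable : forall e t, 0 < e -> unit01 t ->
    measurable_fun setT (fun w => path e w t);
  ga_mgf : \forall e \near 0^'+, forall s, supported unit01 s ->
    (\int[P]_w (expR (lin s (path e w)))%:E =
     (expR (lin s (m e) + 2^-1 * bil (K e) s s))%:E)%E;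
  ga_mean : forall r, 0 < r -> \forall e \near 0^'+,
    forall t, unit01 t -> `|m e t - mbar t| <= r;
  ga_cov : forall r, 0 < r -> \forall e \near 0^'+,
    forall t u, unit01 t -> unit01 u -> `|K e t u / v e - q t u| <= r;
  ga_small : forall r, 0 < r -> \forall e \near 0^'+, exists2 A,
    measurable A /\ ((2^-1)%:E <= P A)%E &
    forall w, A w -> forall t, unit01 t -> `|path e w t - m e t| <= r }.

Hypothesis ga : gaussian_asymptotics.

Lemma path_unif_cont e w : unif_cont1 (path e w).
Proof. by apply: continuous_extend; exact: continuous_C01. Qed.

Lemma measurable_lin_path e s : 0 < e -> supported unit01 s ->
  measurable_fun setT (fun w => lin s (path e w)).
Proof.
move=> e0; elim: s => [_|p s ih /supported_cons[pD sD]].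
  by under eq_fun do rewrite lin_nil; exact: measurable_cst.
under eq_fun do rewrite lin_cons; apply: measurable_funD; last exact: ih.
by apply: measurable_funM => //; apply: ga_measurable ga _ _ _ _.
Qed.

Definition increment (t u : R) : seq (R * R) := [:: (1, t); (-1, u)].

Lemma lin_increment t u (f : R -> R) : lin (increment t u) f = f t - f u.
Proof. by rewrite /increment !lin_cons lin_nil /= mul1r mulN1r addr0. Qed.

Lemma bil_increment k t u : bil k (increment t u) (increment t u) =
  k t t - k t u - k u t + k u u.
Proof. by rewrite /bil !lin_increment; lra. Qed.

Lemma supported_increment t u : unit01 t -> unit01 u ->
  supported unit01 (increment t u).
Proof. by move=> tD uD p; rewrite !inE => /orP[] /eqP ->. Qed.

(* Indexed by the code i of a triple (n, j, k), so that all the increments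
   between nodes at distance at most h form a sequence. *)
Definition node_increment (h : R) (i : nat) : seq (R * R) :=
  if unpickle i is Some (n, j, k) then
    if [&& (j <= n.+1)%N, (k <= n.+1)%N & `|node n j - node n k| <= h]
    then increment (node n j) (node n k) else [::]
  else [::].

Lemma supported_node_increment h i : supported unit01 (node_increment h i).
Proof.
rewrite /node_increment; case: unpickle => [[[n j] k]|] //.
case: ifP => // /and3P[jn kn _].
by apply: supported_increment; exact: node_unit01.
Qed.

Lemma node_increment_pickle (h : R) n j k : (j <= n.+1)%N -> (k <= n.+1)%N ->
  `|node n j - node n k| <= h ->
  node_increment h (pickle (n, j, k)) = increment (node n j) (node n k).
Proof. by move=> jn kn jk; rewrite /node_increment pickleK jn kn jk. Qed.

Lemma node_approx (t : R) n : unit01 t -> exists2 j, (j <= n.+1)%N &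
  `|t - node n j| <= n.+1%:R^-1.
Proof.
move=> /andP[t0 t1]; have n0 : 0 < n.+1%:R :> R by [].
have tn0 : 0 <= t * n.+1%:R by rewrite mulr_ge0// ltW.
have /andP[h1 h2] := truncn_itv tn0.
exists (Num.Def.truncn (t * n.+1%:R)).
  by rewrite -(ler_nat R) (le_trans h1)// ler_piMl// ltW.
have h3 : node n (Num.Def.truncn (t * n.+1%:R)) <= t by rewrite ler_pdivrMr.
have h4 : t <= node n (Num.Def.truncn (t * n.+1%:R)) + n.+1%:R^-1.
  by rewrite -nodeS ler_pdivlMr// ltW.
by rewrite ger0_norm ?subr_ge0// lerBlDl.
Qed.

Lemma centered_mgf e s : 0 < e -> supported unit01 s ->
  (\int[P]_w (expR (lin s (path e w)))%:E =
     (expR (lin s (m e) + 2^-1 * bil (K e) s s))%:E)%E ->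
  (\int[P]_w (expR (lin s (fun t => path e w t - m e t)))%:E =
     (expR (2^-1 * bil (K e) s s))%:E)%E.
Proof.
move=> e0 sD h.
have mE : measurable_fun setT (fun w => (expR (lin s (path e w)))%:E).
  apply/measurable_EFinP; apply: measurableT_comp => //.
  exact: measurable_lin_path.
have pE (w : Omega) : setT w -> (0 <= (expR (lin s (path e w)))%:E)%E.
  by rewrite lee_fin expR_ge0.
have hz := ge0_integralZl_EFin P measurableT pE mE (expR_ge0 (- lin s (m e))).
transitivity (\int[P]_w ((expR (- lin s (m e)))%:E * (expR (lin s (path e w)))%:E))%E.
  by apply: eq_integral => w _; rewrite -EFinM -expRD linB addrC.
by rewrite [LHS]hz h -EFinM -expRD addrA addNr add0r.
Qed.

Definition gap (e h : R) (i : nat) (w : Omega) : R :=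
  lin (node_increment h i) (fun t => path e w t - m e t).

Lemma measurable_gap e h i : 0 < e -> measurable_fun setT (gap e h i).
Proof.
move=> e0; rewrite /gap; under eq_fun do rewrite linB.
apply: measurable_funB => //; apply: measurable_lin_path => //.
exact: supported_node_increment.
Qed.

(** The bound is free of [N]. The closeness r / 4 of the path to its mean gives r / 2 for
    increments, as the concentration inequality requires. *)
Lemma finite_increments_tail (e r V h : R) N (A : set Omega) : 0 < e -> 0 < r -> 0 < V ->
  (forall s, supported unit01 s ->
    (\int[P]_w (expR (lin s (path e w)))%:E =
     (expR (lin s (m e) + 2^-1 * bil (K e) s s))%:E)%E) ->
  (forall i, bil (K e) (node_increment h i) (node_increment h i) <= V) ->
  measurable A -> ((2^-1)%:E <= P A)%E ->
  (forall w, A w -> forall t, unit01 t -> `|path e w t - m e t| <= r / 4) ->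
  (P [set w | (r <= max_norm (fun i : 'I_N => gap e h i w))%R] <=
   (expR (3 - r ^+ 2 / (32 * V)))%:E)%E.
Proof.
move=> e0 r0 V0 hmgf hV mA PA hA; pose D := gap e h.
have mD (i : 'I_N) : measurable_fun setT (D i).
  exact: measurable_gap.
apply: (gaussian_max_tail P _ (fun i j : 'I_N =>
  bil (K e) (node_increment h i) (node_increment h j))) => //.
- move=> u.
  have sc : supported unit01 (combine u (fun i : 'I_N => node_increment h i)).
    by apply: supported_combine => i; exact: supported_node_increment.
  have := centered_mgf e _ e0 sc (hmgf _ sc).
  by rewrite bil_combine => <-; apply: eq_integral => w _; rewrite lin_combine.
- apply: (le_trans PA); apply: le_measure; rewrite ?inE//.
    have mmax : measurable_fun setT (fun w => max_norm (fun i : 'I_N => D i w)).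
      exact: measurable_max_norm.
    rewrite (_ : [set w | _] = setT `&` (fun w => max_norm (fun i : 'I_N => D i w))
       @^-1` `]-oo, r / 2]); first exact: mmax.
    by apply/seteqP; split => w /=; rewrite in_itv/=; [split|case].
  move=> w /hA Aw /=; have [->|[i ->]] := max_norm_arg (fun i : 'I_N => D i w).
    by rewrite divr_ge0// ltW.
  rewrite /D /gap /node_increment; case: unpickle => [[[n j] k]|]; last first.
    by rewrite lin_nil normr0 divr_ge0// ltW.
  case: ifP => [/and3P[jn kn _]|_]; last by rewrite lin_nil normr0 divr_ge0// ltW.
  rewrite lin_increment.
  have h1 := Aw _ (node_unit01 n j jn); have h2 := Aw _ (node_unit01 n k kn).
  have := ler_normB (path e w (node n j) - m e (node n j))
    (path e w (node n k) - m e (node n k)); lra.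
Qed.

Definition osc_le (h r : R) (g : R -> R) := forall t u, unit01 t -> unit01 u ->
  `|t - u| <= h -> `|g t - g u| <= r.

Lemma osc_le_nodes (g f f' : R -> R) (h r : R) : unif_cont1 g -> 0 < h -> 0 < r ->
  (forall i, `|lin (node_increment (2 * h) i) (fun t => g t - f t)| <= r) ->
  (forall t, unit01 t -> `|f t - f' t| <= r) ->
  osc_le (2 * h) r f' -> osc_le h (8 * r) g.
Proof.
move=> cg h0 r0 hi hm om t u tD uD tu.
have [h' h'0 hp] := cg r r0.
have hh : 0 < Num.min h' (h / 2) by rewrite lt_min h'0 divr_gt0.
have [N hN] := harmonic_lt _ hh; have {hN} := hN N (leqnn N).
rewrite le_min => /andP[N1 N2].
have [j jN tj] := node_approx t N tD; have [k kN uk] := node_approx u N uD.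
have tjD : unit01 (node N j : R) by exact: node_unit01.
have ukD : unit01 (node N k : R) by exact: node_unit01.
have jk : `|node N j - node N k| <= 2 * h.
  have a1 := le_trans tj N2; have a2 := le_trans uk N2.
  have a3 := ler_distD t (node N j) (node N k).
  have a4 := ler_distD u t (node N k).
  rewrite (distrC (node N j) t) in a3.
  move: a1 a2 a3 a4 tu; move: `|t - node N j| `|u - node N k| `|t - node N k|.
  by move: `|t - u| `|_ - _| => ? ? ? ? ?; lra.
have := hi (pickle (N, j, k)); rewrite (node_increment_pickle _ _ _ _ jN kN jk).
rewrite lin_increment => h1.
have h2 : `|g t - g (node N j)| <= r.
  by apply: hp => //; exact: le_trans tj N1.
have h3 : `|g u - g (node N k)| <= r.
  by apply: hp => //; exact: le_trans uk N1.
have h4 := om _ _ tjD ukD jk; have h5 := hm _ tjD; have h6 := hm _ ukD.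
move: h1 h2 h3 h4 h5 h6; rewrite !ler_norml.
move=> /andP[? ?] /andP[? ?] /andP[? ?] /andP[? ?] /andP[? ?] /andP[? ?].
by apply/andP; split; lra.
Qed.

Lemma oscillation_tail (L delta : R) : 0 < delta -> exists2 h : R, 0 < h &
  \forall e \near 0^'+, exists2 B, measurable B /\ (P B <= (expR (- (L / v e)))%:E)%E &
    forall w, ~ B w -> osc_le h delta (path e w).
Proof.
move=> delta0; pose r := delta / 8; have r0 : 0 < r by rewrite divr_gt0.
(* With increments of variance at most 2 eta v, the exponent of the concentration inequality is
   exactly (|L| + 1) / v. The extra 1 / v absorbs the constant 3 once v <= 1/3. *)
pose eta := r ^+ 2 / (64 * (`|L| + 1)).
have L0 : 0 < `|L| + 1 by rewrite ltr_wpDl.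
have eta0 : 0 < eta by rewrite divr_gt0// ?exprn_gt0// mulr_gt0.
have qK := ga_kernel ga.
have eta4 : 0 < eta / 2 by rewrite divr_gt0.
have [h1 h10 hq] := kernel_cont q qK _ eta4.
have [h2 h20 hmb] := ga_mbar ga _ r0.
(* Halved, since the nodes near two points at distance h may be 2 h apart. *)
pose h := Num.min h1 h2 / 2.
have h0 : 0 < h by rewrite divr_gt0// lt_min h10.
have hh : 2 * h = Num.min h1 h2 by rewrite /h mulrC divfK.
exists h => //.
have r40 : 0 < r / 4 by rewrite divr_gt0.
have eta8 : 0 < eta / 4 by rewrite divr_gt0.
have v1 : \forall e \near 0^'+, v e <= 3^-1.
  have v30 : 0 < 3^-1 :> R by [].
  have /cvgrPdist_le /(_ _ v30) := ga_v_cvg ga.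
  by apply: filterS => e; rewrite sub0r normrN => /(le_trans (ler_norm _)).
have pos : \forall e \near (0 : R)^'+, 0 < e by exact: nbhs_right_gt.
near=> e.
have e0 : 0 < e by near: e.
have ve0 := ga_v_gt0 ga _ e0.
have ve1 : v e <= 3^-1 by near: e.
have emgf : forall s, supported unit01 s ->
    (\int[P]_w (expR (lin s (path e w)))%:E =
     (expR (lin s (m e) + 2^-1 * bil (K e) s s))%:E)%E.
  by near: e; exact: ga_mgf ga.
have em : forall t, unit01 t -> `|m e t - mbar t| <= r.
  by near: e; exact: ga_mean ga _ r0.
have ec : forall t u, unit01 t -> unit01 u -> `|K e t u / v e - q t u| <= eta / 4.
  by near: e; exact: ga_cov ga _ eta8.
have [A [mA PA] hA] : exists2 A, measurable A /\ ((2^-1)%:E <= P A)%E &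
    forall w, A w -> forall t, unit01 t -> `|path e w t - m e t| <= r / 4.
  by near: e; exact: ga_small ga _ r40.
have V0 : 0 < 2 * eta * v e by rewrite !mulr_gt0.
(* The increment of [q] contributes eta / 2 twice, and the four values of [K e / v e] differ from
   those of [q] by at most eta / 4 each. *)
have hV i : bil (K e) (node_increment (2 * h) i) (node_increment (2 * h) i) <= 2 * eta * v e.
  rewrite /node_increment; case: unpickle => [[[n j] k]|]; last first.
    by rewrite /bil lin_nil ltW.
  case: ifP => [/and3P[jn kn jk]|_]; last by rewrite /bil lin_nil ltW.
  rewrite bil_increment; set t := node n j; set u := node n k.
  have tD : unit01 t by exact: node_unit01.
  have uD : unit01 u by exact: node_unit01.
  have tu1 : `|t - u| <= h1 by rewrite (le_trans jk)// hh ge_min lexx.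
  have ut1 : `|u - t| <= h1 by rewrite distrC.
  have h1' : 0 <= h1 by exact: ltW.
  have q1 : `|q t t - q t u| <= eta / 2 by apply: hq => //; rewrite subrr normr0.
  have q2 : `|q u u - q u t| <= eta / 2 by apply: hq => //; rewrite subrr normr0.
  have c1 := ec t t tD tD; have c2 := ec t u tD uD.
  have c3 := ec u t uD tD; have c4 := ec u u uD uD.
  rewrite -ler_pdivrMr//.
  have -> : (K e t t - K e t u - K e u t + K e u u) / v e =
    K e t t / v e - K e t u / v e - K e u t / v e + K e u u / v e by ring.
  move: q1 q2 c1 c2 c3 c4; rewrite !ler_norml.
  move=> /andP[? ?] /andP[? ?] /andP[? ?] /andP[? ?] /andP[? ?] /andP[? ?]; lra.
pose D := gap e (2 * h).
pose B_ N := [set w | (r <= max_norm (fun i : 'I_N => D i w))%R].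
have mB N : measurable (B_ N).
  have mmax : measurable_fun setT (fun w => max_norm (fun i : 'I_N => D i w)).
    apply: measurable_max_norm => i.
    exact: measurable_gap.
  rewrite (_ : B_ N = setT `&` (fun w => max_norm (fun i : 'I_N => D i w))
     @^-1` `[r, +oo[); first exact: mmax.
  by apply/seteqP; split => w /=; rewrite /B_/= in_itv/= andbT; [split|case].
have ndB : nondecreasing_seq B_.
  move=> N M NM; apply/subsetPset => w /=; rewrite /B_/= => /le_trans; apply.
  have [->|[i ->]] := max_norm_arg (fun i : 'I_N => D i w); first exact: max_norm_ge0.
  exact: (max_norm_ge (fun i : 'I_M => D i w) (widen_ord NM i)).
(* The bound is uniform in the number of increments, so continuity from below extends it to all of
   them. *)
exists (\bigcup_N B_ N).
  split; first exact: bigcup_measurable.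
  have := @nondecreasing_cvg_mu _ _ _ P B_ mB (bigcup_measurable (fun k _ => mB k)) ndB.
  move=> /(cvg_lim (@ereal_hausdorff R)) <-; apply: lime_le.
    apply: ereal_nondecreasing_is_cvgn => N M NM.
    by apply: le_measure; rewrite ?inE//; apply/subsetPset; exact: ndB.
  apply: nearW => N.
  apply: (le_trans (finite_increments_tail e r _ _ N A e0 r0 V0 emgf hV mA PA hA)).
  rewrite lee_fin ler_expR.
  have -> : r ^+ 2 / (32 * (2 * eta * v e)) = (`|L| + 1) / v e.
    by rewrite /eta; field; rewrite !gt_eqF.
  have i3 : 3 <= 1 / v e by rewrite div1r -[leLHS]invrK lef_pV2 ?posrE// invr_gt0.
  have : L / v e <= `|L| / v e by rewrite ler_pM2r ?invr_gt0// ler_norm.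
  rewrite mulrDl; lra.
move=> w nB.
have -> : delta = 8 * r by rewrite /r mulrC divfK.
apply: (osc_le_nodes _ (m e) mbar) => //; first exact: path_unif_cont.
  move=> i; rewrite leNgt; apply/negP => ri; apply: nB; exists i.+1 => //.
  rewrite /B_/=; apply: (le_trans (ltW ri)).
  exact: (max_norm_ge (fun j : 'I_i.+1 => D j w) ord_max).
move=> t u tD uD tu; apply: hmb => //; apply: (le_trans tu).
by rewrite hh ge_min lexx orbT.
Unshelve. all: by end_near. Qed.

End gaussian_family.

(** * Compactness and measurability in the path space *)

Section level_sets.
Context {R : realType}.
Implicit Types (q : R -> R -> R) (g mbar : R -> R).

Lemma eq_rate_le q b g g' : (forall t, unit01 t -> g t = g' t) ->
  rate_le q b g <-> rate_le q b g'.
Proof.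
move=> gg'; split => h s sD; have := h s sD; rewrite /score.
  by rewrite (eq_lin unit01 s g g').
by rewrite (eq_lin unit01 s g g').
Qed.

Lemma rate_le_osc q mbar (a delta : R) : cov_kernel q -> unif_cont1 mbar ->
  0 < delta -> exists2 h : R, 0 < h &
  forall g, rate_le q a (fun t => g t - mbar t) -> osc_le h delta g.
Proof.
move=> qK cm d0; have d20 : 0 < delta / 2 by rewrite divr_gt0.
have [h1 h10 hh1] := rate_le_equicontinuous q qK a _ d20.
have [h2 h20 hh2] := cm _ d20.
exists (Num.min h1 h2); first by rewrite lt_min h10.
move=> g ga t u tD uD; rewrite le_min => /andP[tu1 tu2].
have := hh1 _ ga t u tD uD tu1; have := hh2 t u tD uD tu2.
rewrite !ler_norml => /andP[? ?] /andP[? ?]; apply/andP; split; lra.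
Qed.

Lemma osc_le_close (h delta : R) (f g : R -> R) n : n.+1%:R^-1 <= h ->
  osc_le h delta f -> osc_le h delta g ->
  (forall j, (j <= n.+1)%N -> `|f (node n j) - g (node n j)| <= delta) ->
  forall t, unit01 t -> `|f t - g t| <= 3 * delta.
Proof.
move=> nh fo go fg t tD; have [j jn tj] := node_approx t n tD.
have nD : unit01 (node n j : R) by exact: node_unit01.
have h1 := fo _ _ tD nD (le_trans tj nh); have h2 := go _ _ tD nD (le_trans tj nh).
have := fg _ jn; move: h1 h2; rewrite !ler_norml.
by move=> /andP[? ?] /andP[? ?] /andP[? ?]; apply/andP; split; lra.
Qed.

Lemma filter_forall_mem {T : Type} (F : set_system T) {FF : Filter F}
    {I : eqType} (s : seq I) (Q : I -> set T) : (forall i, i \in s -> F (Q i)) ->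
  F [set x | forall i, i \in s -> Q i x].
Proof.
elim: s => [|i s ih] h; first exact: filterS filterT.
have h1 := h i (mem_head _ _).
have h2 : F [set x | forall i, i \in s -> Q i x].
  by apply: ih => j js; apply: h; rewrite inE js orbT.
apply: filterS2 h1 h2 => x a1 a2 j; rewrite inE => /orP[/eqP ->//|]; exact: a2.
Qed.

(** Tychonoff's theorem for the product topology; a neighborhood of the cluster point constrains
    finitely many times, which is all that a score sees. *)
Lemma pointwise_cluster (F : set_system (R -> R)) {FF : ProperFilter F} (A : R) :
  F [set f | forall t, `|f t| <= A] -> exists f : R -> R,
  forall (B : set (R -> R)) (s : seq R) (e : R), F B -> 0 < e ->
  exists2 g, B g & forall t, t \in s -> `|f t - g t| <= e.
Proof.
move=> FA; pose T := prod_topology (fun _ : R => R : topologicalType).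
have cB := @tychonoff R (fun _ => R : topologicalType)
  (fun _ => [set` `[- A, A]]) (fun _ => @segment_compact R _ _).
have FB : (F : set_system T) [set f | forall t, [set` `[- A, A]] (f t)].
  apply: (@filterS _ F _ _ _ _ FA) => f fA t /=.
  by rewrite in_itv/= -ler_norml; exact: fA.
have [f [_ fc]] := cB F FF FB; exists f => B s e FB0 e0.
have h2 : nbhs (f : T) [set g | forall t, t \in s -> `|f t - g t| <= e].
  apply: (@filter_forall_mem _ (nbhs (f : T)) _ R s
    (fun t => [set g : T | `|f t - g t| <= e])) => t _.
  have U : nbhs (f t : R) [set x : R | `|f t - x| <= e].
    by apply/nbhs_ballP; exists e => // x; rewrite -ball_normE => /ltW.
  exact: (@proj_continuous R (fun _ => R : topologicalType) t f _ U).
by have [g [Bg hg]] := fc _ _ FB0 h2; exists g.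
Qed.

Lemma score_pointwise q f s (b : R) : (forall e, 0 < e -> exists2 g,
    score q g s <= b & forall t, t \in [seq p.2 | p <- s] -> `|f t - g t| <= e) ->
  score q f s <= b.
Proof.
move=> h; apply/ler_addgt0Pr => e e0; pose e' := e / (mass s + 1).
have m0 : 0 < mass s + 1 by rewrite ltr_wpDl// mass_ge0.
have e'0 : 0 < e' by rewrite divr_gt0.
have [g gb fg] := h _ e'0; move: gb; rewrite /score.
have h1 : `|lin s f - lin s g| <= mass s * e'.
  apply: (@lin_le _ (fun t => t \in [seq p.2 | p <- s])) => // p ps.
  by rewrite map_f.
have h2 : mass s * e' <= e.
  by rewrite /e' mulrCA ler_piMr ?(ltW e0)// ler_pdivrMr// mul1r lerDl.
have := le_trans (ler_norm _) (le_trans h1 h2); lra.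
Qed.

Lemma osc_unif_cont1 f : (forall e : R, 0 < e -> exists2 h : R, 0 < h & osc_le h e f) ->
  continuous (f \o val : unit_itv R -> R).
Proof.
move=> cf; apply: unif_cont1_continuous => e e0; have [h h0 hh] := cf e e0.
by exists h => // t u tD uD tu; rewrite !extend_id//; exact: hh.
Qed.

(** A function of bounded rate is continuous on the unit interval, so [to_C01] does not fall back on
    the zero path. *)
Lemma rate_le_to_C01 q mbar a f : cov_kernel q -> unif_cont1 mbar ->
  rate_le q a (fun t => f t - mbar t) ->
  forall t, unit01 t -> extend (C01_fun (to_C01 (f \o val))) t = f t.
Proof.
move=> qK cm fK t tD; rewrite to_C01E ?extend_id//; apply: osc_unif_cont1 => e e0.
by have [h h0 hh] := rate_le_osc q mbar a e qK cm e0; exists h => //; exact: hh.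
Qed.

(** An Arzela-Ascoli argument: a pointwise cluster point keeps all the score bounds, hence the
    common modulus of continuity, which turns closeness at finitely many nodes into uniform
    closeness. *)
Lemma rate_le_compact q mbar (a : R) : cov_kernel q -> unif_cont1 mbar ->
  compact [set h : C01 R | rate_le q a (fun t => extend (C01_fun h) t - mbar t)].
Proof.
move=> qK cm F FF FK.
have [A1 A10 hA1] := rate_le_bounded q qK a.
have [A2 A20 hA2] := unif_cont1_bounded _ cm.
set K := [set h : C01 R | _] in FK *.
have bK (h : C01 R) t : K h -> `|extend (C01_fun h) t| <= A1 + A2.
  move=> Kh; rewrite /extend -(extend_val (C01_fun h)).
  have tD := val_unit01 (to_itv t); have := hA1 _ Kh _ tD; have := hA2 _ tD.
  by rewrite !ler_norml => /andP[? ?] /andP[? ?]; apply/andP; split; lra.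
pose ev (h : C01 R) := extend (C01_fun h).
have FB : (ev @ F) [set f | forall t, `|f t| <= A1 + A2].
  by apply: (@filterS _ F _ K _ _ FK) => h Kh t; exact: bK.
have [f fc] := pointwise_cluster _ _ FB.
have near_f (B : set (C01 R)) (s : seq R) (e : R) : F B -> 0 < e -> exists h, [/\ B h, K h &
    forall t, t \in s -> `|f t - extend (C01_fun h) t| <= e].
  move=> FB0 e0.
  have h1 : (ev @ F) (ev @` (B `&` K)).
    have FBK := filterI FB0 FK.
    change (F (ev @^-1` (ev @` (B `&` K)))).
    apply: (@filterS _ F _ (B `&` K)); last exact: FBK.
    by move=> h BKh; exists h.
  by have [_ [h [Bh Kh] <-] hf] := fc _ s e h1 e0; exists h.
have fK : rate_le q a (fun t => f t - mbar t).
  move=> s sD; apply: score_pointwise => e e0.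
  have [h [_ Kh hf]] := near_f K [seq p.2 | p <- s] e FK e0.
  exists (fun t => extend (C01_fun h) t - mbar t); first exact: Kh.
  move=> t ts; have := hf t ts; congr (`|_| <= e); lra.
have ef := rate_le_to_C01 q mbar a f qK cm fK.
exists (to_C01 (f \o val)); split.
  by apply/(eq_rate_le _ _ _ (fun t => f t - mbar t)) => // t tD; rewrite ef.
move=> B N FB0 /C01_nbhsP [e e0 hN].
have d0 : 0 < e / 4 by rewrite divr_gt0.
have [h h0 hh] := rate_le_osc q mbar a _ qK cm d0.
have [n hn] := harmonic_lt _ h0; have {}hn := hn n (leqnn n).
have [g [Bg Kg gf]] := near_f B [seq node n j | j <- iota 0 n.+2] _ FB0 d0.
exists g; split => //; apply: hN => t.
rewrite -(extend_val _ t) -(extend_val (C01_fun g)) ef; last exact: val_unit01.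
have := osc_le_close h _ f _ n hn (hh _ fK) (hh _ Kg) _ _ (val_unit01 t).
have h1 j : (j <= n.+1)%N -> `|f (node n j) - extend (C01_fun g) (node n j)| <= e / 4.
  by move=> jn; apply: gf; apply: map_f; rewrite mem_iota.
by move=> /(_ h1) /le_lt_trans; apply; lra.
Qed.

(** A compact level set and a closed set disjoint from it lie at positive distance. *)
Lemma level_set_separation q mbar (b : R) (F : set (C01 R)) : cov_kernel q ->
  unif_cont1 mbar -> closed F ->
  (forall h, F h -> ~ rate_le q b (fun t => extend (C01_fun h) t - mbar t)) ->
  exists2 delta : R, 0 < delta & forall (f : R -> R) (g : C01 R), F g ->
    rate_le q b (fun t => f t - mbar t) ->
    ~ (forall t, unit01 t -> `|f t - extend (C01_fun g) t| <= delta).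
Proof.
move=> qK cm cF Fb; have cK := rate_le_compact q mbar b qK cm.
move: cK => /compact_near_coveringP cK; set K := (X in near_covering X) in cK.
have := cK R (0:R)^'+ (fun delta (h : C01 R) => forall g : C01 R, F g ->
  ~ (forall t, `|C01_fun h t - C01_fun g t| <= delta)) _.
case.
  move=> h Kh; have : nbhs h (~` F).
    by apply: open_nbhs_nbhs; split; [exact: closed_openC|move=> /Fb; exact].
  move=> /C01_nbhsP [e e0 he]; have e20 : 0 < e / 2 by rewrite divr_gt0.
  exists ([set h' | forall t, `|C01_fun h t - C01_fun h' t| < e / 2], [set x : R | x < e / 2]).
    split => /=; last exact: nbhs_right_lt.
    by apply/C01_nbhsP; exists (e / 2).
  move=> [h' x] /= [hh' xe] g Fg gh'; apply: (he g) => // t.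
  have := hh' t; have := gh' t; rewrite !ler_norml !ltr_norml.
  by move=> /andP[? ?] /andP[? ?]; apply/andP; split; lra.
move=> delta /= delta0 hd; exists (delta / 2); first by rewrite divr_gt0.
move=> f g Fg fK fg.
have ef := rate_le_to_C01 q mbar b f qK cm fK.
have d2 : ball_ (fun x : R => `|x|) 0 delta (delta / 2).
  by rewrite /= sub0r normrN gtr0_norm ?divr_gt0// ltr_pdivrMr// ltr_pMr// ltr1n.
have d20 : 0 < delta / 2 by rewrite divr_gt0.
have Kf : K (to_C01 (f \o val)).
  by apply/(eq_rate_le _ _ _ (fun t => f t - mbar t)) => // t tD; rewrite ef.
apply: (hd (delta / 2) d2 d20 _ Kf g Fg) => t.
rewrite -(extend_val _ t) -(extend_val (C01_fun g)) ef; last exact: val_unit01.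
by apply: fg; exact: val_unit01.
Qed.

End level_sets.

(** * Finite covers by scores and countable families of cells *)

Section finite_cover.
Context {R : realType}.
Implicit Types (q : R -> R -> R) (mbar : R -> R).

Lemma score1 q (g : R -> R) (a t : R) :
  score q g [:: (a, t)] = a * g t - 2^-1 * a ^+ 2 * q t t.
Proof. by rewrite /score /bil !lin_cons !lin_nil /=; ring. Qed.

(* Otherwise the paths of F on which a finite set of scores is at most b would
   have a pointwise cluster point, close to F and of rate at most b. *)
Lemma finite_score_cover q mbar (b delta h : R) (F : set (C01 R)) :
  cov_kernel q -> unif_cont1 mbar -> 0 < delta -> delta <= 1 -> 0 < h ->
  (forall (f : R -> R) (g : C01 R), F g -> rate_le q b (fun t => f t - mbar t) ->
     ~ (forall t, unit01 t -> `|f t - extend (C01_fun g) t| <= 3 * delta)) ->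
  exists2 ss : seq (seq (R * R)), (forall s, s \in ss -> supported unit01 s) &
    forall g, F g -> osc_le h delta (extend (C01_fun g)) ->
    exists2 s, s \in ss & b < score q (fun t => extend (C01_fun g) t - mbar t) s.
Proof.
move=> qK cm d0 d1 h0 sep; apply: contrapT => nex.
(* Two tests at time 0, with masses 1 and -1, are always included: they bound the value at 0, the
   oscillation then bounds the whole path, and a pointwise cluster point exists. *)
pose C ss := [set f : R -> R | exists g : C01 R, [/\ F g,
  osc_le h delta (extend (C01_fun g)), f = extend (C01_fun g) &
  forall s, s \in [:: [:: (1, 0)], [:: (-1, 0)] & ss] -> supported unit01 s ->
    score q (fun t => f t - mbar t) s <= b]].
have C0 ss : C ss !=set0.
  apply: contrapT => C0; apply: nex.
  pose ss' := [:: [:: (1, 0)], [:: (-1, 0)] & ss].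
  exists [seq s <- ss' | `[< supported unit01 s >]].
    by move=> s; rewrite mem_filter => /andP[/asboolP].
  move=> g Fg og; apply: contrapT => ng; apply: C0.
  exists (extend (C01_fun g)), g; split => // s ss'_s sD; rewrite leNgt; apply/negP => hs.
  by apply: ng; exists s => //; rewrite mem_filter ss'_s andbT; apply/asboolP.
have FF : ProperFilter (filter_from setT C).
  apply: filter_from_proper; last by move=> ss _; exact: C0.
  apply: filter_fromT_filter; first by exists [::].
  move=> ss1 ss2; exists (ss1 ++ ss2) => f [g [Fg og fg hs]].
  by split; exists g; split => // s; rewrite !inE => ss_s; apply: hs;
    rewrite !inE mem_cat; move: ss_s; do 2!case: (s == _) => //=;
    move=> ->; rewrite ?orbT.
have CF ss : filter_from setT C (C ss) by exists ss.
pose A := `|b| + 2^-1 * `|q 0 0| + `|mbar 0| + (Num.Def.truncn h^-1).+1%:R.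
have CA : filter_from setT C [set f | forall t, `|f t| <= A].
  exists [::] => // f [g [Fg og -> hs]] t; rewrite /extend -(extend_val (C01_fun g)).
  have := val_unit01 (to_itv t); move: (val (to_itv t)) => {}t tD.
  have h1 : score q (fun t => extend (C01_fun g) t - mbar t) [:: (1, 0)] <= b.
    by apply: hs; [rewrite !inE eqxx|apply: supported1; exact: unit01_0].
  have h2 : score q (fun t => extend (C01_fun g) t - mbar t) [:: (-1, 0)] <= b.
    by apply: hs; [rewrite !inE eqxx orbT|apply: supported1; exact: unit01_0].
  rewrite !score1 in h1 h2; have := chain_bound _ h h0 _ t tD.
  move=> /(_ (extend (C01_fun g))).
  have og1 x y : unit01 x -> unit01 y -> `|x - y| <= h ->
      `|extend (C01_fun g) x - extend (C01_fun g) y| <= 1.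
    by move=> xD yD xy; apply: (le_trans _ d1); exact: og.
  move=> /(_ og1); rewrite /A.
  have := ler_norm (q 0 0); have := ler_norm b; have := ler_norm (mbar 0).
  have := ler_norm (- mbar 0); rewrite normrN.
  move: h1 h2; move: (extend (C01_fun g) t) (extend (C01_fun g) 0) => x0 x1.
  move: `|b| `|q 0 0| `|mbar 0| => y1 y2 y3; move: ((Num.Def.truncn h^-1).+1%:R : R) => y4 *.
  by apply/ler_normlP; move: (ler_norm (x0 - x1)) (ler_norm (- (x0 - x1)));
    rewrite normrN => *; split; lra.
have [f fc] := pointwise_cluster _ A CA.
have fK : rate_le q b (fun t => f t - mbar t).
  move=> s sD; apply: score_pointwise => e e0.
  have [g [h' [_ _ _ hs]] fg] := fc _ [seq p.2 | p <- s] e (CF [:: s]) e0.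
  exists (fun t => g t - mbar t).
    by apply: hs => //; rewrite !inE eqxx !orbT.
  move=> t ts; have := fg t ts; congr (`|_| <= e); lra.
have [h2 h20 hh2] := rate_le_osc q mbar b delta qK cm d0.
have hm : 0 < Num.min h h2 by rewrite lt_min h0.
have [n hn] := harmonic_lt _ hm; have {}hn := hn n (leqnn n).
have [_ [g [Fg og -> _]] fg] :=
  fc _ [seq node n j | j <- iota 0 n.+2] delta (CF [::]) d0.
apply: (sep f g Fg fK); apply: (osc_le_close (Num.min h h2) delta f _ n hn).
- move=> t u tD uD; rewrite le_min => /andP[_ tu]; exact: (hh2 f fK).
- by move=> t u tD uD; rewrite le_min => /andP[tu _]; exact: og.
- by move=> j jn; apply: fg; apply: map_f; rewrite mem_iota.
Qed.

(* There are countably many cells, and every open set is the union of the cells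
   that it contains. *)
Definition path_cell (p : nat * nat * seq rat) : set (C01 R) :=
  let: (n, m, z) := p in
  [set g | (forall j, (j <= n.+1)%N ->
      `|extend (C01_fun g) (node n j) - ratr (nth 0 z j)| <= m.+1%:R^-1) /\
    forall i, `|lin (node_increment (2 * n.+1%:R^-1) i) (extend (C01_fun g))|
      <= m.+1%:R^-1].

(** The node increments bound the oscillation with factor 8, and comparing two such paths through
    their nodes brings the factor 3. *)
Lemma path_cell_close n m z (f g : C01 R) : path_cell (n, m, z) f ->
  path_cell (n, m, z) g -> forall t, `|C01_fun f t - C01_fun g t| <= 24 * m.+1%:R^-1.
Proof.
move=> [f1 f2] [g1 g2] t; rewrite -(extend_val _ t) -(extend_val (C01_fun g)).
have r0 : 0 < m.+1%:R^-1 :> R by rewrite invr_gt0.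
have h0 : 0 < n.+1%:R^-1 :> R by rewrite invr_gt0.
have osc (h : C01 R) : (forall i,
    `|lin (node_increment (2 * n.+1%:R^-1) i) (extend (C01_fun h))| <= m.+1%:R^-1) ->
    osc_le n.+1%:R^-1 (8 * m.+1%:R^-1) (extend (C01_fun h)).
  move=> hi; apply: (osc_le_nodes _ (fun=> 0) (fun=> 0)) => //.
  - by apply: continuous_extend; exact: continuous_C01.
  - move=> i; have := hi i; congr (`|lin _ _| <= _); apply/funext => u.
    by rewrite subr0.
  - by move=> u uD; rewrite subrr normr0 ltW.
  - by move=> u u' uD u'D _; rewrite subrr normr0 ltW.
have := osc_le_close n.+1%:R^-1 _ _ _ n (lexx _) (osc f f2) (osc g g2) _ _ (val_unit01 t).
have -> : 24 * m.+1%:R^-1 = 3 * (8 * m.+1%:R^-1) :> R by move: (_^-1) => x; lra.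
apply => j jn; have := f1 j jn; have := g1 j jn; move: r0.
move: (_^-1 : R) (extend _ _) (extend _ _) (ratr _) => x x1 x2 x3 x0.
by rewrite !ler_norml => /andP[? ?] /andP[? ?]; apply/andP; split; lra.
Qed.

Lemma path_cell_cover (g : C01 R) (e : R) : 0 < e -> exists p,
  path_cell p g /\ 24 * p.1.2.+1%:R^-1 < e.
Proof.
(* The denominator 25 makes the final inequality strict, the cells having diameter at most 24 / (m +
   1). *)
move=> e0; have e1 : 0 < e / 25 by rewrite divr_gt0.
have [m hm] := harmonic_lt _ e1; have {}hm := hm m (leqnn m).
have r0 : 0 < m.+1%:R^-1 :> R by rewrite invr_gt0.
have cg : unif_cont1 (extend (C01_fun g)).
  by apply: continuous_extend; exact: continuous_C01.
have [h h0 hh] := cg _ r0; have h20 : 0 < h / 2 by rewrite divr_gt0.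
have [n hn] := harmonic_lt _ h20; have {}hn := hn n (leqnn n).
have zP (j : nat) : exists z : rat,
    `|extend (C01_fun g) (node n j) - ratr z| <= m.+1%:R^-1.
  move: (extend _ _) => x.
  have lx : x < x + m.+1%:R^-1 by rewrite ltrDl.
  have [z] := rat_in_itvoo lx; rewrite in_itv/= => /andP[z1 z2].
  exists z; move: z1 z2; move: (ratr z) (m.+1%:R^-1 : R) r0 => y r r0 *.
  by rewrite ler_norml; apply/andP; split; lra.
pose z j := sval (cid (zP j)).
exists (n, m, [seq z j | j <- iota 0 n.+2]); split; last first.
  rewrite /=; move: (m.+1%:R^-1 : R) hm => *; lra.
split.
  move=> j jn; rewrite (nth_map 0%N) ?size_iota// nth_iota// add0n.
  exact: (svalP (cid (zP j))).
move=> i; rewrite /node_increment; case: unpickle => [[[k j] l]|]; last first.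
  by rewrite lin_nil normr0 ltW.
case: ifP => [/and3P[jk lk jl]|_]; last by rewrite lin_nil normr0 ltW.
rewrite lin_increment; apply: hh; [exact: node_unit01|exact: node_unit01|].
apply: (le_trans jl); move: (n.+1%:R^-1 : R) hn => *; lra.
Qed.

Lemma open_path_cells (G : set (C01 R)) : open G ->
  G = \bigcup_(p in [set p | path_cell p `<=` G]) path_cell p.
Proof.
move=> oG; apply/seteqP; split => [g Gg|g [p /= pG pg]]; last exact: pG.
have : nbhs g G by apply: open_nbhs_nbhs.
move=> /C01_nbhsP [e e0 eG]; have [[[n m] z] [pg pe]] := path_cell_cover g e e0.
exists (n, m, z) => // f pf; apply: eG => t; apply: le_lt_trans pe.
exact: path_cell_close pg pf t.
Qed.

End finite_cover.

Section path_measurability.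
Context {R : realType} {d : measure_display} {Omega : measurableType d}.

Lemma measurable_path_open (Z : Omega -> C01 R) (G : set (C01 R)) :
  (forall t, unit01 t -> measurable_fun setT (fun w => extend (C01_fun (Z w)) t)) ->
  open G -> measurable (Z @^-1` G).
Proof.
move=> mZ oG.
have mlin s : supported unit01 s ->
    measurable_fun setT (fun w => lin s (extend (C01_fun (Z w)))).
  elim: s => [_|p s ih /supported_cons[pD sD]].
    by under eq_fun do rewrite lin_nil; exact: measurable_cst.
  under eq_fun do rewrite lin_cons; apply: measurable_funD; last exact: ih.
  by apply: measurable_funM => //; exact: mZ.
have mle (Y : Omega -> R) (r : R) : measurable_fun setT Y ->
    measurable [set w | (Y w <= r)%R].
  move=> mY; rewrite (_ : [set w | _] = setT `&` Y @^-1` `]-oo, r]); first exact: mY.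
  by apply/seteqP; split => w /=; rewrite in_itv/=; [split|case].
have mcell p : measurable (Z @^-1` path_cell p).
  case: p => [[n m] z]; rewrite /path_cell.
  rewrite (_ : _ @^-1` _ =
    (\bigcap_(j in [set j | (j <= n.+1)%N])
      [set w | (`|extend (C01_fun (Z w)) (node n j) - ratr (nth 0%R z j)| <= m.+1%:R^-1)%R]) `&`
    \bigcap_i [set w | (`|lin (node_increment (2 * n.+1%:R^-1) i)
      (extend (C01_fun (Z w)))| <= m.+1%:R^-1)%R]); last first.
    apply/seteqP; split => w /=.
      by move=> [h1 h2]; split => [j /= jn|i _]; [exact: h1|exact: h2].
    by move=> [h1 h2]; split => [j jn|i]; [exact: h1|exact: h2].
  apply: measurableI; apply: bigcap_measurable; [by exists 0%N| |by exists 0%N|].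
    move=> j /= jn; apply: mle; apply: measurableT_comp => //.
    by apply: measurable_funB => //; apply: mZ; exact: node_unit01.
  move=> i _; apply: mle; apply: measurableT_comp => //.
  by apply: mlin; exact: supported_node_increment.
rewrite [G in _ @^-1` G](open_path_cells G oG) preimage_bigcup.
rewrite bigcup_mkcond; apply: countable_bigcupT_measurable => [|p].
  exact: countableP.
by case: ifP.
Qed.

End path_measurability.

(** * Large deviations of a Gaussian family *)

Section probability_bounds.
Context {R : realType} {d : measure_display} {Omega : measurableType d}.
Context (P : probability Omega R).

Lemma integral_scaled_indic (A : set Omega) (a : R) : measurable A -> 0 <= a ->
  (\int[P]_w (a * \1_A w)%:E = a%:E * P A)%E.
Proof.
move=> mA a0.
have m1 : measurable_fun setT (fun w => (\1_A w : R)%:E).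
  by apply/measurable_EFinP; exact: measurable_indic.
have p1 w : setT w -> (0 <= (\1_A w : R)%:E)%E by [].
have h := ge0_integralZl_EFin P measurableT p1 m1 a0.
under eq_integral do rewrite EFinM.
by rewrite [LHS]h integral_indic// setIT.
Qed.

Lemma probability_le_integral (A : set Omega) (f : Omega -> R) (a : R) :
  measurable A -> 0 <= a -> measurable_fun setT f -> (forall w, 0 <= f w) ->
  (forall w, A w -> a <= f w) -> (a%:E * P A <= \int[P]_w (f w)%:E)%E.
Proof.
move=> mA a0 mf f0 af; rewrite -integral_scaled_indic//.
apply: ge0_le_integral => //.
- by move=> w _; rewrite lee_fin mulr_ge0.
- by apply/measurable_EFinP; apply: measurable_funM => //; exact: measurable_indic.
- exact/measurable_EFinP.
- move=> w _; rewrite lee_fin indicE.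
  by case: (boolP (w \in A)) => [|_]; rewrite ?inE ?mulr1 ?mulr0//; exact: af.
Qed.

Lemma integral_le_indic_sum n (A : set Omega) (f : Omega -> R)
    (g : 'I_n -> Omega -> R) (a : R) : measurable A -> 0 <= a ->
  measurable_fun setT f -> (forall w, 0 <= f w) ->
  (forall i, measurable_fun setT (g i)) -> (forall i w, 0 <= g i w) ->
  (forall w, f w <= a * \1_A w + \sum_i g i w) ->
  (\int[P]_w (f w)%:E <= a%:E * P A + \sum_i \int[P]_w (g i w)%:E)%E.
Proof.
move=> mA a0 mf f0 mg g0 fg.
have m1 : measurable_fun setT (fun w => (a * \1_A w : R)%:E).
  by apply/measurable_EFinP; apply: measurable_funM => //; exact: measurable_indic.
have p1 w : setT w -> (0 <= (a * \1_A w : R)%:E)%E by rewrite lee_fin mulr_ge0.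
have m2 i : measurable_fun setT (fun w => (g i w)%:E) by exact/measurable_EFinP.
have p2 i w : setT w -> (0 <= (g i w)%:E)%E by rewrite lee_fin.
have m3 : measurable_fun setT (fun w => \sum_i (g i w)%:E)%E.
  by apply: emeasurable_sum => i _; exact: m2.
have p3 w : setT w -> (0 <= \sum_i (g i w)%:E)%E.
  by move=> _; apply: sume_ge0 => i _; rewrite lee_fin.
have h1 := ge0_integral_sum P measurableT m2 p2 (index_enum 'I_n).
have h2 := ge0_integralD P measurableT p1 m1 p3 m3.
rewrite -integral_scaled_indic// -[X in (_ <= _ + X)%E]h1 -[leRHS]h2.
apply: ge0_le_integral => //.
- by move=> w _; rewrite lee_fin.
- exact/measurable_EFinP.
- exact: emeasurable_funD.
- by move=> w _; rewrite sumEFin -EFinD lee_fin.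
Qed.

Lemma probability_cover {I : eqType} (s : seq I) (A : set Omega)
    (E : I -> set Omega) (p : R) : measurable A ->
  (forall i, i \in s -> measurable (E i) /\ (P (E i) <= p%:E)%E) ->
  (forall w, A w -> exists2 i, i \in s & E i w) -> (P A <= ((size s)%:R * p)%:E)%E.
Proof.
move: s A; elim=> [|i s ih] A mA hE cov /=.
  by rewrite mul0r (_ : A = set0) ?measure0//; apply/seteqP; split => w // /cov[].
have [mi Pi] := hE i (mem_head _ _).
have mAi : measurable (A `\` E i) by exact: measurableD.
have h1 : (P (A `\` E i) <= ((size s)%:R * p)%:E)%E.
  apply: ih => // [j js|w [Aw nEw]]; first by apply: hE; rewrite inE js orbT.
  have [j] := cov w Aw; rewrite inE => /orP[/eqP ->//|js Ej]; by exists j.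
have h2 : (P A <= P (A `\` E i) + P (E i))%E.
  have hU := measureU2 P mAi mi.
  apply: (le_trans _ hU); apply: le_measure; rewrite ?inE//.
    exact: measurableU.
  by move=> w Aw; have [?|?] := pselect (E i w); [right|left].
apply: (le_trans h2); rewrite -natr1 mulrDl mul1r EFinD; exact: leeD.
Qed.

End probability_bounds.

Section log_scale.
Context {R : realType}.

Lemma scaled_lne_le (x : \bar R) (a r : R) : 0 < r -> (0 <= x)%E ->
  (x <= (expR (a / r))%:E)%E -> (r%:E * lne x <= a%:E)%E.
Proof.
move=> r0 x0 xa.
have h : (lne x <= (a / r)%:E)%E.
  have -> : (a / r)%:E = lne (expR (a / r))%:E by rewrite lne_EFin ?expRK// expR_gt0.
  by rewrite lee_lne// in_itv/= ?leey ?andbT// lee_fin expR_ge0.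
have -> : a%:E = (r%:E * (a / r)%:E)%E by rewrite -EFinM mulrCA mulfV ?mulr1// gt_eqF.
by rewrite lee_pmul2l.
Qed.

Lemma scaled_lne_ge (x : \bar R) (a r : R) : 0 < r ->
  ((expR (a / r))%:E <= x)%E -> (a%:E <= r%:E * lne x)%E.
Proof.
move=> r0 xa.
have h : ((a / r)%:E <= lne x)%E.
  have -> : (a / r)%:E = lne (expR (a / r))%:E by rewrite lne_EFin ?expRK// expR_gt0.
  rewrite lee_lne// in_itv/= leey andbT ?lee_fin ?expR_ge0//.
  by apply: le_trans xa; rewrite lee_fin expR_ge0.
have -> : a%:E = (r%:E * (a / r)%:E)%E by rewrite -EFinM mulrCA mulfV ?mulr1// gt_eqF.
by rewrite lee_pmul2l.
Qed.

Lemma limf_esup_le_near {T : choiceType} {X : filteredType T} (f : X -> \bar R)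
    (F : set_system X) (a : \bar R) :
  F [set x | (f x <= a)%E] -> (limf_esup f F <= a)%E.
Proof.
move=> Fa; apply: ge_ereal_inf; exists (ereal_sup (f @` [set x | (f x <= a)%E])).
  by exists [set x | (f x <= a)%E].
by apply: ge_ereal_sup => _ [x xa <-].
Qed.

Lemma limf_einf_ge_near {T : choiceType} {X : filteredType T} (f : X -> \bar R)
    (F : set_system X) (a : \bar R) :
  F [set x | (a <= f x)%E] -> (a <= limf_einf f F)%E.
Proof.
move=> Fa; rewrite /limf_einf leeNr; apply: limf_esup_le_near.
by apply: (eq_ind _ F Fa); apply/funext => x; apply/propext; rewrite /= leeN2.
Qed.

(** Here [y] will be an infimum of the rate, possibly infinite, so the upper bound is tested at the
    real levels below it. *)
Lemma le_oppe_dense (x y : \bar R) :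
  (forall b : R, (b%:E < y)%E -> (x <= (- b)%:E)%E) -> (x <= - y)%E.
Proof.
move=> h; rewrite leNgt; apply/negP => yx.
case: x y h yx => [x| |] [y| |] h yx //.
- have := h ((y - x) / 2); rewrite lte_fin lee_fin; rewrite lte_fin in yx.
  by move=> hh; have := hh ltac:(lra); lra.
- by have := h (1 - x) (ltry _); rewrite lee_fin; lra.
- have := h (y - 1); rewrite lte_fin; move=> hh.
  by have := hh ltac:(lra); rewrite leye_eq.
- by have := h 0 (ltry _); rewrite leye_eq.
Qed.

End log_scale.

(** * Exponential estimates for scores *)

Section gaussian_large_deviations.
Context {R : realType} {d : measure_display} {Omega : measurableType d}.
Context (P : probability Omega R).
Variables (q : R -> R -> R) (mbar : R -> R) (v : R -> R).
Variables (U : R -> Omega -> C01 R) (m : R -> R -> R) (K : R -> R -> R -> R).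
Hypothesis ga : gaussian_asymptotics P q mbar v U m K.

Let qK : cov_kernel q := ga_kernel P q mbar v U m K ga.

(** Centered at the limit mean instead of the mean at [e], so that events expressed by scores do not
    move with [e]. *)
Definition deviation (e : R) (w : Omega) (t : R) : R := path U e w t - mbar t.

Lemma measurable_lin_deviation (e : R) s : 0 < e -> supported unit01 s ->
  measurable_fun setT (fun w => lin s (deviation e w)).
Proof.
move=> e0 sD; rewrite /deviation; under eq_fun do rewrite linB.
apply: measurable_funB; last exact: measurable_cst.
exact: (measurable_lin_path P q mbar v U m K ga).
Qed.

Lemma v_small (r : R) : 0 < r -> \forall e \near (0:R)^'+, v e <= r.
Proof.
move=> r0; have /cvgrPdist_le /(_ _ r0) := ga_v_cvg P q mbar v U m K ga.
by apply: filterS => e; rewrite sub0r normrN => /(le_trans (ler_norm _)).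
Qed.

(** Allows numerical factors and numbers of events to be paid for by an arbitrarily small change of
    the exponent. *)
Lemma expR_large (a C : R) : 0 < a -> \forall e \near (0:R)^'+, C <= expR (a / v e).
Proof.
move=> a0; have C0 : 0 < `|C| + 1 by rewrite ltr_wpDl.
have h := v_small _ (divr_gt0 a0 C0).
have pos : \forall e \near (0 : R)^'+, 0 < e by exact: nbhs_right_gt.
apply: filterS2 h pos => e ve e0; have ve0 := ga_v_gt0 P q mbar v U m K ga _ e0.
have h1 : `|C| + 1 <= a / v e by rewrite ler_pdivlMr// mulrC -ler_pdivlMr.
have := expR_ge1Dx (a / v e); have := ler_norm C; lra.
Qed.

(** The scaled logarithmic moment generating function tends to q(s, s) / 2: for the list divided by
    v, both the shift of the mean and the error on the covariance are negligible at scale 1 / v. *)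
Lemma score_mgf s (eta : R) : supported unit01 s -> 0 < eta ->
  \forall e \near (0:R)^'+, exists2 x : R, `|x - 2^-1 * bil q s s| <= eta &
    (\int[P]_w (expR (lin s (deviation e w) / v e))%:E = (expR (x / v e))%:E)%E.
Proof.
move=> sD eta0; have m0 := mass_ge0 s.
have M0 : 0 < mass s + 1 by rewrite ltr_wpDl.
pose r1 := eta / 2 / (mass s + 1); pose r2 := eta / ((mass s + 1) * (mass s + 1)).
have r10 : 0 < r1 by rewrite divr_gt0// divr_gt0.
have r20 : 0 < r2 by rewrite divr_gt0// mulr_gt0.
have pos : \forall e \near (0 : R)^'+, 0 < e by exact: nbhs_right_gt.
near=> e.
have e0 : 0 < e by near: e.
have ve0 := ga_v_gt0 P q mbar v U m K ga _ e0.
have emgf : forall s, supported unit01 s ->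
    (\int[P]_w (expR (lin s (path U e w)))%:E =
     (expR (lin s (m e) + 2^-1 * bil (K e) s s))%:E)%E.
  by near: e; exact: (ga_mgf P q mbar v U m K ga).
have em : forall t, unit01 t -> `|m e t - mbar t| <= r1.
  by near: e; exact: (ga_mean P q mbar v U m K ga).
have ec : forall t u, unit01 t -> unit01 u -> `|K e t u / v e - q t u| <= r2.
  by near: e; exact: (ga_cov P q mbar v U m K ga).
pose Kv t u := K e t u / v e.
exists (lin s (m e) - lin s mbar + 2^-1 * bil Kv s s).
  have h1 : `|lin s (m e) - lin s mbar| <= eta / 2.
    apply: (le_trans (lin_le _ _ _ _ _ sD em)).
    by rewrite /r1 mulrCA ler_piMr ?divr_ge0 ?(ltW eta0)// ler_pdivrMr// mul1r lerDl.
  have h2 : `|bil Kv s s - bil q s s| <= eta.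
    apply: (le_trans (bil_le _ Kv q _ _ _ sD sD ec)).
    rewrite mulrA /r2 mulrCA ler_piMr ?(ltW eta0)// ler_pdivrMr ?mulr_gt0// mul1r.
    by apply: ler_pM => //; rewrite lerDl.
  move: h1 h2; rewrite !ler_norml => /andP[? ?] /andP[? ?]; apply/andP; split; lra.
pose s' := scale_list (v e)^-1 s.
have s'D : supported unit01 s' by exact: supported_scale.
have mE : measurable_fun setT (fun w => (expR (lin s' (path U e w)))%:E).
  apply/measurable_EFinP; apply: measurableT_comp => //.
  exact: (measurable_lin_path P q mbar v U m K ga).
have pE (w : Omega) : setT w -> (0 <= (expR (lin s' (path U e w)))%:E)%E.
  by rewrite lee_fin expR_ge0.
have hz := ge0_integralZl_EFin P measurableT pE mE (expR_ge0 (- lin s' mbar)).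
transitivity (\int[P]_w ((expR (- lin s' mbar))%:E *
    (expR (lin s' (path U e w)))%:E))%E.
  apply: eq_integral => w _; rewrite -EFinM -expRD /deviation linB !lin_scale.
  by congr ((expR _)%:E); ring.
rewrite [LHS]hz emgf// -EFinM -expRD; congr ((expR _)%:E).
rewrite bil_scalel bil_scaler !lin_scale.
have -> : bil Kv s s = bil (K e) s s / v e.
  by rewrite /bil -linZr; congr lin; apply/funext => t; rewrite -linZr.
by field; rewrite gt_eqF.
Unshelve. all: by end_near. Qed.

(** On the event, s(deviation) exceeds b + q(s, s) / 2; in the exponential Markov inequality the
    half energy cancels against the moment generating function. *)
Lemma score_tail s (b eta : R) : supported unit01 s -> 0 < eta ->
  \forall e \near (0:R)^'+,
    measurable [set w | (b < score q (deviation e w) s)%R] /\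
    (P [set w | (b < score q (deviation e w) s)%R] <=
      (expR (- (b - eta) / v e))%:E)%E.
Proof.
move=> sD eta0; have pos : \forall e \near (0 : R)^'+, 0 < e by exact: nbhs_right_gt.
apply: filterS2 (score_mgf s _ sD eta0) pos => e [x hx hI] e0.
have ve0 := ga_v_gt0 P q mbar v U m K ga _ e0.
have ml := measurable_lin_deviation _ _ e0 sD.
have mA : measurable [set w | (b < score q (deviation e w) s)%R].
  rewrite (_ : [set w | _] = setT `&` (fun w => lin s (deviation e w)) @^-1`
    `]b + 2^-1 * bil q s s, +oo[); first exact: ml.
  apply/seteqP; split => w /=; rewrite in_itv/= andbT /score; last by case=> _; lra.
  by split => //; lra.
split => //.
have := probability_le_integral P _ (fun w => expR (lin s (deviation e w) / v e))
  (expR ((b + 2^-1 * bil q s s) / v e)) mA (expR_ge0 _) _ (fun w => expR_ge0 _) _.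
rewrite hI; set p := P _.
have m1 : measurable_fun setT (fun w => expR (lin s (deviation e w) / v e)).
  by apply: measurableT_comp => //; apply: measurable_funM.
move=> /(_ m1) h; have {}h := h _.
have : ((expR ((b + 2^-1 * bil q s s) / v e))%:E * p <= (expR (x / v e))%:E)%E.
  apply: h => w /=; rewrite /score => hw; rewrite ler_expR ler_pM2r ?invr_gt0//; lra.
have pf : p \is a fin_num by exact: fin_num_measure.
rewrite -(fineK pf) -EFinM !lee_fin => h2.
rewrite -(ler_pM2l (expR_gt0 ((b + 2^-1 * bil q s s) / v e))); apply: (le_trans h2).
rewrite -expRD ler_expR -mulrDl ler_pM2r ?invr_gt0//.
by have := le_trans (ler_norm _) hx; lra.
Qed.

(* Tilting by the list c moves the mean of the deviation to the potential of c. *)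
Lemma tilted_lower_bound c (ss : seq (seq (R * R))) (delta eta : R) :
  supported unit01 c -> (forall s, s \in ss -> supported unit01 s) ->
  0 < delta -> 0 < eta ->
  \forall e \near (0:R)^'+, exists2 A, measurable A /\
    ((expR (- (2^-1 * bil q c c + delta + eta) / v e))%:E <= P A)%E &
    forall w, A w -> forall s, s \in ss ->
      lin s (deviation e w) - bil q s c <= delta.
Proof.
(* The list [c] is among the tests, so that the tilting density is at most [a] on the good event. *)
move=> cD ssD d0 eta0; pose l := c :: ss.
have lD s : s \in l -> supported unit01 s by rewrite inE => /orP[/eqP ->|/ssD].
pose N := size l; pose sel (i : 'I_N) := nth [::] l i.
have selD i : supported unit01 (sel i) by apply: lD; rewrite mem_nth.
pose S := \sum_i bil q (sel i) (sel i).
have Qge0 s : supported unit01 s -> 0 <= bil q s s by exact: kernel_psd.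
have S0 : 0 <= S by apply: sumr_ge0 => i _; exact: Qge0.
have QS i : bil q (sel i) (sel i) <= S.
  by rewrite /S (bigD1 i)//= lerDl; apply: sumr_ge0 => j _; exact: Qge0.
pose th := delta / (S + 1); have S1 : 0 < S + 1 by rewrite ltr_wpDl.
have th0 : 0 < th by rewrite divr_gt0.
have thS i : th * bil q (sel i) (sel i) <= delta.
  rewrite /th mulrAC ler_pdivrMr// ler_pM2l//; have := QS i; lra.
(* A failed test costs th delta = 4 kap; perturbing the tilt by th s brings back at most 2 kap from
   its quadratic term and [kap] from the approximation, and the comparison with [x] at most kap / 2.
   A gain of kap / 2 remains. *)
pose kap := th * delta / 4; have kap0 : 0 < kap by rewrite divr_gt0// mulr_gt0.
pose r := Num.min (kap / 2) (eta / 2).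
have kap20 : 0 < kap / 2 by rewrite divr_gt0.
have eta20 : 0 < eta / 2 by rewrite divr_gt0.
have r0 : 0 < r by rewrite lt_min kap20.
have csD i : supported unit01 (c ++ scale_list th (sel i)).
  by apply: supported_cat => //; exact: supported_scale.
have pos : \forall e \near (0 : R)^'+, 0 < e by exact: nbhs_right_gt.
pose Q (i : 'I_N) (e : R) := exists2 y : R,
    `|y - 2^-1 * bil q (c ++ scale_list th (sel i)) (c ++ scale_list th (sel i))| <= kap &
    (\int[P]_w (expR (lin (c ++ scale_list th (sel i)) (deviation e w) / v e))%:E
      = (expR (y / v e))%:E)%E.
have QF : (0 : R)^'+ [set e | forall i, i \in index_enum 'I_N -> Q i e].
  by apply: (@filter_forall_mem R (0 : R)^'+ _ 'I_N _ Q) => i _; exact: score_mgf.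
near=> e.
have e0 : 0 < e by near: e.
have ve0 := ga_v_gt0 P q mbar v U m K ga _ e0.
have [x hx hI] : exists2 x : R, `|x - 2^-1 * bil q c c| <= r &
    (\int[P]_w (expR (lin c (deviation e w) / v e))%:E = (expR (x / v e))%:E)%E.
  by near: e; exact: score_mgf.
have hy : forall i, i \in index_enum 'I_N -> Q i e by near: e; exact: QF.
have big1 : 2 * N%:R <= expR (kap / 2 / v e) by near: e; exact: expR_large.
have big2 : 2 <= expR (eta / 2 / v e) by near: e; exact: expR_large.
pose A := [set w | forall i : 'I_N, (lin (sel i) (deviation e w) - bil q (sel i) c <= delta)%R].
have mdev i : measurable_fun setT (fun w => lin (sel i) (deviation e w)).
  exact: measurable_lin_deviation.
have mA : measurable A.
  have -> : A = \bigcap_(i in [set: 'I_N]) (setT `&`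
      (fun w => lin (sel i) (deviation e w)) @^-1` `]-oo, delta + bil q (sel i) c]).
    apply/seteqP; split => w /= h i; last first.
      by have := h i I; rewrite /= in_itv/= => -[_]; lra.
    by move=> _; split => //; rewrite /= in_itv/=; have := h i; lra.
  apply: fin_bigcap_measurable => // i _; exact: mdev.
exists A; last first.
  move=> w Aw s sss; have sl : s \in l by rewrite inE sss orbT.
  have := Aw (Ordinal (etrans (index_mem s l) sl)).
  by rewrite /sel /= nth_index.
split => //.
pose g (i : 'I_N) w := expR ((lin (c ++ scale_list th (sel i)) (deviation e w) -
  th * (bil q (sel i) c + delta)) / v e).
pose f w := expR (lin c (deviation e w) / v e).
pose a := expR ((bil q c c + delta) / v e).
have mexp s (z : R) : supported unit01 s ->
    measurable_fun setT (fun w => expR ((lin s (deviation e w) - z) / v e)).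
  move=> sD; apply: measurableT_comp => //; apply: measurable_funM => //.
  by apply: measurable_funB => //; exact: measurable_lin_deviation.
have mf : measurable_fun setT f.
  by have := mexp c 0 cD; rewrite /f; under eq_fun do rewrite subr0.
have fg w : f w <= a * \1_A w + \sum_i g i w.
  have gs : 0 <= \sum_i g i w by apply: sumr_ge0 => i _; exact: expR_ge0.
  rewrite indicE; have [/set_mem Aw|/negP nA] := boolP (w \in A).
    rewrite mulr1 ler_wpDr// /f /a ler_expR ler_pM2r ?invr_gt0//.
    have := Aw ord0; rewrite /sel /=; lra.
  rewrite mulr0 add0r.
  (* Off [A] some test exceeds its bound, and the tilting density is then dominated by the one
     perturbed along that test. *)
  have [i hi] : exists i : 'I_N, delta < lin (sel i) (deviation e w) - bil q (sel i) c.
    apply: contrapT => ne; apply: nA; apply: mem_set => i; rewrite leNgt; apply/negP => hi.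
    by apply: ne; exists i.
  rewrite (bigD1 i)//= ler_wpDr//; first by apply: sumr_ge0 => j _; exact: expR_ge0.
  rewrite /f /g ler_expR ler_pM2r ?invr_gt0// lin_cat lin_scale.
  rewrite -addrA lerDl -mulrBr mulr_ge0 ?(ltW th0)//; lra.
have := integral_le_indic_sum P N A f g a mA (expR_ge0 _) mf (fun w => expR_ge0 _)
  (fun i => mexp _ _ (csD i)) (fun i w => expR_ge0 _) fg.
have hg i : (\int[P]_w (g i w)%:E <= (expR ((x - kap / 2) / v e))%:E)%E.
  have [y hy1 hy2] := hy i (mem_index_enum i).
  have m1 : measurable_fun setT (fun w =>
      (expR (lin (c ++ scale_list th (sel i)) (deviation e w) / v e))%:E).
    have := mexp _ 0 (csD i); under eq_fun do rewrite subr0.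
    by move=> ?; exact/measurable_EFinP.
  have p1 (w : Omega) : setT w -> (0 <= (expR (lin (c ++ scale_list th (sel i))
      (deviation e w) / v e))%:E)%E by rewrite lee_fin expR_ge0.
  have hz := ge0_integralZl_EFin P measurableT p1 m1
    (expR_ge0 (- (th * (bil q (sel i) c + delta)) / v e)).
  have -> : (\int[P]_w (g i w)%:E = \int[P]_w ((expR (- (th * (bil q (sel i) c + delta)) / v e))%:E *
      (expR (lin (c ++ scale_list th (sel i)) (deviation e w) / v e))%:E))%E.
    by apply: eq_integral => w _; rewrite -EFinM -expRD /g -mulrDl [in RHS]addrC.
  rewrite [leLHS]hz hy2 -EFinM -expRD lee_fin ler_expR -mulrDl ler_pM2r ?invr_gt0//.
  move: hy1; rewrite (bil_add_scale unit01) ?(bil_sym unit01 q c)//; try exact: kernel_sym.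
  move=> /(le_trans (ler_norm _)) hy1.
  have rk : r <= kap / 2 by rewrite ge_min lexx.
  have hx1 : - r <= x - 2^-1 * bil q c c by move: hx; rewrite ler_norml => /andP[].
  have h2 : 2^-1 * th ^+ 2 * bil q (sel i) (sel i) <= 2 * kap.
    have -> : 2^-1 * th ^+ 2 * bil q (sel i) (sel i) =
      2^-1 * (th * (th * bil q (sel i) (sel i))) by ring.
    by have := ler_wpM2l (ltW th0) (thS i); rewrite /kap; lra.
  have h4 : th * delta = 4 * kap by rewrite /kap; lra.
  rewrite mulrDr h4; move: hy1 h2; lra.
rewrite hI => /le_trans /(_ (leeD2l _ (lee_sum _ (fun i _ => hg i)))).
have pf : P A \is a fin_num by exact: fin_num_measure.
rewrite -(fineK pf) -EFinM sumEFin -EFinD !lee_fin sumr_const card_ord.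
move: (fine (P A)) => p h.
(* The [N] error terms together carry at most half of the integral, so the good event carries the
   other half. *)
have h1 : expR (x / v e) <= 2 * (a * p).
  have E : expR ((x - kap / 2) / v e) * expR (kap / 2 / v e) = expR (x / v e).
    by rewrite -expRD -mulrDl subrK.
  have h2 : 2 * (expR ((x - kap / 2) / v e) *+ N) <= expR (x / v e).
    by rewrite -E -(mulr_natr (expR _) N) mulrCA ler_pM2l ?expR_gt0.
  lra.
rewrite -(ler_pM2l (expR_gt0 ((bil q c c + delta) / v e))).
rewrite -(@ler_pM2l _ 2)//; apply: le_trans h1.
apply: (@le_trans _ _ (expR (eta / 2 / v e) *
  (expR ((bil q c c + delta) / v e) *
   expR (- (2^-1 * bil q c c + delta + eta) / v e)))).
  by rewrite ler_pM2r// mulr_gt0 ?expR_gt0.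
rewrite -!expRD ler_expR -!mulrDl ler_pM2r ?invr_gt0//.
have rk : r <= eta / 2 by rewrite ge_min lexx orbT.
have hx1 : - r <= x - 2^-1 * bil q c c by move: hx; rewrite ler_norml => /andP[].
lra.
Unshelve. all: by end_near. Qed.

End gaussian_large_deviations.

(** * Upper and lower bounds for closed and open sets *)

Section gaussian_LDP.
Context {R : realType} {d : measure_display} {Omega : measurableType d}.
Context (P : probability Omega R).
Variables (q : R -> R -> R) (mbar : R -> R) (v : R -> R).
Variables (U : R -> Omega -> C01 R) (m : R -> R -> R) (K : R -> R -> R -> R).
Hypothesis ga : gaussian_asymptotics P q mbar v U m K.

Let qK : cov_kernel q := ga_kernel P q mbar v U m K ga.
Let mbarc : unif_cont1 mbar := ga_mbar P q mbar v U m K ga.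

Let rate : C01 R -> \bar R := rkhs_rate q (mbar \o val).

Lemma rate_level (h : C01 R) (b : R) :
  (rate h <= b%:E)%E <-> rate_le q b (fun t => extend (C01_fun h) t - mbar t).
Proof.
have cm : continuous (mbar \o val : unit_itv R -> R).
  by apply: osc_unif_cont1 => e e0; have [r r0 hr] := mbarc e e0; exists r.
apply: (iff_trans (rkhs_rate_le q qK _ h b cm)); apply: eq_rate_le => t tD.
by rewrite /extend /= clamp01_id.
Qed.

Lemma rate_real_or_infinite (h : C01 R) : rate h = +oo%E \/ exists b : R, rate h = b%:E.
Proof. by rewrite /rate /rkhs_rate; case: ifP => _; [right; eexists|left]. Qed.

Lemma measurable_open_event (e : R) (G : set (C01 R)) : 0 < e -> open G ->
  measurable (U e @^-1` G).
Proof.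
move=> e0; apply: measurable_path_open => t tD.
exact: (ga_measurable P q mbar v U m K ga).
Qed.

Lemma measurable_closed_event (e : R) (F : set (C01 R)) : 0 < e -> closed F ->
  measurable (U e @^-1` F).
Proof.
move=> e0 cF; rewrite -[F]setCK preimage_setC; apply: measurableC.
by apply: (measurable_open_event e (~` F) e0); exact: closed_openC.
Qed.

Lemma closed_event_bound (F : set (C01 R)) (b eta : R) : closed F -> 0 < eta ->
  (forall h, F h -> (b%:E < rate h)%E) ->
  \forall e \near (0:R)^'+, (P (U e @^-1` F) <= (expR ((- b + eta) / v e))%:E)%E.
Proof.
move=> cF eta0 Fb.
have nF h : F h -> ~ rate_le q b (fun t => extend (C01_fun h) t - mbar t).
  by move=> /Fb; rewrite ltNge => /negP hb /rate_level.
have [delta0 d00 sep] := level_set_separation q mbar b F qK mbarc cF nF.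
(* Two paths of oscillation [delta] that are [delta]-close at the nodes are 3 delta apart at most,
   which must stay within the separation distance. *)
pose delta := Num.min 1 (delta0 / 3).
have d30 : 0 < delta0 / 3 by rewrite divr_gt0.
have d0 : 0 < delta by rewrite lt_min ltr01.
have d1 : delta <= 1 by rewrite ge_min lexx.
have d3 : 3 * delta <= delta0.
  have : delta <= delta0 / 3 by rewrite ge_min lexx orbT.
  lra.
have [h h0 hosc] := oscillation_tail P q mbar v U m K ga b delta d0.
have sep3 (f : R -> R) (g : C01 R) : F g -> rate_le q b (fun t => f t - mbar t) ->
    ~ (forall t, unit01 t -> `|f t - extend (C01_fun g) t| <= 3 * delta).
  move=> Fg fK fg; apply: (sep f g Fg fK) => t tD; exact: le_trans (fg t tD) d3.
have [ss ssD cover] := finite_score_cover q mbar b delta h F qK mbarc d0 d1 h0 sep3.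
have eta20 : 0 < eta / 2 by rewrite divr_gt0.
pose Q (s : seq (R * R)) (e : R) :=
    measurable [set w | (b < score q (deviation mbar U e w) s)%R] /\
    (P [set w | (b < score q (deviation mbar U e w) s)%R] <=
      (expR (- (b - eta / 2) / v e))%:E)%E.
have QF : (0 : R)^'+ [set e | forall s, s \in ss -> Q s e].
  apply: (@filter_forall_mem R (0 : R)^'+ _ _ ss Q) => s sss.
  exact: (score_tail P q mbar v U m K ga s b _ (ssD s sss) eta20).
have pos : \forall e \near (0 : R)^'+, 0 < e by exact: nbhs_right_gt.
near=> e.
have e0 : 0 < e by near: e.
have ve0 := ga_v_gt0 P q mbar v U m K ga _ e0.
have hs : forall s, s \in ss -> Q s e by near: e; exact: QF.
have [B [mB PB] hB] : exists2 B, measurable B /\ (P B <= (expR (- (b / v e)))%:E)%E &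
    forall w, ~ B w -> osc_le h delta (path U e w) by near: e; exact: hosc.
have large : ((size ss).+1%:R : R) <= expR (eta / 2 / v e).
  by near: e; exact: (expR_large P q mbar v U m K ga).
(* [None] stands for the event of large oscillation, bounded together with the score events. *)
pose E (i : option (seq (R * R))) :=
  if i is Some s then [set w | (b < score q (deviation mbar U e w) s)%R] else B.
have mF := measurable_closed_event e F e0 cF.
have h1 : forall i, i \in None :: map Some ss -> measurable (E i) /\
    (P (E i) <= (expR ((- b + eta / 2) / v e))%:E)%E.
  move=> [s|]; rewrite inE /=.
    move=> /mapP[s' s'ss [->]].
    by have [? ?] := hs s' s'ss; split => //; rewrite addrC -opprB.
  move=> _; split => //; apply: (le_trans PB); rewrite lee_fin ler_expR -mulNr.
  by rewrite ler_pM2r ?invr_gt0//; lra.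
have h2 : forall w, (U e @^-1` F) w -> exists2 i, i \in None :: map Some ss & E i w.
  move=> w Fw; have [Bw|nB] := pselect (B w); first by exists None => //; rewrite mem_head.
  have [s sss hw] := cover _ Fw (hB w nB).
  by exists (Some s) => //; rewrite inE /= map_f.
have := probability_cover P _ _ E _ mF h1 h2.
move=> /le_trans; apply; rewrite lee_fin /= size_map.
(* Half of [eta] is the error of each event, and the other half absorbs their number. *)
have -> : (- b + eta) / v e = eta / 2 / v e + (- b + eta / 2) / v e.
  by rewrite -mulrDl; congr (_ * _); lra.
by rewrite expRD ler_pM2r ?expR_gt0.
Unshelve. all: by end_near. Qed.

Lemma open_event_bound (G : set (C01 R)) (h : C01 R) (b eta : R) : open G -> G h ->
  (rate h <= b%:E)%E -> 0 < eta ->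
  \forall e \near (0:R)^'+, ((expR ((- b - eta) / v e))%:E <= P (U e @^-1` G))%E.
Proof.
move=> oG Gh /rate_level hb eta0.
have [r r0 hr] : exists2 r : R, 0 < r &
    forall g : C01 R, (forall t, `|C01_fun h t - C01_fun g t| < r) -> G g.
  by apply/C01_nbhsP; apply: open_nbhs_nbhs.
(* The parts of [eta] pay for the energy of the interpolating list, for [delta], for the tilting
   error and for a factor 2; the last one is slack. *)
pose eta5 := eta / 5; have eta50 : 0 < eta5 by rewrite divr_gt0.
(* At the nodes the path is within 2 delta of [h], hence within 6 delta everywhere, and 7 makes the
   inequality strict. *)
pose delta := Num.min eta5 (r / 7).
have r70 : 0 < r / 7 by rewrite divr_gt0.
have d0 : 0 < delta by rewrite lt_min eta50.
have dr : 7 * delta <= r.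
  have : delta <= r / 7 by rewrite ge_min lexx orbT.
  lra.
have de : delta <= eta5 by rewrite ge_min lexx.
have hb' : forall s, supported unit01 s ->
    score q (fun t => extend (C01_fun h) t - mbar t) s <= b + eta5 - eta5.
  by move=> s sD; rewrite addrK; exact: hb.
have [c [cD Qc pc]] := rate_le_interpolation q qK unit01 _ _ _ _
  (@subset_refl _ _) eta50 d0 hb'.
(* At level b + eta the event of large oscillation is negligible against the lower bound obtained by
   tilting. *)
have [h1 h10 hosc] := oscillation_tail P q mbar v U m K ga (b + eta) delta d0.
have hh : unif_cont1 (extend (C01_fun h)).
  by apply: continuous_extend; exact: continuous_C01.
have [h2 h20 hhosc] := hh _ d0.
have hm : 0 < Num.min h1 h2 by rewrite lt_min h10.
have [n hn] := harmonic_lt _ hm; have {}hn := hn n (leqnn n).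
(* The tests are one-sided, so both signs of each Dirac mass are needed to bound the absolute
   value. *)
pose ss : seq (seq (R * R)) := [seq [:: (1, node n j)] | j <- iota 0 n.+2] ++
  [seq [:: (-1, node n j)] | j <- iota 0 n.+2].
have ssD s : s \in ss -> supported unit01 s.
  rewrite mem_cat => /orP[] /mapP[j]; rewrite mem_iota => /= jn ->;
  by apply: supported1; exact: node_unit01.
have low := tilted_lower_bound P q mbar v U m K ga c ss delta eta5 cD ssD d0 eta50.
have pos : \forall e \near (0 : R)^'+, 0 < e by exact: nbhs_right_gt.
near=> e.
have e0 : 0 < e by near: e.
have ve0 := ga_v_gt0 P q mbar v U m K ga _ e0.
have [B [mB PB] hB] : exists2 B, measurable B /\ (P B <= (expR (- ((b + eta) / v e)))%:E)%E &
    forall w, ~ B w -> osc_le h1 delta (path U e w) by near: e; exact: hosc.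
have [A [mA PA] hA] : exists2 A, measurable A /\
    ((expR (- (2^-1 * bil q c c + delta + eta5) / v e))%:E <= P A)%E &
    forall w, A w -> forall s, s \in ss ->
      lin s (deviation mbar U e w) - bil q s c <= delta by near: e; exact: low.
have large : (2 : R) <= expR (eta5 / v e).
  by near: e; exact: (expR_large P q mbar v U m K ga).
have mG := measurable_open_event e G e0 oG.
have AB : A `<=` U e @^-1` G `|` B.
  move=> w Aw; have [Bw|nB] := pselect (B w); [by right|left].
  apply: hr => t; rewrite -(extend_val (C01_fun h)) -(extend_val (C01_fun (U e w))).
  have o1 : osc_le (Num.min h1 h2) (2 * delta) (extend (C01_fun h)).
    move=> x y xD yD; rewrite le_min => /andP[_ xy].
    by apply: (le_trans (hhosc _ _ xD yD xy)); lra.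
  have o2 : osc_le (Num.min h1 h2) (2 * delta) (path U e w).
    move=> x y xD yD; rewrite le_min => /andP[xy _].
    by apply: (le_trans (hB w nB _ _ xD yD xy)); lra.
  apply: le_lt_trans (osc_le_close _ _ _ _ n hn o1 o2 _ _ (val_unit01 t)) _; last by lra.
  move=> j jn; have nD : unit01 (node n j : R) by exact: node_unit01.
  have jm : j \in iota 0 n.+2 by rewrite mem_iota.
  have h3 := hA w Aw [:: (1, node n j)]; have h4 := hA w Aw [:: (-1, node n j)].
  have s3 : [:: (1, node n j)] \in ss.
    by rewrite mem_cat (map_f (fun j => [:: (1, node n j)]) jm).
  have s4 : [:: (-1, node n j)] \in ss.
    by rewrite mem_cat (map_f (fun j => [:: (-1, node n j)]) jm) orbT.
  have := pc _ nD; move: (h3 s3) (h4 s4).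
  rewrite /bil !lin_cons !lin_nil /= /deviation /potential !ler_norml.
  move: (lin c (q _)) (path U e w _) (extend _ _) (mbar _) => x1 x2 x3 x4.
  by move=> h5 h6 /andP[h7 h8]; apply/andP; split; lra.
have mU := measureU2 P mG mB.
have : (P A <= P (U e @^-1` G) + P B)%E.
  by apply: (le_trans _ mU); apply: le_measure; rewrite ?inE//; exact: measurableU.
move=> /(le_trans PA) /le_trans /(_ (leeD2l _ PB)).
have pf : P (U e @^-1` G) \is a fin_num by exact: fin_num_measure.
rewrite -(fineK pf) -EFinD !lee_fin; move: (fine _) => p hp.
have x1 : expR (- (2^-1 * bil q c c + delta + eta5) / v e) >=
    expR (eta5 / v e) * expR (- (b + 4 * eta5) / v e).
  by rewrite -expRD -mulrDl ler_expR ler_pM2r ?invr_gt0//; lra.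
have x2 : expR (- ((b + eta) / v e)) <= expR (- (b + 4 * eta5) / v e).
  rewrite -mulNr ler_expR ler_pM2r ?invr_gt0// /eta5; lra.
have x3 : 2 * expR (- (b + 4 * eta5) / v e) <= expR (eta5 / v e) * expR (- (b + 4 * eta5) / v e).
  by rewrite ler_pM2r ?expR_gt0.
have x4 : expR ((- b - eta) / v e) = expR (- ((b + eta) / v e)).
  by congr expR; ring.
rewrite x4; lra.
Unshelve. all: by end_near. Qed.

Theorem gaussian_LDP : satisfies_LDP P U v rate.
Proof.
have pos : \forall e \near (0 : R)^'+, 0 < e by exact: nbhs_right_gt.
split.
- exact: (ga_v_cvg P q mbar v U m K ga).
- move=> e e0 G; exact: measurable_open_event.
- move=> b; have := rate_le_compact q mbar b qK mbarc; congr compact.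
  by apply/seteqP; split => h /= /rate_level.
- move=> G oG; rewrite leeNl; apply: le_ereal_inf_tmp => _ [h Gh <-].
  have [->|[b hb]] := rate_real_or_infinite h; first exact: leey.
  rewrite leeNl hb; apply/lee_addgt0Pr => eta eta0.
  rewrite -leeBlDr// -EFinN -EFinB; apply: limf_einf_ge_near.
  have hb' : (rate h <= b%:E)%E by rewrite hb.
  apply: filterS2 (open_event_bound G h b eta oG Gh hb' eta0) pos => e hP e0.
  by apply: scaled_lne_ge => //; exact: (ga_v_gt0 P q mbar v U m K ga).
- move=> F cF; apply: le_oppe_dense => b hb; apply/lee_addgt0Pr => eta eta0.
  rewrite -EFinD; apply: limf_esup_le_near.
  have Fb h : F h -> (b%:E < rate h)%E.
    by move=> Fh; apply: (lt_le_trans hb); apply: ereal_inf_lbound; exists h.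
  apply: filterS2 (closed_event_bound F b eta cF eta0 Fb) pos => e hP e0.
  apply: scaled_lne_le => //; first exact: (ga_v_gt0 P q mbar v U m K ga).
Qed.

End gaussian_LDP.

(** * Uniform convergence as e tends to 0 *)

Section uniform_convergence.
Context {R : realType}.

Definition ucvg {I : Type} (D : set I) (F : R -> I -> R) (f : I -> R) : Prop :=
  forall r : R, 0 < r -> \forall e \near (0:R)^'+, forall i, D i -> `|F e i - f i| <= r.

Definition bounded_on {I : Type} (D : set I) (f : I -> R) : Prop :=
  exists2 M : R, 0 < M & forall i, D i -> `|f i| <= M.

Lemma near_ex2 (Q1 Q2 : set R) : (0 : R)^'+ Q1 -> (0 : R)^'+ Q2 ->
  exists e, Q1 e /\ Q2 e.
Proof.
move=> h1 h2; have h := @filterI _ _ (at_right_proper_filter (0 : R)) _ _ h1 h2.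
by have [e [? ?]] := @filter_ex _ _ (at_right_proper_filter (0 : R)) _ h; exists e.
Qed.

Context {I : Type} (D : set I).
Implicit Types (F G : R -> I -> R) (f g : I -> R).

Lemma ucvg_cst f : ucvg D (fun=> f) f.
Proof. by move=> r r0; apply: nearW => e i Di; rewrite subrr normr0 ltW. Qed.

Lemma ucvg_near F G f : (\forall e \near (0:R)^'+, forall i, D i -> F e i = G e i) ->
  ucvg D F f -> ucvg D G f.
Proof.
move=> FG Ff r r0; apply: filterS2 FG (Ff r r0) => e h1 h2 i Di.
by rewrite -h1//; exact: h2.
Qed.

Lemma eq_ucvg F f g : (forall i, D i -> f i = g i) -> ucvg D F f -> ucvg D F g.
Proof.
by move=> fg Ff r r0; apply: filterS (Ff r r0) => e h i Di; rewrite -fg//; exact: h.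
Qed.

Lemma ucvg_reindex {J : Type} (D' : set J) (u : J -> I) F f :
  (forall j, D' j -> D (u j)) -> ucvg D F f ->
  ucvg D' (fun e j => F e (u j)) (fun j => f (u j)).
Proof.
by move=> hu Ff r r0; apply: filterS (Ff r r0) => e h j Dj; apply: h; exact: hu.
Qed.

Lemma ucvgD F G f g : ucvg D F f -> ucvg D G g ->
  ucvg D (fun e i => F e i + G e i) (fun i => f i + g i).
Proof.
move=> Ff Gg r r0; have r20 : 0 < r / 2 by rewrite divr_gt0.
apply: filterS2 (Ff _ r20) (Gg _ r20) => e h1 h2 i Di.
have := h1 i Di; have := h2 i Di; rewrite !ler_norml => /andP[? ?] /andP[? ?].
by apply/andP; split; lra.
Qed.

Lemma ucvgN F f : ucvg D F f -> ucvg D (fun e i => - F e i) (fun i => - f i).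
Proof.
move=> Ff r r0; apply: filterS (Ff _ r0) => e h i Di.
by rewrite -opprD normrN; exact: h.
Qed.

Lemma ucvgB F G f g : ucvg D F f -> ucvg D G g ->
  ucvg D (fun e i => F e i - G e i) (fun i => f i - g i).
Proof. by move=> Ff Gg; apply: ucvgD => //; exact: ucvgN. Qed.

Lemma ucvgM F G f g : bounded_on D f -> bounded_on D g -> ucvg D F f -> ucvg D G g ->
  ucvg D (fun e i => F e i * G e i) (fun i => f i * g i).
Proof.
move=> [M M0 fM] [N N0 gN] Ff Gg r r0.
pose a := Num.min 1 (r / (2 * (N + 1))); pose b := r / (2 * M).
have N1 : 0 < N + 1 by rewrite ltr_wpDl// ltW.
have aN : 0 < r / (2 * (N + 1)) by rewrite divr_gt0// mulr_gt0.
have a0 : 0 < a by rewrite lt_min ltr01.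
have b0 : 0 < b by rewrite divr_gt0// mulr_gt0.
apply: filterS2 (Ff _ a0) (Gg _ (_ : 0 < Num.min 1 b)) => [e h1 h2 i Di|]; last first.
  by rewrite lt_min ltr01.
have x1 := h1 i Di; have := h2 i Di; rewrite le_min => /andP[x2 x3].
have -> : F e i * G e i - f i * g i = (F e i - f i) * G e i + f i * (G e i - g i) by ring.
have y1 : `|G e i| <= N + 1.
  have := ler_normD (G e i - g i) (g i); rewrite subrK; have := gN i Di; lra.
have y2 := fM i Di.
have z1 : `|(F e i - f i) * G e i| <= r / 2.
  rewrite normrM; apply: (@le_trans _ _ (r / (2 * (N + 1)) * (N + 1))).
    by apply: ler_pM => //; apply: (le_trans x1); rewrite ge_min lexx orbT.
  by rewrite le_eqVlt; apply/orP; left; apply/eqP; field; rewrite gt_eqF.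
have z2 : `|f i * (G e i - g i)| <= r / 2.
  rewrite normrM; apply: (@le_trans _ _ (M * b)); first exact: ler_pM.
  by rewrite /b le_eqVlt; apply/orP; left; apply/eqP; field; rewrite gt_eqF.
apply: (le_trans (ler_normD _ _)); lra.
Qed.

Lemma ucvgZ F f (a : R) : ucvg D F f -> ucvg D (fun e i => a * F e i) (fun i => a * f i).
Proof.
move=> Ff r r0; have a0 : 0 < `|a| + 1 by rewrite ltr_wpDl.
apply: filterS (Ff _ (divr_gt0 r0 a0)) => e h i Di.
rewrite -mulrBr normrM; apply: (@le_trans _ _ (`|a| * (r / (`|a| + 1)))).
  by apply: ler_wpM2l => //; exact: h.
by rewrite mulrCA ler_piMr ?(ltW r0)// ler_pdivrMr// mul1r lerDl.
Qed.

Lemma ucvg_sum {J : eqType} (s : seq J) (F : J -> R -> I -> R) (f : J -> I -> R) :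
  (forall j, j \in s -> ucvg D (F j) (f j)) ->
  ucvg D (fun e i => \sum_(j <- s) F j e i) (fun i => \sum_(j <- s) f j i).
Proof.
elim: s => [|j s ih] h.
  apply: (@ucvg_near (fun=> fun=> 0)).
    by apply: nearW => e i _; rewrite big_nil.
  by apply: eq_ucvg (ucvg_cst (fun=> 0)) => i _; rewrite big_nil.
have hj := h j (mem_head _ _).
have hs : forall j, j \in s -> ucvg D (F j) (f j).
  by move=> j' j's; apply: h; rewrite inE j's orbT.
apply: (@ucvg_near (fun e i => F j e i + \sum_(j <- s) F j e i)).
  by apply: nearW => e i _; rewrite big_cons.
by apply: eq_ucvg (ucvgD _ _ _ _ hj (ih hs)) => i _; rewrite big_cons.
Qed.

Lemma ucvg_lin s (F : R -> I -> R -> R) (f : I -> R -> R) :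
  (forall p, p \in s -> ucvg D (fun e i => F e i p.2) (fun i => f i p.2)) ->
  ucvg D (fun e i => lin s (F e i)) (fun i => lin s (f i)).
Proof. by move=> h; apply: ucvg_sum => p ps; apply: ucvgZ; exact: h. Qed.

Lemma bounded_onM f g : bounded_on D f -> bounded_on D g ->
  bounded_on D (fun i => f i * g i).
Proof.
move=> [M M0 fM] [N N0 gN]; exists (M * N); first exact: mulr_gt0.
by move=> i Di; rewrite normrM; apply: ler_pM => //; [exact: fM|exact: gN].
Qed.

Lemma bounded_onZ (a : R) f : bounded_on D f -> bounded_on D (fun i => a * f i).
Proof.
move=> bf; apply: bounded_onM => //; exists (`|a| + 1); first by rewrite ltr_wpDl.
by move=> i _; rewrite lerDl.
Qed.

Lemma ucvgV F f (a : R) : 0 < a -> (forall i, D i -> a <= f i) -> ucvg D F f ->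
  ucvg D (fun e i => (F e i)^-1) (fun i => (f i)^-1).
Proof.
move=> a0 fa Ff r r0; pose b := Num.min (a / 2) (r * (a * (a / 2))).
have a20 : 0 < a / 2 by rewrite divr_gt0.
have b0 : 0 < b by rewrite lt_min a20 !mulr_gt0.
apply: filterS (Ff _ b0) => e h i Di; have := h i Di.
rewrite le_min => /andP[h1 h2]; have f1 := fa i Di.
have F1 : a / 2 <= F e i by move: h1; rewrite ler_norml => /andP[? _]; lra.
have F0 : 0 < F e i by lra.
have f0 : 0 < f i by lra.
have -> : (F e i)^-1 - (f i)^-1 = (f i - F e i) / (f i * F e i).
  by field; rewrite !gt_eqF.
rewrite normrM normfV (gtr0_norm (mulr_gt0 f0 F0)) ler_pdivrMr ?mulr_gt0//.
rewrite distrC; apply: (le_trans h2); rewrite ler_pM2l//.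
by apply: ler_pM => //; exact: ltW.
Qed.

Lemma ucvg_cvg F f i : D i -> ucvg D F f -> F e i @[e --> (0:R)^'+] --> f i.
Proof.
move=> Di Ff; apply/cvgrPdist_le => r r0; apply: filterS (Ff r r0) => e h.
by rewrite distrC; exact: h.
Qed.

Lemma ucvg_unique F f g i : D i -> ucvg D F f -> ucvg D F g -> f i = g i.
Proof.
move=> Di Ff Fg; have c1 := ucvg_cvg F f i Di Ff; have c2 := ucvg_cvg F g i Di Fg.
by rewrite -(cvg_lim (@Rhausdorff R) c1) -(cvg_lim (@Rhausdorff R) c2).
Qed.

Lemma ucvg_bounded F f : ucvg D F f ->
  (\forall e \near (0:R)^'+, bounded_on D (F e)) -> bounded_on D f.
Proof.
move=> Ff Fb; have [e [[M M0 hM] he]] := near_ex2 _ _ Fb (Ff 1 ltr01).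
exists (M + 1); first by rewrite ltr_wpDl// ltW.
move=> i Di; have := he i Di; have := hM i Di.
by rewrite !ler_norml => /andP[? ?] /andP[? ?]; apply/andP; split; lra.
Qed.

Lemma ereal_sup_small {J : Type} (E : set J) (F : R -> J -> R) :
  (ereal_sup [set (F e j)%:E | j in E] @[e --> (0:R)^'+] --> 0%E)%E ->
  forall r : R, 0 < r -> \forall e \near (0:R)^'+, forall j, E j -> F e j <= r.
Proof.
move=> h r r0; have h1 : nbhs (0%E : \bar R) [set x | (x < r%:E)%E].
  by apply: open_ereal_lt'; rewrite lte_fin.
have h2 : \forall e \near (0:R)^'+,
    (ereal_sup [set (F e j)%:E | j in E] < r%:E)%E := h _ h1.
apply: filterS h2 => e /= he j Ej; rewrite -lee_fin.
by apply: (le_trans _ (ltW he)); apply: ereal_sup_ubound; exists j.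
Qed.

Lemma powR_ucvg (r : R) (f : I -> R) : 0 < r -> ucvg D (fun e _ => e `^ r) (fun=> 0).
Proof.
move=> r0 s s0; have h0 : 0 < s `^ r^-1 by rewrite powR_gt0.
have pos : \forall e \near (0 : R)^'+, 0 < e by exact: nbhs_right_gt.
have lt : \forall e \near (0 : R)^'+, e < s `^ r^-1 by exact: nbhs_right_lt.
apply: filterS2 pos lt => e e0 es i _.
rewrite subr0 ger0_norm ?powR_ge0//.
have -> : s = (s `^ r^-1) `^ r by rewrite -powRrM mulVf ?gt_eqF// powRr1// ltW.
apply: ge0_ler_powR; rewrite ?nnegrE; exact: ltW.
Qed.

End uniform_convergence.

(** * Stability of uniform continuity *)

Section modulus_algebra.
Context {R : realType}.
Implicit Types (f g : R -> R) (q : R -> R -> R).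

Lemma unif_cont1_cst (a : R) : unif_cont1 (fun=> a).
Proof. by move=> e e0; exists 1 => // t u _ _ _; rewrite subrr normr0 ltW. Qed.

Lemma unif_cont1_id : unif_cont1 (fun t : R => t).
Proof. by move=> e e0; exists e. Qed.

Lemma unif_cont1D f g : unif_cont1 f -> unif_cont1 g -> unif_cont1 (fun t => f t + g t).
Proof.
move=> cf cg e e0; have e20 : 0 < e / 2 by rewrite divr_gt0.
have [h1 h10 hf] := cf _ e20; have [h2 h20 hg] := cg _ e20.
exists (Num.min h1 h2); first by rewrite lt_min h10.
move=> t u tD uD; rewrite le_min => /andP[tu1 tu2].
have := hf t u tD uD tu1; have := hg t u tD uD tu2.
by rewrite !ler_norml => /andP[? ?] /andP[? ?]; apply/andP; split; lra.
Qed.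

Lemma unif_cont1Z (a : R) f : unif_cont1 f -> unif_cont1 (fun t => a * f t).
Proof.
move=> cf e e0; have a0 : 0 < `|a| + 1 by rewrite ltr_wpDl.
have [h h0 hf] := cf _ (divr_gt0 e0 a0); exists h => // t u tD uD tu.
rewrite -mulrBr normrM; apply: (@le_trans _ _ (`|a| * (e / (`|a| + 1)))).
  by apply: ler_wpM2l => //; exact: hf.
by rewrite mulrCA ler_piMr ?(ltW e0)// ler_pdivrMr// mul1r lerDl.
Qed.

Lemma unif_cont1B f g : unif_cont1 f -> unif_cont1 g -> unif_cont1 (fun t => f t - g t).
Proof.
move=> cf cg; under eq_fun do rewrite -mulN1r.
by apply: unif_cont1D => //; exact: unif_cont1Z.
Qed.

Lemma unif_cont1_lin s (F : R -> R -> R) : (forall p, p \in s -> unif_cont1 (F^~ p.2)) ->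
  unif_cont1 (fun t => lin s (F t)).
Proof.
elim: s => [|p s ih] h.
  by under eq_fun do rewrite lin_nil; exact: unif_cont1_cst.
under eq_fun do rewrite lin_cons; apply: unif_cont1D.
  by apply: unif_cont1Z; apply: h; rewrite mem_head.
by apply: ih => p' p's; apply: h; rewrite inE p's orbT.
Qed.

Lemma unif_cont2D q q' : unif_cont2 q -> unif_cont2 q' ->
  unif_cont2 (fun t u => q t u + q' t u).
Proof.
move=> cf cg e e0; have e20 : 0 < e / 2 by rewrite divr_gt0.
have [h1 h10 hf] := cf _ e20; have [h2 h20 hg] := cg _ e20.
exists (Num.min h1 h2); first by rewrite lt_min h10.
move=> t t' u u' tD t'D uD u'D; rewrite !le_min => /andP[a1 a2] /andP[b1 b2].
have := hf _ _ _ _ tD t'D uD u'D a1 b1; have := hg _ _ _ _ tD t'D uD u'D a2 b2.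
by rewrite !ler_norml => /andP[? ?] /andP[? ?]; apply/andP; split; lra.
Qed.

Lemma unif_cont2_tensor f g : unif_cont1 f -> unif_cont1 g ->
  unif_cont2 (fun t u => f t * g u).
Proof.
move=> cf cg e e0; have [M M0 fM] := unif_cont1_bounded _ cf.
have [N N0 gN] := unif_cont1_bounded _ cg.
have e1 : 0 < e / (2 * N) by rewrite divr_gt0// mulr_gt0.
have e2 : 0 < e / (2 * M) by rewrite divr_gt0// mulr_gt0.
have [h1 h10 hf] := cf _ e1; have [h2 h20 hg] := cg _ e2.
exists (Num.min h1 h2); first by rewrite lt_min h10.
move=> t t' u u' tD t'D uD u'D; rewrite !le_min => /andP[a1 _] /andP[_ b2].
have -> : f t * g u - f t' * g u' = (f t - f t') * g u + f t' * (g u - g u') by ring.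
have z1 : `|(f t - f t') * g u| <= e / 2.
  rewrite normrM; apply: (@le_trans _ _ (e / (2 * N) * N)).
    by apply: ler_pM => //; [exact: hf|exact: gN].
  by rewrite le_eqVlt; apply/orP; left; apply/eqP; field; rewrite gt_eqF.
have z2 : `|f t' * (g u - g u')| <= e / 2.
  rewrite normrM; apply: (@le_trans _ _ (M * (e / (2 * M)))).
    by apply: ler_pM => //; [exact: fM|exact: hg].
  by rewrite le_eqVlt; apply/orP; left; apply/eqP; field; rewrite gt_eqF.
apply: (le_trans (ler_normD _ _)); lra.
Qed.

Lemma unif_cont2Z (a : R) q : unif_cont2 q -> unif_cont2 (fun t u => a * q t u).
Proof.
move=> cf e e0; have a0 : 0 < `|a| + 1 by rewrite ltr_wpDl.
have [h h0 hf] := cf _ (divr_gt0 e0 a0); exists h => // t t' u u' tD t'D uD u'D tt uu.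
rewrite -mulrBr normrM; apply: (@le_trans _ _ (`|a| * (e / (`|a| + 1)))).
  by apply: ler_wpM2l => //; exact: hf.
by rewrite mulrCA ler_piMr ?(ltW e0)// ler_pdivrMr// mul1r lerDl.
Qed.

(** The source of continuity for the limit kernel: it is a uniform limit of continuous covariances,
    compared at one well chosen [e]. *)
Lemma ucvg_unif_cont2 (F : R -> R * R -> R) q :
  ucvg (unit01 `*` unit01) F (fun p => q p.1 p.2) ->
  (\forall e \near (0:R)^'+, unif_cont2 (fun t u => F e (t, u))) -> unif_cont2 q.
Proof.
move=> Fq Fc r r0; have r30 : 0 < r / 3 by rewrite divr_gt0.
have [e [ce he]] := near_ex2 _ _ Fc (Fq _ r30).
have [h' h'0 hh] := ce _ r30; exists h' => // t t' u u' tD t'D uD u'D tt uu.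
have x1 := hh _ _ _ _ tD t'D uD u'D tt uu.
have x2 := he (t, u) (conj tD uD); have x3 := he (t', u') (conj t'D u'D).
move: x1 x2 x3; rewrite /= !ler_norml => /andP[? ?] /andP[? ?] /andP[? ?].
by apply/andP; split; lra.
Qed.

End modulus_algebra.

(** * Conditional processes and bridges *)

Section conditioning_algebra.
Context {R : realType}.
Variables (k : R -> R -> R) (T : nat -> R).
Hypothesis kC : forall t s, k t s = k s t.

Local Notation C := (cond_cov k T).

Lemma cond_covC j t s : C j t s = C j s t.
Proof. by elim: j t s => [|j ih] t s; rewrite /= 1?kC// (ih t s); ring. Qed.

Lemma cond_cov_coef j t S : C j t S = cond_coef k T (k t) j S.
Proof.
elim: j S => [//|j ih] S; rewrite /= -!ih /cond_weight /=; ring.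
Qed.

(** Represents the random part of the j-fold conditional process at time t as a finite functional of
    X, with the recursion of [cond_process] stripped of its constants. *)
Fixpoint cond_list (j : nat) (t : R) : seq (R * R) :=
  if j is i.+1 then
    cond_list i t ++ scale_list (- cond_weight k T j t) (cond_list i (T j))
  else [:: (1, t)].

Lemma lin_cond_list j t f : lin (cond_list j t) f = cond_coef k T f j t.
Proof.
elim: j t => [|j ih] t /=; first by rewrite lin_cons lin_nil mul1r addr0.
by rewrite lin_cat lin_scale !ih mulNr.
Qed.

Lemma supported_cond_list (D : set R) j t : D t ->
  (forall i, (1 <= i <= j)%N -> D (T i)) -> supported D (cond_list j t).
Proof.
elim: j t => [|j ih] t Dt DT /=; first exact: supported1.
have DT' i : (1 <= i <= j)%N -> D (T i).
  by move=> /andP[i1 ij]; apply: DT; rewrite i1 leqW.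
apply: supported_cat; [exact: ih|apply: supported_scale; apply: ih => //].
by apply: DT; rewrite /= leqnn.
Qed.

Variable n : nat.
Hypothesis C_gt0 : forall j, (1 <= j <= n)%N -> 0 < C j.-1 (T j) (T j).

(** Identifies k_j as the covariance of the functionals encoded by [cond_list]; the positive
    variances at the conditioning times make the cross terms collapse. *)
Lemma bil_cond_list j t s : (j <= n)%N ->
  bil k (cond_list j t) (cond_list j s) = C j t s.
Proof.
elim: j t s => [|j ih] t s jn.
  by rewrite /bil /= !lin_cons !lin_nil /= !mul1r !addr0.
have C0 : C j (T j.+1) (T j.+1) != 0 by rewrite gt_eqF// C_gt0//= jn.
rewrite /= bil_catl !bil_catr !bil_scalel !bil_scaler !ih ?(ltnW jn)//.
rewrite /cond_weight /= (cond_covC j (T j.+1) s).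
by field.
Qed.

Lemma cond_covE t s : C n t s = k t s - \sum_(1 <= l < n.+1)
  C l.-1 t (T l) / C l.-1 (T l) (T l) * C l.-1 s (T l).
Proof.
elim: n => [|j ih]; first by rewrite big_geq// subr0.
by rewrite big_nat_recr//= opprD addrA -ih.
Qed.

(** The conditional process is affine in X: its constant part is obtained by conditioning the zero
    process, taken on a one-point space. *)
Lemma cond_process_decomposition {Omega : Type} x (X : R -> Omega -> R) j t w :
  cond_process k T x X j t w =
  cond_process k T x (fun _ (_ : unit) => 0) j t tt + cond_coef k T (X^~ w) j t.
Proof. by elim: j t => [|j ih] t /=; rewrite ?add0r// !ih; ring. Qed.

Hypothesis n_gt0 : (0 < n)%N.

Lemma weight_end : cond_weight k T n (T n) = 1.
Proof. by rewrite /cond_weight mulfV// gt_eqF// C_gt0// n_gt0 leqnn. Qed.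

Lemma cond_coef_end f : cond_coef k T f n (T n) = 0.
Proof.
case: n n_gt0 weight_end => [//|j] _ /= ->; by rewrite mul1r subrr.
Qed.

Lemma cond_process_end {Omega : Type} x (X : R -> Omega -> R) w :
  cond_process k T x X n (T n) w = x n.
Proof.
case: n n_gt0 weight_end => [//|j] _ /= ->; by rewrite mul1r opprB addrCA subrr addr0.
Qed.

Lemma cond_cov_end t : C n t (T n) = 0.
Proof. by rewrite cond_cov_coef cond_coef_end. Qed.

(* The conditional covariance vanishes at time T n, so that it equals its own
   second increment there. *)
Lemma cond_cov_increments t s : C n t s =
  k t s - k t (T n) - k (T n) s + k (T n) (T n) - \sum_(1 <= l < n.+1)
    cond_coef k T (fun S => k t S - k (T n) S) l.-1 (T l) *
    cond_coef k T (fun S => k s S - k (T n) S) l.-1 (T l) / C l.-1 (T l) (T l).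
Proof.
have e u l : cond_coef k T (fun S => k u S - k (T n) S) l (T l.+1) =
    C l u (T l.+1) - C l (T n) (T l.+1).
  by rewrite -lin_cond_list linB !lin_cond_list -!cond_cov_coef.
have -> : C n t s = C n t s - C n t (T n) - C n (T n) s + C n (T n) (T n).
  by rewrite (cond_covC n (T n) s) !cond_cov_end !subr0 addr0.
rewrite [C n t s]cond_covE [C n t (T n)]cond_covE [C n (T n) s]cond_covE [C n (T n) (T n)]cond_covE.
have -> : \sum_(1 <= l < n.+1)
    cond_coef k T (fun S => k t S - k (T n) S) l.-1 (T l) *
    cond_coef k T (fun S => k s S - k (T n) S) l.-1 (T l) / C l.-1 (T l) (T l) =
  \sum_(1 <= l < n.+1) (C l.-1 t (T l) / C l.-1 (T l) (T l) * C l.-1 s (T l)) -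
  \sum_(1 <= l < n.+1) (C l.-1 t (T l) / C l.-1 (T l) (T l) * C l.-1 (T n) (T l)) -
  \sum_(1 <= l < n.+1) (C l.-1 (T n) (T l) / C l.-1 (T l) (T l) * C l.-1 s (T l)) +
  \sum_(1 <= l < n.+1) (C l.-1 (T n) (T l) / C l.-1 (T l) (T l) * C l.-1 (T n) (T l)).
  rewrite -!sumrB -big_split; apply: eq_big_nat => -[//|l] _ /=.
  by rewrite !e; ring.
ring.
Qed.

End conditioning_algebra.

Section substitution.
Context {R : realType}.

(** Pulls a functional of the process t -> lin (M t) X back to a functional of X. *)
Definition substitute (M : R -> seq (R * R)) (s : seq (R * R)) :=
  flatten [seq scale_list p.1 (M p.2) | p <- s].

Lemma lin_substitute M s f : lin (substitute M s) f = lin s (fun t => lin (M t) f).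
Proof.
elim: s => [|p s ih]; first by rewrite !lin_nil.
by rewrite /substitute /= lin_cat lin_scale -/(substitute M s) ih lin_cons.
Qed.

Lemma bil_substitute k M s : bil k (substitute M s) (substitute M s) =
  bil (fun t u => bil k (M t) (M u)) s s.
Proof.
rewrite /bil lin_substitute; congr lin; apply/funext => t.
rewrite (_ : (fun t0 => _) = (fun t0 => lin s (fun u => lin (M u) (k t0)))).
  by rewrite lin_exchange.
by apply/funext => t0; rewrite lin_substitute.
Qed.

Lemma supported_substitute (D D' : set R) M s : supported D s ->
  (forall t, D t -> supported D' (M t)) -> supported D' (substitute M s).
Proof.
move=> + h; elim: s => [//|p s ih] /supported_cons[Dp sD].
by apply: supported_cat; [apply: supported_scale; exact: h|exact: ih].
Qed.

End substitution.

(** * Expansion of the conditional and bridge covariances *)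

Section expansion.
Context {R : realType}.
Variables (k : R -> R -> R) (T : nat -> R) (n : nat).
Hypothesis kC : forall t s, k t s = k s t.
Hypothesis k_psd : forall s, supported (nneg_times (R := R)) s -> 0 <= bil k s s.
Hypothesis C_gt0 : forall j, (1 <= j <= n)%N -> 0 < cond_cov k T j.-1 (T j) (T j).
Hypothesis n_gt0 : (0 < n)%N.
Hypothesis T_gt0 : forall j, (1 <= j <= n)%N -> 0 < T j.
Variables (alpha : R) (phi : R -> R -> R) (a : R) (R1 : R -> R -> R -> R).
Variables (psi : R -> R -> R) (c : R -> R) (R2 : R -> R -> R -> R).
Hypothesis alpha_gt0 : 0 < alpha.

Local Notation C := (cond_cov k T).
Local Notation tau := (T n).
Local Notation square := (unit01 (R := R) `*` unit01 (R := R)).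

Hypothesis k_section : forall e S : R, 0 < e -> 0 <= S ->
  unif_cont1 (fun t => k (tau + e * t) S).
Hypothesis k_cont : forall e : R, 0 < e ->
  unif_cont2 (fun t s => k (tau + e * t) (tau + e * s)).
Hypothesis k_increments : forall e t s : R, 0 < e -> unit01 t -> unit01 s ->
  k (tau + e * t) (tau + e * s) - k (tau + e * t) tau - k tau (tau + e * s) + k tau tau =
  e ^+ 2 * (a ^+ 2 * t * s + phi t s * e `^ alpha + R1 e t s).
Hypothesis R1_cvg : ucvg square (fun e p => R1 e p.1 p.2 / e `^ alpha) (fun=> 0).
Hypothesis k_derivative : forall S : R, 0 < S -> forall e t : R, 0 < e -> unit01 t ->
  k (tau + e * t) S - k tau S = e * (c S * t + psi t S * e `^ alpha + R2 e t S).
Hypothesis R2_cvg : forall S : R, 0 < S ->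
  ucvg unit01 (fun e t => R2 e t S / e `^ alpha) (fun=> 0).
Hypothesis an_gt0 : 0 < cond_sq k T c a n.

Local Notation an := (cond_sq k T c a n).
Local Notation phin := (cond_phi k T c psi phi n).

Lemma tau_gt0 : 0 < tau.
Proof. by apply: T_gt0; rewrite n_gt0 leqnn. Qed.

Lemma time_ge0 e t : 0 < e -> unit01 t -> 0 <= tau + e * t.
Proof.
by move=> e0 /andP[t0 _]; rewrite addr_ge0 ?(ltW tau_gt0)// mulr_ge0// ltW.
Qed.

Lemma near_pos : \forall e \near (0 : R)^'+, 0 < e.
Proof. exact: nbhs_right_gt. Qed.

Definition psi_coef (l : nat) (t : R) : R := cond_coef k T (psi t) l.-1 (T l).

(** The remainder is kept inside the coefficient, so that the expansions are exact identities for
    each [e] and limits are taken only afterwards. *)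
Definition psi_coef_e (l : nat) (e t : R) : R :=
  cond_coef k T (fun S => psi t S + R2 e t S / e `^ alpha) l.-1 (T l).

Definition c_coef (l : nat) : R := cond_coef k T c l.-1 (T l).

Lemma coef_list_pos l : (1 <= l <= n)%N ->
  supported [set t : R | 0 < t] (cond_list k T l.-1 (T l)).
Proof.
move=> /andP[l1 ln]; apply: supported_cond_list; first by apply: T_gt0; rewrite l1.
move=> i /andP[i1 il]; apply: T_gt0; rewrite i1 (leq_trans il)//.
by rewrite (leq_trans (leq_pred l)).
Qed.

(** The times in the list are among T_1, ..., T_n and hence positive, as the expansion of k(., S)
    requires. *)
Lemma increment_coef l e t : (1 <= l <= n)%N -> 0 < e -> unit01 t ->
  cond_coef k T (fun S => k (tau + e * t) S - k tau S) l.-1 (T l) =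
  e * (c_coef l * t + e `^ alpha * psi_coef_e l e t).
Proof.
move=> ln e0 tD; rewrite /c_coef /psi_coef_e -!lin_cond_list.
rewrite -linZr -linZ -linD -linZ; apply: eq_lin (coef_list_pos l ln) _ => S S0.
rewrite k_derivative//; have p0 : 0 < e `^ alpha by rewrite powR_gt0.
by field; rewrite gt_eqF.
Qed.

Lemma psi_coef_ucvg l : (1 <= l <= n)%N ->
  ucvg unit01 (psi_coef_e l) (psi_coef l).
Proof.
move=> ln; rewrite /psi_coef_e /psi_coef.
have -> : (fun e t => cond_coef k T (fun S => psi t S + R2 e t S / e `^ alpha) l.-1 (T l))
    = (fun e t => lin (cond_list k T l.-1 (T l)) (fun S => psi t S + R2 e t S / e `^ alpha)).
  by apply/funext => e; apply/funext => t; rewrite lin_cond_list.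
have -> : (fun t => cond_coef k T (psi t) l.-1 (T l)) =
    (fun t => lin (cond_list k T l.-1 (T l)) (psi t)).
  by apply/funext => t; rewrite lin_cond_list.
apply: (ucvg_lin unit01 _ (fun e t S => psi t S + R2 e t S / e `^ alpha)) => p /(coef_list_pos l ln) S0.
have h := ucvgD unit01 _ _ _ _ (ucvg_cst unit01 (fun t => psi t p.2)) (R2_cvg _ S0).
by apply: eq_ucvg h => t _; rewrite addr0.
Qed.

Lemma coef_unif_cont1 s e : 0 < e -> supported (nneg_times (R := R)) s ->
  unif_cont1 (fun t => lin s (k (tau + e * t))).
Proof. by move=> e0 sD; apply: unif_cont1_lin => p /sD S0; exact: k_section. Qed.

(** The coefficient is a uniform limit, in t, of functions that are continuous for each [e] because
    they are expressed by the covariance. Boundedness is what products of limits require. *)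
Lemma psi_coef_bounded l : (1 <= l <= n)%N -> bounded_on unit01 (psi_coef l).
Proof.
move=> ln; apply: (ucvg_bounded unit01 _ _ (psi_coef_ucvg l ln)).
apply: filterS near_pos => e e0.
have p0 : 0 < e `^ alpha by rewrite powR_gt0.
pose L := cond_list k T l.-1 (T l).
have uc : unif_cont1 (fun t => (e `^ alpha)^-1 *
    (e^-1 * (lin L (k (tau + e * t)) - lin L (k tau)) - c_coef l * t)).
  apply: unif_cont1Z; apply: unif_cont1B; last exact: unif_cont1Z unif_cont1_id.
  apply: unif_cont1Z; apply: unif_cont1B; last exact: unif_cont1_cst.
  by apply: coef_unif_cont1 => // p /(coef_list_pos l ln) /ltW.
have [M M0 hM] := unif_cont1_bounded _ uc; exists M => // t tD.
have := hM t tD; congr (`|_| <= _).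
have := increment_coef l e t ln e0 tD; rewrite -lin_cond_list linB -/L => ->.
by field; rewrite !gt_eqF.
Qed.

Lemma powR_square_cvg {I : Type} (D : set I) : ucvg D (fun e _ => e `^ alpha) (fun=> 0).
Proof. by apply: powR_ucvg => //; exact: (fun=> 0). Qed.

(** The exact coefficient at order e^(2 + alpha). Products of two psi coefficients carry one more
    factor e^alpha, which is why they are absent from the limit phi_n. *)
Definition phi_e (e : R) (p : R * R) : R :=
  phi p.1 p.2 + R1 e p.1 p.2 / e `^ alpha - \sum_(1 <= l < n.+1)
    (c_coef l / C l.-1 (T l) (T l) *
       (psi_coef_e l e p.1 * p.2 + psi_coef_e l e p.2 * p.1) +
     e `^ alpha * ((C l.-1 (T l) (T l))^-1 *
       (psi_coef_e l e p.1 * psi_coef_e l e p.2))).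

Lemma cond_cov_expansion e t s : 0 < e -> unit01 t -> unit01 s ->
  C n (tau + e * t) (tau + e * s) =
  e ^+ 2 * (an * t * s + e `^ alpha * phi_e e (t, s)).
Proof.
move=> e0 tD sD; have p0 : 0 < e `^ alpha by rewrite powR_gt0.
rewrite (cond_cov_increments k T kC n C_gt0 n_gt0) k_increments//.
rewrite /cond_sq /phi_e /=.
have -> : \sum_(1 <= l < n.+1)
    cond_coef k T (fun S => k (tau + e * t) S - k tau S) l.-1 (T l) *
    cond_coef k T (fun S => k (tau + e * s) S - k tau S) l.-1 (T l) / C l.-1 (T l) (T l) =
  e ^+ 2 * ((\sum_(1 <= l < n.+1) c_coef l ^+ 2 / C l.-1 (T l) (T l)) * (t * s) +
    e `^ alpha * (\sum_(1 <= l < n.+1) (c_coef l / C l.-1 (T l) (T l) *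
       (psi_coef_e l e t * s + psi_coef_e l e s * t) +
     e `^ alpha * ((C l.-1 (T l) (T l))^-1 *
       (psi_coef_e l e t * psi_coef_e l e s))))).
  rewrite mulr_suml mulr_sumr -big_split mulr_sumr; apply: eq_big_nat => l /= ln.
  by rewrite !increment_coef//; ring.
move: (\sum_(_ <= _ < _) _) (\sum_(_ <= _ < _) _) => x y.
by field; rewrite gt_eqF.
Qed.

Lemma bounded_fst : bounded_on square (fun p => p.1).
Proof. by exists 1 => // p [/andP[? ?] _]; rewrite ger0_norm. Qed.

Lemma bounded_snd : bounded_on square (fun p => p.2).
Proof. by exists 1 => // p [_ /andP[? ?]]; rewrite ger0_norm. Qed.

Lemma bounded_cst {I : Type} (D : set I) (x : R) : bounded_on D (fun=> x).
Proof. by exists (`|x| + 1); [rewrite ltr_wpDl|move=> i _; rewrite lerDl]. Qed.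

Lemma phi_ucvg : ucvg square phi_e (fun p => phin p.1 p.2).
Proof.
rewrite /phi_e /cond_phi.
apply: (ucvgB _ (fun e p => phi p.1 p.2 + R1 e p.1 p.2 / e `^ alpha) _
  (fun p => phi p.1 p.2)).
  have h := ucvgD square _ _ _ _ (ucvg_cst square (fun p => phi p.1 p.2)) R1_cvg.
  by apply: eq_ucvg h => t _; rewrite addr0.
apply: ucvg_sum => l; rewrite mem_index_iota ltnS => ln.
have h1 : ucvg square (fun e p => psi_coef_e l e p.1) (fun p => psi_coef l p.1).
  by apply: (ucvg_reindex unit01 square fst) => [p []|]//; exact: psi_coef_ucvg.
have h2 : ucvg square (fun e p => psi_coef_e l e p.2) (fun p => psi_coef l p.2).
  by apply: (ucvg_reindex unit01 square snd) => [p []|]//; exact: psi_coef_ucvg.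
have [M M0 hM] := psi_coef_bounded l ln.
have b1 : bounded_on square (fun p => psi_coef l p.1) by exists M => // p [? _]; exact: hM.
have b2 : bounded_on square (fun p => psi_coef l p.2) by exists M => // p [_ ?]; exact: hM.
have h3 := ucvgM _ _ _ _ _ b1 b2 h1 h2.
have h4 := ucvgZ _ _ _ (C l.-1 (T l) (T l))^-1 h3.
have h5 := ucvgM _ _ _ _ _ (bounded_cst square 0) (bounded_onZ _ _ _ (bounded_onM _ _ _ b1 b2))
  (powR_square_cvg square) h4.
have h6 := ucvgM _ _ _ _ _ b1 bounded_snd h1 (ucvg_cst _ _).
have h7 := ucvgM _ _ _ _ _ b2 bounded_fst h2 (ucvg_cst _ _).
have h8 := ucvgZ _ _ _ (c_coef l / C l.-1 (T l) (T l)) (ucvgD _ _ _ _ _ h6 h7).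
by apply: eq_ucvg (ucvgD _ _ _ _ _ h8 h5) => p _; rewrite mul0r addr0.
Qed.

Lemma cond_section l e S : (l <= n)%N -> 0 < e -> 0 <= S ->
  unif_cont1 (fun t => C l (tau + e * t) S).
Proof.
move=> ln e0 S0; under eq_fun do rewrite cond_cov_coef -lin_cond_list.
apply: coef_unif_cont1 => //; apply: supported_cond_list => // i /andP[i1 il].
by rewrite /nneg_times /= ltW// T_gt0// i1 (leq_trans il).
Qed.

Lemma unif_cont2_sum {J : eqType} (s : seq J) (F : J -> R -> R -> R) :
  (forall j, j \in s -> unif_cont2 (F j)) -> unif_cont2 (fun t u => \sum_(j <- s) F j t u).
Proof.
elim: s => [|j s ih] h.
  by move=> e e0; exists 1 => // *; rewrite !big_nil subrr normr0 ltW.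
have -> : (fun t u => \sum_(j <- j :: s) F j t u) =
    (fun t u => F j t u + \sum_(j <- s) F j t u).
  by apply/funext => t; apply/funext => u; rewrite big_cons.
apply: unif_cont2D; first by apply: h; rewrite mem_head.
by apply: ih => j' j's; apply: h; rewrite inE j's orbT.
Qed.

Lemma cond_cov_cont e : 0 < e -> unif_cont2 (fun t s => C n (tau + e * t) (tau + e * s)).
Proof.
move=> e0; have -> : (fun t s => C n (tau + e * t) (tau + e * s)) = (fun t s =>
    k (tau + e * t) (tau + e * s) + \sum_(1 <= l < n.+1)
    (- (C l.-1 (T l) (T l))^-1) * (C l.-1 (tau + e * t) (T l) * C l.-1 (tau + e * s) (T l))).
  apply/funext => t; apply/funext => s; rewrite cond_covE -sumrN; congr (_ + _).
  by apply: eq_bigr => l _; ring.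
apply: unif_cont2D; first exact: k_cont.
apply: unif_cont2_sum => l; rewrite mem_index_iota ltnS => /andP[l1 ln].
apply: unif_cont2Z; have Tl0 : 0 <= T l by rewrite ltW// T_gt0// l1.
by apply: unif_cont2_tensor; apply: cond_section => //; rewrite (leq_trans (leq_pred l)).
Qed.

(** Solves the expansion for [phi_e], which thereby inherits symmetry and continuity from the
    conditional covariance; phi_n then receives its symmetry and its boundedness in the limit. *)
Lemma phi_e_formula e t s : 0 < e -> unit01 t -> unit01 s ->
  phi_e e (t, s) =
  (C n (tau + e * t) (tau + e * s) / e ^+ 2 - an * t * s) / e `^ alpha.
Proof.
move=> e0 tD sD; rewrite cond_cov_expansion//.
have p0 : 0 < e `^ alpha by rewrite powR_gt0.
by field; rewrite !gt_eqF.
Qed.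

Lemma phi_e_sym e t s : 0 < e -> unit01 t -> unit01 s -> phi_e e (t, s) = phi_e e (s, t).
Proof. by move=> e0 tD sD; rewrite !phi_e_formula// (cond_covC k T kC) mulrAC. Qed.

Lemma phin_sym t s : unit01 t -> unit01 s -> phin t s = phin s t.
Proof.
move=> tD sD.
have h : ucvg square (fun e p => phi_e e (p.2, p.1)) (fun p => phin p.2 p.1).
  by apply: (ucvg_reindex square square (fun p => (p.2, p.1))) phi_ucvg => p [].
have h' : ucvg square phi_e (fun p => phin p.2 p.1).
  apply: ucvg_near h; apply: filterS near_pos => e e0 [x y] [xD yD].
  exact: phi_e_sym.
exact: (ucvg_unique square _ _ _ (t, s) (conj tD sD) phi_ucvg h').
Qed.

Lemma phin_bounded : bounded_on square (fun p => phin p.1 p.2).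
Proof.
apply: (ucvg_bounded _ _ _ phi_ucvg); apply: filterS near_pos => e e0.
have p0 : 0 < e `^ alpha by rewrite powR_gt0.
have uc : unif_cont2 (fun t s => (e `^ alpha)^-1 *
    ((e ^+ 2)^-1 * C n (tau + e * t) (tau + e * s) + (- an * t) * s)).
  apply: unif_cont2Z; apply: unif_cont2D; first by apply: unif_cont2Z; exact: cond_cov_cont.
  by apply: unif_cont2_tensor; [apply: unif_cont1Z|]; exact: unif_cont1_id.
have [M M0 hM] := unif_cont2_bounded _ uc; exists M => // -[t s] [tD sD].
have := hM t s tD sD; congr (`|_| <= _); rewrite phi_e_formula//.
by rewrite mulrC [_ / e ^+ 2]mulrC !mulNr.
Qed.

Lemma scale_ucvg {I : Type} (D : set I) (F : R -> I -> R) (f : I -> R) :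
  bounded_on D f -> ucvg D F f -> ucvg D (fun e i => e `^ alpha * F e i) (fun=> 0).
Proof.
move=> bf Ff; have h := ucvgM _ _ _ _ _ (bounded_cst D 0) bf (powR_square_cvg D) Ff.
by apply: eq_ucvg h => i _; rewrite mul0r.
Qed.

Lemma phi_edge_ucvg {I : Type} (D : set I) (f g : I -> R) :
  (forall i, D i -> unit01 (f i)) -> (forall i, D i -> unit01 (g i)) ->
  ucvg D (fun e i => phi_e e (f i, g i)) (fun i => phin (f i) (g i)).
Proof.
by move=> fD gD; apply: (ucvg_reindex square D (fun i => (f i, g i))) phi_ucvg => i Di;
  split; [exact: fD|exact: gD].
Qed.

Lemma phin_edge_bounded {I : Type} (D : set I) (f g : I -> R) :
  (forall i, D i -> unit01 (f i)) -> (forall i, D i -> unit01 (g i)) ->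
  bounded_on D (fun i => phin (f i) (g i)).
Proof.
move=> fD gD; have [M M0 hM] := phin_bounded; exists M => // i Di.
by apply: (hM (f i, g i)); split; [exact: fD|exact: gD].
Qed.

Lemma denominator_ucvg {I : Type} (D : set I) :
  ucvg D (fun e _ => (an + e `^ alpha * phi_e e (1, 1))^-1) (fun=> an^-1).
Proof.
apply: (ucvgV _ _ _ an an_gt0) => //.
have h := scale_ucvg D _ _ (phin_edge_bounded D (fun=> 1) (fun=> 1)
  (fun _ _ => unit01_1) (fun _ _ => unit01_1)) (phi_edge_ucvg D (fun=> 1) (fun=> 1)
  (fun _ _ => unit01_1) (fun _ _ => unit01_1)).
by apply: eq_ucvg (ucvgD _ _ _ _ _ (ucvg_cst D (fun=> an)) h) => i _; rewrite addr0.
Qed.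

Lemma denominator_gt0 : \forall e \near (0:R)^'+, 0 < an + e `^ alpha * phi_e e (1, 1).
Proof.
have h := scale_ucvg setT _ _ (phin_edge_bounded setT (fun _ : unit => 1) (fun=> 1)
  (fun _ _ => unit01_1) (fun _ _ => unit01_1)) (phi_edge_ucvg setT (fun=> 1) (fun=> 1)
  (fun _ _ => unit01_1) (fun _ _ => unit01_1)).
have a2 : 0 < an / 2 by rewrite divr_gt0.
apply: filterS (h _ a2) => e /(_ tt I); rewrite subr0 ler_norml => /andP[? _].
by move: an_gt0; lra.
Qed.

Lemma bridge_weightE e t : 0 < e -> unit01 t -> bridge_weight k T n e t =
  (an * t + e `^ alpha * phi_e e (t, 1)) / (an + e `^ alpha * phi_e e (1, 1)).
Proof.
move=> e0 tD; rewrite /bridge_weight.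
have -> : tau + e = tau + e * 1 by rewrite mulr1.
have u1 : unit01 (1 : R) by exact: unit01_1.
rewrite !cond_cov_expansion// !mulr1 -mulf_div mulfV ?mul1r//.
by rewrite gt_eqF// exprn_gt0.
Qed.

Lemma bridge_weight_ucvg : ucvg unit01 (bridge_weight k T n) id.
Proof.
have id01 : bounded_on unit01 (fun t : R => t).
  by exists 1 => // t /andP[? ?]; rewrite ger0_norm.
have h1 := scale_ucvg unit01 _ _ (phin_edge_bounded unit01 id (fun=> 1)
  (fun _ h => h) (fun _ _ => unit01_1)) (phi_edge_ucvg unit01 id (fun=> 1)
  (fun _ h => h) (fun _ _ => unit01_1)).
have h2 := ucvgD _ _ _ _ _ (ucvg_cst unit01 (fun t => an * t)) h1.
have b2 : bounded_on unit01 (fun t : R => an * t + 0).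
  have [M M0 hM] := bounded_onZ _ an _ id01; exists M => // t tD.
  by rewrite addr0; exact: hM.
have h3 := ucvgM _ _ _ _ _ b2 (bounded_cst unit01 an^-1) h2 (denominator_ucvg unit01).
apply: ucvg_near (eq_ucvg _ _ _ _ _ h3).
  by apply: filterS near_pos => e e0 t tD; rewrite bridge_weightE.
by move=> t _ /=; rewrite addr0 mulrAC mulfV ?mul1r// gt_eqF.
Qed.

Lemma bridge_weight_limE t : unit01 t -> bridge_weight_lim k T n t = t.
Proof.
move=> tD; have h := ucvg_cvg _ _ _ _ tD bridge_weight_ucvg.
exact: (cvg_lim (@Rhausdorff R) h).
Qed.

Lemma bridge_weight_cont e : 0 < e -> unif_cont1 (bridge_weight k T n e).
Proof.
move=> e0; rewrite /bridge_weight.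
under eq_fun do rewrite mulrC.
apply: unif_cont1Z; apply: cond_section => //.
by rewrite addr_ge0 ?(ltW tau_gt0)// ltW.
Qed.

Definition bridge_list (e t : R) : seq (R * R) :=
  cond_list k T n (tau + e * t) ++
  scale_list (- bridge_weight k T n e t) (cond_list k T n (tau + e)).

Definition bridge_cov (e t s : R) : R := bil k (bridge_list e t) (bridge_list e s).

Lemma supported_bridge_list e t : 0 < e -> unit01 t ->
  supported (nneg_times (R := R)) (bridge_list e t).
Proof.
move=> e0 tD; have hT i : (1 <= i <= n)%N -> nneg_times (T i).
  by move=> /T_gt0 /ltW.
apply: supported_cat; first by apply: supported_cond_list => //; exact: time_ge0.
apply: supported_scale; apply: supported_cond_list => //.
by rewrite /nneg_times/= addr_ge0 ?(ltW tau_gt0)// ltW.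
Qed.

Lemma bridge_covE e t s : bridge_cov e t s =
  C n (tau + e * t) (tau + e * s)
  - bridge_weight k T n e s * C n (tau + e * t) (tau + e)
  - bridge_weight k T n e t * C n (tau + e * s) (tau + e)
  + bridge_weight k T n e t * bridge_weight k T n e s * C n (tau + e) (tau + e).
Proof.
rewrite /bridge_cov /bridge_list bil_catl !bil_catr !bil_scalel !bil_scaler.
rewrite !(bil_cond_list k T kC n C_gt0)// (cond_covC k T kC n (tau + e) (tau + e * s)).
ring.
Qed.

Lemma bridge_cov_cont e : 0 < e -> unif_cont2 (bridge_cov e).
Proof.
move=> e0; have w := bridge_weight_cont e e0.
have te : 0 <= tau + e by rewrite addr_ge0 ?(ltW tau_gt0)// ltW.
have x := cond_section n e (tau + e) (leqnn n) e0 te.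
have -> : bridge_cov e = fun t s => C n (tau + e * t) (tau + e * s) +
  (-1 * (C n (tau + e * t) (tau + e) * bridge_weight k T n e s) +
  (-1 * (bridge_weight k T n e t * C n (tau + e * s) (tau + e)) +
  C n (tau + e) (tau + e) * (bridge_weight k T n e t * bridge_weight k T n e s))).
  by apply/funext => t; apply/funext => s; rewrite bridge_covE; ring.
apply: unif_cont2D; first exact: cond_cov_cont.
apply: unif_cont2D; first by apply: unif_cont2Z; exact: unif_cont2_tensor.
by apply: unif_cont2D; apply: unif_cont2Z; exact: unif_cont2_tensor.
Qed.

(** The bridge covariance is C(t, s) - C(t, 1) C(s, 1) / C(1, 1). With C(t, s) = e^2 (A t s +
    e^alpha phi_e(t, s)), the terms A^2 t s cancel exactly, and [F] is the quotient of the rest by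
    e^(2 + alpha). *)
Lemma bridge_cov_ucvg : ucvg square
  (fun e p => bridge_cov e p.1 p.2 / e `^ (2 + alpha))
  (fun p => bridge_kernel phin p.1 p.2).
Proof.
have u1 : unit01 (1 : R) by exact: unit01_1.
pose F := fun e (p : R * R) => phi_e e p +
  (an * (p.1 * p.2 * phi_e e (1, 1) - p.1 * phi_e e (p.2, 1) - p.2 * phi_e e (p.1, 1)) -
   e `^ alpha * (phi_e e (p.1, 1) * phi_e e (p.2, 1))) *
  (an + e `^ alpha * phi_e e (1, 1))^-1.
have fst01 p : square p -> unit01 p.1 by case.
have snd01 p : square p -> unit01 p.2 by case.
have one01 (p : R * R) : square p -> unit01 (1 : R) by [].
have f11 := phi_edge_ucvg square (fun=> 1) (fun=> 1) one01 one01.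
have f1 := phi_edge_ucvg square fst (fun=> 1) fst01 one01.
have f2 := phi_edge_ucvg square snd (fun=> 1) snd01 one01.
have b11 := phin_edge_bounded square (fun=> 1) (fun=> 1) one01 one01.
have b1 := phin_edge_bounded square fst (fun=> 1) fst01 one01.
have b2 := phin_edge_bounded square snd (fun=> 1) snd01 one01.
have bf := bounded_onM _ _ _ bounded_fst bounded_snd.
have h1 := ucvgM _ _ _ _ _ bf b11 (ucvg_cst _ _) f11.
have h2 := ucvgM _ _ _ _ _ bounded_fst b2 (ucvg_cst _ _) f2.
have h3 := ucvgM _ _ _ _ _ bounded_snd b1 (ucvg_cst _ _) f1.
have h4 := ucvgB _ _ _ _ _ (ucvgB _ _ _ _ _ h1 h2) h3.
have h5 := scale_ucvg _ _ _ (bounded_onM _ _ _ b1 b2) (ucvgM _ _ _ _ _ b1 b2 f1 f2).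
have h6 := ucvgB _ _ _ _ _ (ucvgZ _ _ _ an h4) h5.
have bb : bounded_on square (fun p => an * (p.1 * p.2 * phin 1 1 - p.1 * phin p.2 1 -
    p.2 * phin p.1 1) - 0).
  have [M1 M10 hM1] := bounded_onM _ _ _ bf b11.
  have [M2 M20 hM2] := bounded_onM _ _ _ bounded_fst b2.
  have [M3 M30 hM3] := bounded_onM _ _ _ bounded_snd b1.
  exists (an * (M1 + M2 + M3)); first by rewrite mulr_gt0// !addr_gt0.
  move=> p Dp; rewrite subr0 normrM (gtr0_norm an_gt0) ler_pM2l//.
  have := hM1 p Dp; have := hM2 p Dp; have := hM3 p Dp; rewrite !ler_norml.
  by move=> /andP[? ?] /andP[? ?] /andP[? ?]; apply/andP; split; lra.
have h7 := ucvgM _ _ _ _ _ bb (bounded_cst square an^-1) h6 (denominator_ucvg square).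
have hF : ucvg square F (fun p => bridge_kernel phin p.1 p.2).
  have := ucvgD _ _ _ _ _ phi_ucvg h7; apply: eq_ucvg => -[t s] [tD sD] /=.
  rewrite /bridge_kernel (phin_sym 1 s)// subr0.
  by field; rewrite gt_eqF.
apply: ucvg_near hF; apply: filterS2 near_pos denominator_gt0 => e e0 den [t s] [tD sD] /=.
rewrite /F bridge_covE !bridge_weightE//=.
have -> : tau + e = tau + e * 1 by rewrite mulr1.
rewrite !cond_cov_expansion// powRD; last by apply/implyP => _; rewrite gt_eqF.
have -> : e `^ 2 = e ^+ 2 by rewrite -powR_mulrn// ltW.
have p0 : 0 < e `^ alpha by rewrite powR_gt0.
move: den p0; move: (e `^ alpha) (phi_e e (t, s)) (phi_e e (t, 1)) (phi_e e (s, 1))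
  (phi_e e (1, 1)) => p x1 x2 x3 x4 den p0.
by field; rewrite !gt_eqF.
Qed.

(** Positivity passes from the covariance of the bridge to its uniform limit, the error on a list
    [s] being at most the square of its mass times the distance of the kernels. *)
Lemma bridge_cov_kernel : cov_kernel (bridge_kernel phin).
Proof.
have u1 : unit01 (1 : R) by exact: unit01_1.
split.
- move=> t s tD sD; rewrite /bridge_kernel (phin_sym t s)// (phin_sym 1 s)//.
  by rewrite (phin_sym t 1)//; ring.
- move=> s sD; apply/ler_addgt0Pr => r r0.
  have M0 : 0 < mass s * mass s + 1 by rewrite ltr_wpDl// mulr_ge0// mass_ge0.
  have [e [e0 he]] := near_ex2 _ _ near_pos (bridge_cov_ucvg _ (divr_gt0 r0 M0)).
  pose q := fun t u => bridge_cov e t u / e `^ (2 + alpha).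
  have he' t u : unit01 t -> unit01 u ->
      `|q t u - bridge_kernel phin t u| <= r / (mass s * mass s + 1).
    by move=> tD uD; apply: (he (t, u)).
  have q0 : 0 <= bil q s s.
    have -> : bil q s s = bil (bridge_cov e) s s * (e `^ (2 + alpha))^-1.
      by rewrite /bil -linZr; congr lin; apply/funext => t; rewrite -linZr.
    rewrite mulr_ge0 ?invr_ge0 ?powR_ge0// -bil_substitute; apply: k_psd.
    by apply: (supported_substitute unit01) => // t tD; exact: supported_bridge_list.
  have := bil_le _ q (bridge_kernel phin) _ _ _ sD sD he'.
  rewrite ler_norml => /andP[_].
  have : mass s * (mass s * (r / (mass s * mass s + 1))) <= r.
    by rewrite !mulrA ler_pdivrMr// mulrC ler_pM2l// lerDl.
  lra.
- apply: ucvg_unif_cont2 bridge_cov_ucvg _; apply: filterS near_pos => e e0.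
  by under eq_fun do under eq_fun do rewrite /= mulrC; apply: unif_cont2Z;
    exact: bridge_cov_cont.
Qed.

Lemma weight_cont l e : (l < n)%N -> 0 < e ->
  unif_cont1 (fun t => cond_weight k T l.+1 (tau + e * t)).
Proof.
move=> ln e0; rewrite /cond_weight; under eq_fun do rewrite mulrC.
apply: unif_cont1Z; apply: cond_section => //; first exact: ltnW.
by apply: ltW; apply: T_gt0; rewrite ln.
Qed.

Lemma cond_process_cont {Omega : Type} x (X : R -> Omega -> R) w e j : (j <= n)%N ->
  0 < e -> unif_cont1 (fun t => X (tau + e * t) w) ->
  unif_cont1 (fun t => cond_process k T x X j (tau + e * t) w).
Proof.
move=> + e0 cX; elim: j => [//|j ih] jn /=.
apply: unif_cont1B; first exact: ih (ltnW jn).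
under eq_fun do rewrite mulrC.
by apply: unif_cont1Z; exact: weight_cont.
Qed.

Lemma cond_coef_cont f e j : (j <= n)%N -> 0 < e ->
  unif_cont1 (fun t => f (tau + e * t)) ->
  unif_cont1 (fun t => cond_coef k T f j (tau + e * t)).
Proof.
move=> + e0 cX; elim: j => [//|j ih] jn /=.
apply: unif_cont1B; first exact: ih (ltnW jn).
under eq_fun do rewrite mulrC.
by apply: unif_cont1Z; exact: weight_cont.
Qed.

Variables (x : nat -> R) (y : R).

Definition mean_process (t : R) : R :=
  cond_process k T x (fun _ (_ : unit) => 0) n t tt.

Definition bridge_mean_e (e t : R) : R := mean_process (tau + e * t) -
  bridge_weight k T n e t * (mean_process (tau + e) - y).

(** The constant part of the conditional process is continuous after T_n and starts from x_n; all
    the times involved lie within e of T_n. *)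
Lemma mean_process_ucvg {I : Type} (D : set I) (f : I -> R) :
  (forall i, D i -> unit01 (f i)) ->
  ucvg D (fun e i => mean_process (tau + e * f i)) (fun=> x n).
Proof.
move=> fD r r0.
have [h h0 hh] := cond_process_cont x (fun _ (_ : unit) => 0) tt 1 n (leqnn n) ltr01
  (unif_cont1_cst 0) r r0.
have hm : 0 < Num.min 1 h by rewrite lt_min ltr01.
have lt : \forall e \near (0 : R)^'+, e < Num.min 1 h by exact: nbhs_right_lt.
apply: filterS2 near_pos lt => e e0; rewrite lt_min => /andP[e1 eh] i Di.
have /andP[f0 f1] := fD i Di.
have ef0 : 0 <= e * f i by rewrite mulr_ge0// ltW.
have efe : e * f i <= e by rewrite ler_piMr// ltW.
have efD : unit01 (e * f i).
  by apply/andP; split => //; apply: le_trans efe _; exact: ltW.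
have := hh (e * f i) 0 efD unit01_0.
rewrite subr0 ger0_norm// mul1r mulr0 addr0 (cond_process_end k T n C_gt0 n_gt0).
by apply; apply: le_trans efe _; exact: ltW.
Qed.

Lemma bridge_mean_ucvg : ucvg unit01 bridge_mean_e (fun t => x n + t * (y - x n)).
Proof.
have h1 := mean_process_ucvg unit01 id (fun _ h => h).
have h2 := @mean_process_ucvg R unit01 (fun=> (1 : R)) (fun _ _ => unit01_1).
have h3 := ucvgB unit01 _ _ _ _ h2 (ucvg_cst unit01 (fun=> y)).
have id01 : bounded_on unit01 (@id R).
  by exists 1 => // t /andP[? ?]; rewrite ger0_norm.
have h4 := ucvgM _ _ _ _ _ id01 (bounded_cst unit01 (x n - y)) bridge_weight_ucvg h3.
apply: ucvg_near (eq_ucvg _ _ _ _ _ (ucvgB _ _ _ _ _ h1 h4)).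
  by apply: nearW => e t _; rewrite /bridge_mean_e mulr1.
by move=> t _ /=; ring.
Qed.

Lemma bridge_decomposition {Omega : Type} (X : R -> Omega -> R) w e t :
  cond_process k T x X n (tau + e * t) w -
    bridge_weight k T n e t * (cond_process k T x X n (tau + e) w - y) =
  bridge_mean_e e t + lin (bridge_list e t) (X^~ w).
Proof.
rewrite !(cond_process_decomposition k T x X) /bridge_mean_e /bridge_list.
by rewrite lin_cat lin_scale !lin_cond_list -/(mean_process _) -/(mean_process _); ring.
Qed.

End expansion.

Section moduli.
Context {R : realType}.

Lemma affine_le (tau e t : R) : 0 <= tau -> 0 < e -> unit01 t -> 0 <= tau + e * t <= tau + e.
Proof.
move=> tau0 e0 /andP[t0 t1]; rewrite addr_ge0 ?mulr_ge0 ?(ltW e0)//=.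
by rewrite lerD2l ler_piMr// ltW.
Qed.

Lemma affine_close (tau e t u h : R) : 0 < e -> `|t - u| <= h / (2 * e) -> 0 < h ->
  `|(tau + e * t) - (tau + e * u)| < h.
Proof.
move=> e0 tu h0; rewrite opprD addrACA subrr add0r -mulrBr normrM gtr0_norm//.
apply: (@le_lt_trans _ _ (e * (h / (2 * e)))); first by rewrite ler_pM2l.
have -> : e * (h / (2 * e)) = h / 2 by field; rewrite gt_eqF.
by rewrite ltr_pdivrMr// ltr_pMr// ltr1n.
Qed.

Lemma within_unif_cont1 (f : R -> R) (tau e : R) : 0 <= tau -> 0 < e ->
  {within `[0, +oo[, continuous f} -> unif_cont1 (fun t => f (tau + e * t)).
Proof.
move=> tau0 e0 cf r r0.
have cf' : {within `[0, tau + e], continuous f}.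
  apply: continuous_subspaceW cf => t /=; rewrite !in_itv/= andbT.
  by move=> /andP[].
have [h h0 hh] := heine_cantor _ _ _ (@segment_compact R 0 (tau + e)) cf' r0.
exists (h / (2 * e)); first by rewrite divr_gt0// mulr_gt0.
move=> t u tD uD tu; apply: hh; rewrite /= ?in_itv/= ?affine_le//.
by rewrite -ball_normE /=; exact: affine_close.
Qed.

Lemma within_unif_cont2 (k : R -> R -> R) (tau e tau' e' : R) : 0 <= tau -> 0 < e ->
  0 <= tau' -> 0 < e' -> continuous_cov k ->
  unif_cont2 (fun t s => k (tau + e * t) (tau' + e' * s)).
Proof.
move=> tau0 e0 tau'0 e'0 cf r r0.
pose B := (`[0, tau + e]%classic : set R) `*` (`[0, tau' + e']%classic : set R).
have cf' : {within B, continuous (fun p : R * R => k p.1 p.2)}.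
  apply: continuous_subspaceW cf => -[t s] [] /=; rewrite !in_itv/= !andbT.
  by move=> /andP[? _] /andP[].
have cB : compact B.
  by apply: compact_setX; exact: segment_compact.
have [h h0 hh] := heine_cantor B (fun p : R * R => k p.1 p.2) _ cB cf' r0.
exists (Num.min (h / (2 * e)) (h / (2 * e'))).
  by rewrite lt_min !divr_gt0// mulr_gt0.
move=> t t' u u' tD t'D uD u'D; rewrite !le_min => /andP[tt _] /andP[_ uu].
apply: (hh (tau + e * t, tau' + e' * u) (tau + e * t', tau' + e' * u')).
- by split; rewrite /= in_itv/= affine_le.
- by split; rewrite /= in_itv/= affine_le.
- by split; rewrite /= -ball_normE /=; exact: affine_close.
Qed.

Lemma within_unif_cont1_section (k : R -> R -> R) (tau e S : R) : 0 <= tau -> 0 < e ->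
  0 <= S -> continuous_cov k -> unif_cont1 (fun t => k (tau + e * t) S).
Proof.
move=> tau0 e0 S0 ck r r0.
have [h h0 hh] := within_unif_cont2 k tau e S 1 tau0 e0 S0 ltr01 ck r r0.
exists h => // t u tD uD tu.
have := hh t u 0 0 tD uD unit01_0 unit01_0 tu.
by rewrite subrr normr0 mulr0 addr0; apply; exact: ltW.
Qed.

End moduli.

(** * Proximity of the bridge to its mean *)

Section small_deviations.
Context {R : realType} {d : measure_display} {Omega : measurableType d}.
Context (P : probability Omega R) (X : R -> {RV P >-> R}).
Variables (k : R -> R -> R) (T : nat -> R) (n : nat).
Hypothesis C_gt0 : forall j, (1 <= j <= n)%N -> 0 < cond_cov k T j.-1 (T j) (T j).
Hypothesis n_gt0 : (0 < n)%N.
Hypothesis T_gt0 : forall j, (1 <= j <= n)%N -> 0 < T j.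
Hypothesis k_section : forall e S : R, 0 < e -> 0 <= S ->
  unif_cont1 (fun t => k (T n + e * t) S).
Hypothesis X_cont : forall w, unif_cont1 (fun t => X (T n + 1 * t) w).
Hypothesis weight_cvg : ucvg unit01 (bridge_weight k T n) id.

(** The window after T_n has length 1 and does not depend on [e]: the bridges for all small e are
    read off this one path. *)
Let Z (w : Omega) (t : R) : R := cond_coef k T (X^~ w) n (T n + 1 * t).

Let Z_cont w : unif_cont1 (Z w).
Proof.
exact: (cond_coef_cont k T n T_gt0 k_section (X^~ w) 1 n (leqnn n) ltr01 (X_cont w)).
Qed.

Let Z0 w : Z w 0 = 0.
Proof. by rewrite /Z mulr0 addr0; exact: (cond_coef_end k T n C_gt0 n_gt0). Qed.

Let measurable_lin_Z s : measurable_fun setT (fun w => lin s (Z w)).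
Proof.
have -> : (fun w => lin s (Z w)) = (fun w =>
    lin (substitute (fun t => cond_list k T n (T n + 1 * t)) s) (X^~ w)).
  apply/funext => w; rewrite lin_substitute; congr lin; apply/funext => t.
  by rewrite lin_cond_list.
exact: measurable_lin_process.
Qed.

(** Each path is continuous and starts from 0, so the events of small oscillation at scale 1 / (N +
    1) increase to the whole space and one of them has probability at least 1/2. Countably many node
    increments describe them, which makes them measurable. *)
Lemma start_small (eta : R) : 0 < eta -> exists2 h : R, 0 < h & exists2 A,
  measurable A /\ ((2^-1)%:E <= P A)%E &
  forall w, A w -> forall t, unit01 t -> t <= h -> `|Z w t| <= 8 * eta.
Proof.
move=> eta0; pose h (N : nat) : R := N.+1%:R^-1 / 2.
have h0 N : 0 < h N by rewrite divr_gt0.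
pose A (N : nat) := [set w | forall i, (`|lin (node_increment (2 * h N) i) (Z w)| <= eta)%R].
have mA N : measurable (A N).
  have -> : A N = \bigcap_i (setT `&` (fun w => `|lin (node_increment (2 * h N) i) (Z w)|)
      @^-1` `]-oo, eta]).
    apply/seteqP; split => w /= hw i.
      by move=> _; split => //; rewrite /= in_itv/=.
    by have := hw i I; rewrite /= in_itv/= => -[].
  apply: bigcap_measurable; first by exists 0%N.
  move=> i _; have m1 : measurable_fun setT (fun w => `|lin (node_increment (2 * h N) i) (Z w)|).
    by apply: measurableT_comp => //; exact: measurable_lin_Z.
  exact: m1.
have hh N : 2 * h N = N.+1%:R^-1 by rewrite /h mulrC divfK.
have ndA : nondecreasing_seq A.
  move=> N M NM; apply/subsetPset => w /= hw i; have := hw i.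
  rewrite /node_increment; case: unpickle => [[[l a] b]|]//.
  case: (boolP [&& (a <= l.+1)%N, (b <= l.+1)%N & `|node l a - node l b| <= 2 * h M]).
    move=> /and3P[la lb ab]; rewrite la lb /= ifT//; apply: (le_trans ab).
    by rewrite !hh lef_pV2 ?posrE// ler_nat.
  by move=> _ _; rewrite lin_nil normr0 ltW.
have cA : \bigcup_N A N = setT.
  apply/seteqP; split => // w _; have [h' h'0 hw] := Z_cont w eta eta0.
  have [N hN] := harmonic_lt _ h'0; exists N => // i.
  rewrite /node_increment; case: unpickle => [[[l a] b]|]; last first.
    by rewrite lin_nil normr0 ltW.
  case: ifP => [/and3P[la lb ab]|_]; last by rewrite lin_nil normr0 ltW.
  rewrite lin_increment; apply: hw; [exact: node_unit01|exact: node_unit01|].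
  by apply: (le_trans ab); rewrite hh; exact: hN.
have [N hN] : exists N, ((2^-1)%:E <= P (A N))%E.
  apply: contrapT => ne.
  have cv : P (A N) @[N --> \oo] --> (1%E : \bar R).
    rewrite -(probability_setT P) -cA.
    exact: (@nondecreasing_cvg_mu _ _ _ P A mA (bigcup_measurable (fun k _ => mA k)) ndA).
  have : (1 <= (2^-1)%:E :> \bar R)%E.
    rewrite -(cvg_lim (@ereal_hausdorff R) cv); apply: lime_le.
      by apply/cvg_ex; exists 1%E.
    apply: nearW => N; rewrite leNgt; apply/negP => hN; apply: ne; exists N.
    exact: ltW.
  by rewrite lee_fin; lra.
exists (h N) => //; exists (A N) => // w Aw t tD th.
have := osc_le_nodes (Z w) (fun=> 0) (fun=> 0) (h N) eta (Z_cont w) (h0 N) eta0 _ _ _ t 0 tD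
  unit01_0 _.
rewrite Z0 !subr0; apply.
- by move=> i; have := Aw i; congr (`|lin _ _| <= _); apply/funext => u; rewrite subr0.
- by move=> u uD; rewrite ?subr0 normr0 ltW.
- by move=> u u' uD u'D _; rewrite ?subr0 normr0 ltW.
- by have /andP[t0 _] := tD; rewrite ger0_norm.
Qed.

Lemma bridge_small (r : R) : 0 < r -> \forall e \near (0:R)^'+, exists2 A,
  measurable A /\ ((2^-1)%:E <= P A)%E &
  forall w, A w -> forall t, unit01 t -> `|lin (bridge_list k T n e t) (X^~ w)| <= r.
Proof.
(* Both values of the conditioned path are at most 8 r / 24 = r / 3, and the bridge weight, which is
   at most 2, multiplies the one at the end of the window. *)
move=> r0; have r240 : 0 < r / 24 by rewrite divr_gt0.
have [h h0 [A [mA PA] hA]] := start_small _ r240.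
have hm : 0 < Num.min 1 h by rewrite lt_min ltr01.
have lt : \forall e \near (0 : R)^'+, e < Num.min 1 h by exact: nbhs_right_lt.
have pos : \forall e \near (0 : R)^'+, 0 < e by exact: nbhs_right_gt.
apply: filterS3 pos lt (weight_cvg 1 ltr01) => e e0.
rewrite lt_min => /andP[e1 eh] hw; exists A => // w Aw t tD.
have E u : lin (cond_list k T n (T n + e * u)) (X^~ w) = Z w (e * u).
  by rewrite lin_cond_list /Z mul1r.
rewrite /bridge_list lin_cat lin_scale E -[e in T n + e]mulr1 E.
have eD u : unit01 u -> unit01 (e * u) /\ e * u <= h.
  move=> /andP[u0 u1]; have eu : e * u <= e by rewrite ler_piMr// ltW.
  split; last exact: le_trans eu (ltW eh).
  by rewrite /unit01/= mulr_ge0 ?(ltW e0)//=; apply: le_trans eu _; exact: ltW.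
have [x1 x2] := eD t tD; have [x3 x4] := eD 1 unit01_1.
have y1 := hA w Aw _ x1 x2; have y2 := hA w Aw _ x3 x4.
have y3 : `|bridge_weight k T n e t| <= 2.
  have := hw t tD; have /andP[t0 t1] := tD; rewrite !ler_norml.
  by move=> /andP[? ?]; apply/andP; split; lra.
have y4 : `|bridge_weight k T n e t * Z w (e * 1)| <= 2 * (8 * (r / 24)).
  by rewrite normrM; apply: ler_pM.
rewrite mulNr; apply: (le_trans (ler_normB _ _)); lra.
Qed.

End small_deviations.

(** * Large deviations of the bridge of the n-fold conditional process *)

Theorem theorem4p9 (R : realType) (d : measure_display)
    (Omega : measurableType d) (P : probability Omega R)
    (X : R -> {RV P >-> R})
    (Xgauss : gaussian_process X) (Xcentered : centered_process X)
    (Xcont : continuous_process X) (kcont : continuous_cov (cov_fun X))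
    (n : nat) (n_ge1 : (1 <= n)%N) (T : nat -> R) (T1_gt0 : 0 < T 1%N)
    (T_incr : forall j, (1 <= j < n)%N -> T j < T j.+1)
    (x : nat -> R) (y : R)
    (k_gt0 : forall j, (1 <= j <= n)%N ->
       0 < cond_cov (cov_fun X) T j.-1 (T j) (T j))
    (alpha : R) (alpha_gt0 : 0 < alpha) (alpha_le1 : alpha <= 1)
    (phi : R -> R -> R) (a : R) (R1 : R -> R -> R -> R)
    (Hcov : forall e t s : R, 0 < e -> t \in `[0, 1] -> s \in `[0, 1] ->
       covariance P (X (T n + e * t) \- X (T n)) (X (T n + e * s) \- X (T n))
       = (e ^+ 2 * (a ^+ 2 * t * s + phi t s * e `^ alpha + R1 e t s))%:E)
    (HR1 : ereal_sup [set (`|R1 e ts.1 ts.2| / e `^ alpha)%:E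
                     | ts in (`[0, 1]%classic : set R) `*` (`[0, 1]%classic : set R)] @[e --> 0^'+] --> 0%E)
    (psi : R -> R -> R) (c : R -> R) (R2 : R -> R -> R -> R)
    (Hk : forall S : R, 0 < S -> forall e t : R, 0 < e -> t \in `[0, 1] ->
       cov_fun X (T n + e * t) S - cov_fun X (T n) S
       = e * (c S * t + psi t S * e `^ alpha + R2 e t S))
    (HR2 : forall S : R, 0 < S ->
       ereal_sup [set (`|R2 e t S| / e `^ alpha)%:E
                 | t in (`[0, 1]%classic : set R)] @[e --> 0^'+] --> 0%E)
    (an_gt0 : 0 < cond_sq (cov_fun X) T c a n) :
  satisfies_LDP P (bridge (cov_fun X) T x y X n)
    (fun e => e `^ (2 + alpha))
    (rkhs_rate (bridge_kernel (cond_phi (cov_fun X) T c psi phi n))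
       (bridge_mean (cov_fun X) T (x n) y n)).
Proof.
set k := cov_fun X in kcont k_gt0 Hk an_gt0 *.
have T_gt0 : forall j, (1 <= j <= n)%N -> 0 < T j.
  elim=> [//|[|j] ih] /andP[_ jn]; first exact: T1_gt0.
  apply: lt_trans (T_incr j.+1 _); last by rewrite jn.
  by apply: ih; rewrite /= (ltnW jn).
have tau0 : 0 <= T n by apply: ltW; apply: T_gt0; rewrite n_ge1 leqnn.
have kC : forall t s, k t s = k s t by move=> t s; exact: cov_fun_sym.
have k_psd s : supported (nneg_times (R := R)) s -> 0 <= bil k s s.
  exact: (cov_fun_psd P X Xgauss Xcentered).
have k_section e S : 0 < e -> 0 <= S -> unif_cont1 (fun t => k (T n + e * t) S).
  by move=> e0 S0; exact: within_unif_cont1_section.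
have k_cont e : 0 < e -> unif_cont2 (fun t s => k (T n + e * t) (T n + e * s)).
  by move=> e0; exact: within_unif_cont2.
have itv01 (t : R) : unit01 t -> t \in `[0, 1] by move=> tD; rewrite in_itv.
have k_inc e t s : 0 < e -> unit01 t -> unit01 s ->
    k (T n + e * t) (T n + e * s) - k (T n + e * t) (T n) - k (T n) (T n + e * s) +
    k (T n) (T n) = e ^+ 2 * (a ^+ 2 * t * s + phi t s * e `^ alpha + R1 e t s).
  move=> e0 tD sD; apply: EFin_inj.
  rewrite -(Hcov e t s e0 (itv01 t tD) (itv01 s sD)) covariance_increments//.
    by have /andP[] := affine_le (T n) e t tau0 e0 tD.
  by have /andP[] := affine_le (T n) e s tau0 e0 sD.
have pos : \forall e \near (0 : R)^'+, 0 < e by exact: nbhs_right_gt.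
have R1_cvg : ucvg (unit01 (R := R) `*` unit01 (R := R))
    (fun e p => R1 e p.1 p.2 / e `^ alpha) (fun=> 0).
  move=> r r0; apply: filterS2 pos (ereal_sup_small _ _ HR1 r r0) => e e0 he p [p1 p2].
  rewrite subr0 normrM normfV (ger0_norm (powR_ge0 e alpha)).
  by apply: he; split; rewrite /= in_itv.
have k_der S : 0 < S -> forall e t, 0 < e -> unit01 t ->
    k (T n + e * t) S - k (T n) S = e * (c S * t + psi t S * e `^ alpha + R2 e t S).
  by move=> S0 e t e0 tD; apply: Hk => //; exact: itv01.
have R2_cvg S : 0 < S -> ucvg unit01 (fun e t => R2 e t S / e `^ alpha) (fun=> 0).
  move=> S0 r r0.
  apply: filterS2 pos (ereal_sup_small _ _ (HR2 S S0) r r0) => e e0 he t tD.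
  rewrite subr0 normrM normfV (ger0_norm (powR_ge0 e alpha)).
  by apply: he; rewrite /= in_itv.
have X_cont w e : 0 < e -> unif_cont1 (fun t => X (T n + e * t) w).
  by move=> e0; exact: (within_unif_cont1 (fun t => X t w)).
pose q := bridge_kernel (cond_phi k T c psi phi n).
have qK : cov_kernel q by exact: (bridge_cov_kernel k T n kC k_psd k_gt0 n_ge1 T_gt0
  alpha phi a R1 psi c R2).
have wE := bridge_weight_limE k T n kC k_gt0 n_ge1 T_gt0 alpha phi a R1 psi c R2
  alpha_gt0 k_section k_cont k_inc R1_cvg k_der R2_cvg an_gt0.
have wC := bridge_weight_ucvg k T n kC k_gt0 n_ge1 T_gt0 alpha phi a R1 psi c R2
  alpha_gt0 k_section k_cont k_inc R1_cvg k_der R2_cvg an_gt0.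
have mC := bridge_mean_ucvg k T n kC k_gt0 n_ge1 T_gt0 alpha phi a R1 psi c R2
  alpha_gt0 k_section k_cont k_inc R1_cvg k_der R2_cvg an_gt0 x y.
have KC := bridge_cov_ucvg k T n kC k_gt0 n_ge1 T_gt0 alpha phi a R1 psi c R2
  alpha_gt0 k_section k_cont k_inc R1_cvg k_der R2_cvg an_gt0.
pose mbar (t : R) := x n + t * (y - x n).
(* The limit weight is the identity, because the leading term of the conditional covariance is
   proportional to t s. *)
have -> : bridge_mean k T (x n) y n = mbar \o val.
  apply/funext => u; rewrite /bridge_mean /mbar /= wE//; exact: val_unit01.
pose m := bridge_mean_e k T n x y.
have pathE e w t : 0 < e -> unit01 t -> path (bridge k T x y X n) e w t =
    m e t + lin (bridge_list k T n e t) (fun t => X t w).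
  move=> e0 tD; rewrite /m -(bridge_decomposition k T n x y (fun t => X t)).
  pose g t := cond_process k T x X n (T n + e * t) w -
    bridge_weight k T n e t * (cond_process k T x X n (T n + e) w - y).
  have cg : unif_cont1 g.
    apply: unif_cont1B.
      exact: (cond_process_cont k T n T_gt0 k_section x X w e n (leqnn n) e0 (X_cont w e e0)).
    under eq_fun do rewrite mulrC.
    by apply: unif_cont1Z; exact: (bridge_weight_cont k T n n_ge1 T_gt0 k_section).
  (* Continuity of the bridge excludes the default value of [to_C01]. *)
  rewrite /path /bridge to_C01E; last by apply: (osc_unif_cont1 g).
  exact: (extend_id g).
apply: (gaussian_LDP P q mbar _ _ m (bridge_cov k T n)); split.
- exact: qK.
- apply: unif_cont1D; first exact: unif_cont1_cst.
  under eq_fun do rewrite mulrC.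
  by apply: unif_cont1Z; exact: unif_cont1_id.
- by move=> e e0; rewrite powR_gt0.
- have h := powR_ucvg (I := unit) setT (2 + alpha) (fun=> 0).
  by apply: (ucvg_cvg setT (fun e _ => e `^ (2 + alpha)) (fun=> 0) tt) => //; apply: h; lra.
- move=> e t e0 tD; under eq_fun do rewrite pathE//.
  by apply: measurable_funD => //; exact: measurable_lin_process.
- apply: filterS pos => e e0 s sD.
  (* A functional of the bridge is pulled back to one of X, whose moment generating function is
     known. *)
  pose s' := substitute (bridge_list k T n e) s.
  have s'D : supported (nneg_times (R := R)) s'.
    apply: (supported_substitute unit01) => // t tD.
    exact: (supported_bridge_list k T n n_ge1 T_gt0).
  have mE : measurable_fun setT (fun w => (expR (lin s' (fun t => X t w)))%:E).
    apply/measurable_EFinP; apply: measurableT_comp => //.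
    exact: measurable_lin_process.
  have pE (w : Omega) : setT w -> (0 <= (expR (lin s' (fun t => X t w)))%:E)%E.
    by rewrite lee_fin expR_ge0.
  have hz := ge0_integralZl_EFin P measurableT pE mE (expR_ge0 (lin s (m e))).
  transitivity (\int[P]_w ((expR (lin s (m e)))%:E *
      (expR (lin s' (fun t => X t w)))%:E))%E.
    apply: eq_integral => w _; rewrite -EFinM -expRD; congr ((expR _)%:E).
    rewrite lin_substitute -linD; apply: eq_lin sD _ => t tD; exact: pathE.
  rewrite [LHS]hz lin_process_mgf// -EFinM -expRD; congr ((expR (_ + _ * _))%:E).
  exact: bil_substitute.
- exact: mC.
- move=> r r0; apply: filterS (KC r r0) => e he t u tD uD.
  exact: (he (t, u) (conj tD uD)).
- move=> r r0.
  have h := bridge_small P X k T n k_gt0 n_ge1 T_gt0 k_section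
    (fun w => X_cont w 1 ltr01) wC r r0.
  apply: filterS2 pos h => e e0 [A mA hA]; exists A => // w Aw t tD.
  by rewrite pathE// addrC addKr; exact: hA.
Qed.
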